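(* Let $\theta,\rho$ be real constants with $0<\theta<\frac{1}{200}$, $\rho>32\theta$, $\rho+4\theta<\frac{11}{54}$, $\rho+\theta>0$. For a sufficiently large real $x$ put $$\delta = x^{-\theta},\quad K = \delta^{-1}\log^2 x,\quad \Delta = x^{\rho},\quad D = \frac{x^{1/2}}{\Delta K^4}.$$ Suppose $\alpha\in\mathbb{R}\setminus\mathbb{Q}$ satisfies $\left|\alpha-\frac{a}{q}\right|<\frac{1}{q^2}$ with $a\in\mathbb{Z}$, $q\in\mathbb{N}$, $(a,q)=1$. Let $\lambda(d)$, $d\le D$, be complex numbers with $\lambda(d)\ll \tau(d)$ and such that $\lambda(d)\neq 0$ only if $d$ is a well-separable number of level $D$. Let $c(k)$, $0<|k|\le K$, be complex numbers with $c(k)\ll 1$. Let $b\in\mathbb{Z}$, $\beta\in\mathbb{R}$, and define $$W(x) = \sum_{d\le D}\lambda(d)\sum_{1\le |k|\le K} c(k)\sum_{\substack{x/2\le n< x\\ n\equiv b \ (\mathrm{mod}\ d)}} e\big((\alpha n^2+\beta)k\big)\Lambda(n).$$ Then for every arbitrarily small $\varepsilon>0$, $$W \ll x^{\varepsilon}\left(\frac{xK}{\Delta^{1/32}} + \frac{xK}{q^{1/32}} + x^{15/16}K^{31/32}q^{1/32} + \frac{x\Delta^{1/2}K}{q^{1/4}} + x^{1/2}\Delta^{1/2}K^{3/4}q^{1/4}\right).$$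
   Context: A positive integer $d$ is called a well-separable number of level $D\ge 1$ if for any $H,S\ge 1$ with $HS=D$ there are integers $h\le H$, $s\le S$ with $d=hs$. $\tau(d)$ is the number of divisors of $d$, $\Lambda$ is the von Mangoldt function, $e(y)=e^{2\pi i y}$. The implied constant in the conclusion may depend on $\varepsilon$, $\theta$, $\rho$ and the implied constants in the bounds on $\lambda$ and $c$. *)

(* Defs.v *)
From mathcomp Require Import ssreflect ssrbool ssrnat seq div prime.
From Stdlib Require Import Reals ZArith.
From Coquelicot Require Import Coquelicot.

Open Scope R_scope.

Definition tau (d : nat) : nat := size (divisors d).

(* von Mangoldt: Lambda(n) = log p if n = p^k (p prime, k >= 1), else 0.
   n > 1 is a prime power iff it has exactly one prime divisor. *)
Definition vonMangoldt (n : nat) : R :=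
  match primes n with
  | [:: p] => ln (INR p)
  | _ => 0
  end.

Definition e (y : R) : C := (cos (2 * PI * y), sin (2 * PI * y)).

Definition well_separable (d : nat) (D : R) : Prop :=
  forall H S : R, 1 <= H -> 1 <= S -> H * S = D ->
    exists h s : nat, (0 < h)%nat /\ (0 < s)%nat /\ INR h <= H /\ INR s <= S /\ d = (h * s)%nat.

Fixpoint Csum (N : nat) (f : nat -> C) : C :=
  match N with
  | O => 0%C
  | S m => Cplus (Csum m f) (f m)
  end.

(* integer upper cutoff for a real bound: every natural n <= y satisfies n < ubound y *)
Definition ubound (y : R) : nat := Z.to_nat (up y).

Definition Rleb (a b : R) : bool := if Rle_dec a b then true else false.
Definition Rltb (a b : R) : bool := if Rlt_dec a b then true else false.

Definition W (x D K alpha beta : R) (b : Z) (lam : nat -> C) (c : Z -> C) : C :=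
  Csum (S (ubound D)) (fun d =>
    if (0 < d)%nat && Rleb (INR d) D then
      Cmult (lam d)
        (Csum (S (ubound K)) (fun kk =>
          if (0 < kk)%nat && Rleb (INR kk) K then
            let inner (k : Z) :=
              Cmult (c k)
                (Csum (S (ubound x)) (fun n =>
                  if Rleb (x / 2) (INR n) && Rltb (INR n) x
                     && Z.eqb (Z.modulo (Z.of_nat n - b) (Z.of_nat d)) 0
                  then Cmult (e ((alpha * (INR n) ^ 2 + beta) * IZR k))
                             (RtoC (vonMangoldt n))
                  else 0%C)) in
            Cplus (inner (Z.of_nat kk)) (inner (- Z.of_nat kk)%Z)
          else 0%C))
    else 0%C).

(* Main.v *)
(* With y = Delta^(1/32), one may assume y^64 <= q <= x^2 K / y^64: otherwise the fourth or the fifth term of the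
   bound exceeds the trivial bound x^(1+eps) K. In this range it suffices to gain a factor y, for each k separately,
   over the trivial bound. Only prime powers n contribute to moduli d not coprime to b, so these moduli are negligible.

   Vaughan's identity with V of size y^2 splits the sum into bilinear sums over products n m. In the type I sums m
   runs over an arithmetic progression and Weyl differencing applies. In the type II sums n runs over a dyadic
   interval [N, 2N) and d = h s with h <= H = min(N / y^2, D), s <= D / H, as the weights are well-separable.
   Cauchy-Schwarz with h and m outside leaves pairs (n1, s1), (n2, s2) with n1 = n2 (mod h), by coprimality with b,
   and a sum over m in a class modulo h lcm(s1, s2) with quadratic phase (n1^2 - n2^2) m^2; the diagonal n1 = n2
   saves y^2 by the choice of H. A second Weyl differencing reduces everything to counting how often
   alpha k v h^3 s^2 is close to an integer. Differencing the count twice in h and once in s makes the form linear,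
   the divisor bound collapses all variables into a single u, and the u <= Y with alpha u close to an integer are
   counted in blocks of length q. *)
From HB Require Import structures.
Require Import Defs.
From Stdlib Require Import Reals ZArith Lra Lia Psatz.
From Coquelicot Require Import Coquelicot.
From mathcomp Require Import all_boot zify.
Set Implicit Arguments. Unset Strict Implicit. Unset Printing Implicit Defensive.
Open Scope R_scope.

(** The exponent 1/32 pays for a chain of square roots, since every Cauchy-Schwarz and every
    differencing halves the exponent of the saving. A gain of [y] in the sum needs [y^2] in the Weyl
    sums and [y^4] in the count of the values [alpha k v h^3 s^2] near integers. This count needs
    [y^8] after one differencing in [h], gets [y^20] from the form [v s^2], and hence asks for
    [y^40] in the linear count. Such a saving requires classes of [m] of length [y^50], which
    [D ^ 2 * y ^ 64 <= x] provides when [H = N / y^2]. The obstacle is the range [N / y^2 > D]: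
    there [H = D], the classes of [m] are only known to have length [y^31], and the linear count
    saves no more than [y^21]. But then [S = 1], so the square [s^2] can be absorbed at bounded cost
    instead of being differenced, and [y^21] is enough. For this reason the counting lemmas treat a
    variable in two ways: a long one is differenced, since its diagonal is affordable, and a short
    one is merged with the others. *)

Ltac positivity := lazymatch goal with
  | |- 0 <= _ * _ => first [lra | apply Rmult_le_pos; positivity]
  | |- 0 < _ * _ => first [lra | apply Rmult_lt_0_compat; positivity]
  | |- 0 <= _ / _ => first [lra | apply Rmult_le_pos; positivity]
  | |- 0 < _ / _ => first [lra | apply Rdiv_lt_0_compat; positivity]
  | |- 0 < / _ => apply Rinv_0_lt_compat; positivity
  | |- 0 <= / _ => left; apply Rinv_0_lt_compat; positivity
  | |- 0 <= _ ^ _ => first [apply pow2_ge_0 | apply pow_le; positivity]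
  | |- 0 < _ ^ _ => apply pow_lt; positivity
  | |- 0 < Rpower _ _ => apply exp_pos
  | |- 0 <= INR _ => apply pos_INR
  | |- 0 <= Cmod _ => apply Cmod_ge_0
  | |- 0 <= sqrt _ => apply sqrt_pos
  | |- _ => lra
  end.

(** * Finite sums of real and complex numbers *)

Lemma leq_INR (a b : nat) : (a <= b)%N -> INR a <= INR b.
Proof. by move=> H; apply: le_INR; lia. Qed.

Lemma ltn_INR (a b : nat) : (a < b)%N -> INR a < INR b.
Proof. by move=> H; apply: lt_INR; lia. Qed.

Lemma mul_INR (a b : nat) : INR (a * b)%N = INR a * INR b.
Proof. exact: mult_INR. Qed.
Lemma add_INR (a b : nat) : INR (a + b)%N = INR a + INR b.
Proof. exact: plus_INR. Qed.
Lemma exp_INR (a n : nat) : INR (a ^ n)%N = INR a ^ n.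
Proof. by elim: n => [|n IH] //; rewrite expnS mul_INR IH. Qed.
Definition INRE := (mul_INR, add_INR, exp_INR).

HB.instance Definition _ := Monoid.isComLaw.Build R 0 Rplus
  (fun x y z => esym (Rplus_assoc x y z)) Rplus_comm Rplus_0_l.
HB.instance Definition _ := Monoid.isComLaw.Build C (RtoC 0) Cplus
  Cplus_assoc Cplus_comm Cplus_0_l.

Notation "\rsum_ ( i <- r ) F" := (\big[Rplus/0]_(i <- r) F)
  (at level 36, F at level 36, i, r at level 50, format "\rsum_ ( i  <-  r )  F") : R_scope.
Notation "\rsum_ ( m <= i < n ) F" := (\big[Rplus/0]_(m <= i < n) F)
  (at level 36, F at level 36, i, m, n at level 50, format "\rsum_ ( m  <=  i  <  n )  F") : R_scope.
Notation "\csum_ ( i <- r ) F" := (\big[Cplus/RtoC 0]_(i <- r) F)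
  (at level 36, F at level 36, i, r at level 50, format "\csum_ ( i  <-  r )  F") : R_scope.
Notation "\csum_ ( m <= i < n ) F" := (\big[Cplus/RtoC 0]_(m <= i < n) F)
  (at level 36, F at level 36, i, m, n at level 50, format "\csum_ ( m  <=  i  <  n )  F") : R_scope.

Lemma rsum_le (I : eqType) (s : seq I) (f g : I -> R) :
  (forall i, i \in s -> f i <= g i) -> \rsum_(i <- s) f i <= \rsum_(i <- s) g i.
Proof.
move=> H; rewrite big_seq [X in _ <= X]big_seq.
by elim/big_ind2: _ => // [|x1 x2 y1 y2]; lra.
Qed.

Lemma rsum_nat_le (m n : nat) (f g : nat -> R) :
  (forall i, (m <= i < n)%N -> f i <= g i) -> \rsum_(m <= i < n) f i <= \rsum_(m <= i < n) g i.
Proof. by move=> H; apply: rsum_le => i; rewrite mem_index_iota; apply: H. Qed.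

Lemma rsum_ge0 (I : eqType) (s : seq I) (f : I -> R) :
  (forall i, i \in s -> 0 <= f i) -> 0 <= \rsum_(i <- s) f i.
Proof.
move=> H; rewrite big_seq; elim/big_ind: _ => //; [lra|exact: Rplus_le_le_0_compat].
Qed.

Lemma rsum_mulr (I : Type) (s : seq I) (f : I -> R) (c : R) :
  \rsum_(i <- s) (c * f i) = c * \rsum_(i <- s) f i.
Proof. by rewrite (big_morph (Rmult c) (Rmult_plus_distr_l c) (Rmult_0_r c)). Qed.

Lemma csum_mulr (I : Type) (s : seq I) (f : I -> C) (c : C) :
  \csum_(i <- s) (Cmult c (f i)) = Cmult c (\csum_(i <- s) f i).
Proof. by rewrite (big_morph (Cmult c) (Cmult_plus_distr_l c) (Cmult_0_r c)). Qed.

Lemma rsum_recr (m n : nat) (f : nat -> R) : (m <= n)%N ->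
  \rsum_(m <= i < n.+1) f i = \rsum_(m <= i < n) f i + f n.
Proof. by move=> h; rewrite big_nat_recr. Qed.

Lemma csum_recr (m n : nat) (f : nat -> C) : (m <= n)%N ->
  \csum_(m <= i < n.+1) f i = Cplus (\csum_(m <= i < n) f i) (f n).
Proof. by move=> h; rewrite big_nat_recr. Qed.

Lemma rsum_split (I : Type) (s : seq I) (f g : I -> R) :
  \rsum_(i <- s) (f i + g i) = \rsum_(i <- s) f i + \rsum_(i <- s) g i.
Proof. exact: big_split. Qed.

Lemma csum_split (I : Type) (s : seq I) (f g : I -> C) :
  \csum_(i <- s) (Cplus (f i) (g i)) = Cplus (\csum_(i <- s) f i) (\csum_(i <- s) g i).
Proof. exact: big_split. Qed.

Lemma rsum_const (m n : nat) (c : R) : \rsum_(m <= i < n) c = INR (n - m) * c.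
Proof.
rewrite big_const_nat; elim: (n - m)%N => [|k IH]; first by rewrite /= ?Rmult_0_l.
by rewrite iterS IH S_INR /=; ring.
Qed.

Lemma rsum_seq_const (I : Type) (s : seq I) (c : R) : \rsum_(i <- s) c = INR (size s) * c.
Proof.
elim: s => [|a s IH]; first by rewrite big_nil /=; ring.
by rewrite big_cons IH (_ : size (a :: s) = (size s).+1) // S_INR; ring.
Qed.

Lemma INR_sum (I : Type) (s : seq I) (f : I -> nat) :
  INR (\sum_(i <- s) f i)%N = \rsum_(i <- s) INR (f i).
Proof. exact: (big_morph INR add_INR). Qed.

Lemma RtoC_sum (I : Type) (s : seq I) (f : I -> R) :
  RtoC (\rsum_(i <- s) f i) = \csum_(i <- s) RtoC (f i).
Proof. exact: (big_morph RtoC RtoC_plus). Qed.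

Lemma Cmod_sum (I : Type) (s : seq I) (f : I -> C) :
  Cmod (\csum_(i <- s) f i) <= \rsum_(i <- s) Cmod (f i).
Proof.
elim: s => [|a s IH]; first by rewrite !big_nil Cmod_0; lra.
by rewrite !big_cons; apply: Rle_trans (Cmod_triangle _ _) _; lra.
Qed.

Lemma Cconj_sum (I : Type) (s : seq I) (f : I -> C) :
  Cconj (\csum_(i <- s) f i) = \csum_(i <- s) Cconj (f i).
Proof.
apply: (big_morph Cconj) => [a b|]; rewrite /Cconj /Cplus /RtoC /=.
  by congr pair; ring.
by congr pair; ring.
Qed.

Lemma Re_sum (I : Type) (s : seq I) (f : I -> C) :
  Re (\csum_(i <- s) f i) = \rsum_(i <- s) Re (f i).
Proof. exact: (big_morph Re). Qed.

(** Cauchy-Schwarz against the constant 1: the sum of [(t - f i)^2] is nonnegative, and [t] is taken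
    to be the mean of [f]. *)
Lemma rsum_sqr_le (I : Type) (s : seq I) (f : I -> R) :
  (\rsum_(i <- s) f i) ^ 2 <= INR (size s) * \rsum_(i <- s) (f i) ^ 2.
Proof.
have H (t : R) : 2 * t * \rsum_(i <- s) f i <= INR (size s) * t ^ 2 + \rsum_(i <- s) (f i) ^ 2.
  elim: s => [|a s IH]; first by rewrite !big_nil /=; lra.
  rewrite !big_cons (_ : size (a :: s) = (size s).+1) // S_INR; have := pow2_ge_0 (t - f a); lra.
case: s H => [|a s] H; first by rewrite !big_nil /=; lra.
set S1 := \rsum_(i <- _) f i in H *; set S2 := \rsum_(i <- _) _ in H *.
set n := INR _ in H *.
have n0 : 0 < n by rewrite /n; apply: (ltn_INR (a := 0)).
have := H (S1 / n).
have -> : 2 * (S1 / n) * S1 = 2 * (S1 ^ 2 / n) by field; lra.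
have -> : n * (S1 / n) ^ 2 = S1 ^ 2 / n by field; lra.
move=> h; have {}h : S1 ^ 2 / n <= S2 by lra.
have -> : S1 ^ 2 = n * (S1 ^ 2 / n) by field; lra.
by apply: Rmult_le_compat_l; lra.
Qed.

(** * Counting points near integers *)

Lemma leq_sum_subset (I : eqType) (s1 s2 : seq I) (Q : I -> nat) :
  uniq s1 -> {subset s1 <= s2} -> (\sum_(i <- s1) Q i <= \sum_(i <- s2) Q i)%N.
Proof.
elim: s1 s2 => [|a s1 IH] s2 /=; first by rewrite big_nil.
case/andP=> as1 us1 sub.
have as2 : a \in s2 by apply: sub; rewrite inE eqxx.
rewrite big_cons (big_rem a as2) /= leq_add2l; apply: IH => // z zs1.
have zs2 : z \in s2 by apply: sub; rewrite inE zs1 orbT.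
have za : z != a by apply: contraNneq as1 => <-.
move: zs2; rewrite (perm_mem (perm_to_rem as2)) inE (negPf za) //.
Qed.

(** The tool for substitutions such as [s -> s ^ 2] or [t -> 2 t + a]: the image is enlarged to a
    full interval, on which the next variable can be merged. *)
Lemma leq_sum_inj (n m : nat) (f : nat -> nat) (Q : nat -> nat) :
  (forall t, (0 < t <= n)%N -> (0 < f t <= m)%N) ->
  (forall t t', (0 < t <= n)%N -> (0 < t' <= n)%N -> f t = f t' -> t = t') ->
  (\sum_(1 <= t < n.+1) Q (f t) <= \sum_(1 <= c < m.+1) Q c)%N.
Proof.
move=> fr fi; rewrite -(big_map f xpredT Q); apply: leq_sum_subset.
  rewrite map_inj_in_uniq ?iota_uniq // => t t'.
  by rewrite !mem_index_iota => H H'; apply: fi; lia.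
by move=> z /mapP [t]; rewrite !mem_index_iota => H ->; apply: fr; lia.
Qed.

Lemma sum_dvd_le (u V : nat) : (0 < u)%N -> (\sum_(1 <= v < V.+1) (v %| u) <= tau u)%N.
Proof.
move=> u0; rewrite -big_mkcond sum1_count /= -size_filter; apply: uniq_leq_size.
  by rewrite filter_uniq // iota_uniq.
by move=> v; rewrite mem_filter -dvdn_divisors // => /andP [].
Qed.

Lemma sum_eq_le (n u : nat) (f : nat -> nat) :
  (forall t t', (0 < t)%N -> (0 < t')%N -> f t = f t' -> t = t') ->
  (\sum_(1 <= t < n.+1) (f t == u) <= 1)%N.
Proof.
move=> fi; rewrite -big_mkcond sum1_count /= -size_filter.
set s := filter _ _.
have us : uniq s by rewrite filter_uniq // iota_uniq.
have : {subset s <= [:: head 0 s]}%N.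
  move=> t ts; rewrite inE; apply/eqP.
  have hs : head 0%N s \in s by move: ts; case: (s) => //= a l _; rewrite inE eqxx.
  move: ts hs; rewrite !mem_filter !mem_index_iota => /andP[/eqP e1 h1] /andP[/eqP e2 h2].
  by apply: fi; try lia; rewrite e1 e2.
by move/(uniq_leq_size us).
Qed.

(* Substituting [u = g v a] costs the number of solutions of [g v a = u], a divisor function in all uses. *)
Lemma rsum2_fiber (V A U : nat) (g : nat -> nat -> nat) (c : R) (Q : nat -> R) :
  (forall v a, (0 < v <= V)%N -> (0 < a <= A)%N -> (0 < g v a <= U)%N) ->
  (forall u, (0 < u <= U)%N ->
     INR (\sum_(1 <= v < V.+1) \sum_(1 <= a < A.+1) (g v a == u))%N <= c) ->
  (forall u, 0 <= Q u) ->
  \rsum_(1 <= v < V.+1) \rsum_(1 <= a < A.+1) Q (g v a) <= c * \rsum_(1 <= u < U.+1) Q u.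
Proof.
move=> Hg Hc Q0.
have E v a : (0 < v <= V)%N -> (0 < a <= A)%N ->
   Q (g v a) = \rsum_(1 <= u < U.+1) (Q u * INR (g v a == u)%N).
  move=> hv ha.
  have hin : g v a \in index_iota 1 U.+1 by rewrite mem_index_iota Hg.
  rewrite (bigD1_seq _ hin) ?iota_uniq //= eqxx (_ : INR true = 1) // big1; first by ring.
  by move=> i /negPf ne; rewrite eq_sym ne /= Rmult_0_r.
have -> : \rsum_(1 <= v < V.+1) \rsum_(1 <= a < A.+1) Q (g v a) =
  \rsum_(1 <= v < V.+1) \rsum_(1 <= a < A.+1) \rsum_(1 <= u < U.+1) (Q u * INR (g v a == u)%N).
  by apply: eq_big_nat => v hv; apply: eq_big_nat => a ha; apply: E; lia.
under eq_bigr do rewrite exchange_big.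
rewrite exchange_big /= -rsum_mulr; apply: rsum_nat_le => u hu.
under eq_bigr do rewrite rsum_mulr -INR_sum.
rewrite rsum_mulr -INR_sum Rmult_comm; apply: Rmult_le_compat_r => //.
by apply: Hc; lia.
Qed.

Lemma sum_mul_fiber (V A u : nat) : (0 < u)%N ->
  (\sum_(1 <= v < V.+1) \sum_(1 <= a < A.+1) (v * a == u) <= tau u)%N.
Proof.
move=> u0; apply: leq_trans (sum_dvd_le V u0).
rewrite !big_nat; apply: leq_sum => v hv.
case: (boolP (v %| u)) => dv.
  by apply: sum_eq_le => t t' _ _ /eqP; rewrite eqn_pmul2l ?(andP hv).1 // => /eqP.
rewrite big1 // => a _; case: eqP => // e; move: dv; rewrite -e dvdn_mulr //.
Qed.

(** If [lcm(s, t) = u], then [s] and [t] both divide [u]. *)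
Lemma sum_lcm_fiber (V A u : nat) : (0 < u)%N ->
  (\sum_(1 <= s < V.+1) \sum_(1 <= t < A.+1) (lcmn s t == u) <= tau u * tau u)%N.
Proof.
move=> u0; apply: leq_trans (_ : (\sum_(1 <= s < V.+1) (s %| u)) * tau u <= _)%N; last first.
  by rewrite leq_mul2r sum_dvd_le ?orbT.
rewrite big_distrl; apply: leq_sum => s _ /=.
case: (boolP (s %| u)) => hs; last first.
  by rewrite big1 // => t _; case: eqP => // e; move: hs; rewrite -e dvdn_lcml.
rewrite mul1n; apply: leq_trans (sum_dvd_le A u0); apply: leq_sum => t _.
by case: eqP => // <-; rewrite dvdn_lcmr.
Qed.

Lemma rmul_collapse (V A M : nat) (Q : nat -> R) :
  (forall u, (0 < u <= V * A)%N -> (tau u <= M)%N) -> (forall u, 0 <= Q u) ->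
  \rsum_(1 <= v < V.+1) \rsum_(1 <= a < A.+1) Q (v * a)%N
     <= INR M * \rsum_(1 <= u < (V * A).+1) Q u.
Proof.
move=> HM; apply: rsum2_fiber => [v a hv ha|u hu].
  by have := @leq_mul v a V A; lia.
apply: leq_INR; apply: leq_trans (HM u hu); apply: sum_mul_fiber; lia.
Qed.

Lemma mul_collapse (V A M : nat) (Q : nat -> nat) :
  (forall u, (0 < u <= V * A)%N -> (tau u <= M)%N) ->
  (\sum_(1 <= v < V.+1) \sum_(1 <= a < A.+1) Q (v * a)%N
     <= M * \sum_(1 <= u < (V * A).+1) Q u)%N.
Proof.
move=> HM; apply/leP; apply: INR_le; rewrite mul_INR !INR_sum.
under eq_bigr do rewrite INR_sum.
by apply: (rmul_collapse (Q := fun u => INR (Q u)) HM) => u; exact: pos_INR.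
Qed.

Lemma rsum_mul_lcm (Sn M : nat) (f : nat -> R) :
  (forall u, (0 < u <= Sn ^ 2)%N -> (tau u <= M)%N) -> (forall u, 0 <= f u) ->
  \rsum_(1 <= s < Sn.+1) \rsum_(1 <= t < Sn.+1) f (lcmn s t)
     <= INR M ^ 2 * \rsum_(1 <= u < (Sn ^ 2).+1) f u.
Proof.
move=> HM; apply: rsum2_fiber => [s t hs ht|u hu].
  rewrite lcmn_gt0 expnS expn1; apply/andP; split; first by lia.
  apply: leq_trans (_ : s * t <= _)%N; last by apply: leq_mul; lia.
  by rewrite -muln_lcm_gcd leq_pmulr // gcdn_gt0; lia.
rewrite -exp_INR; apply: leq_INR; have tM := HM u hu.
have u0 : (0 < u)%N by lia.
by apply: leq_trans (sum_lcm_fiber Sn Sn u0) _; rewrite expnS expn1 leq_mul.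
Qed.

(** A pair [t < s] is coded by [t] and the shift [a = s - t]; the range of [a] is then made
    independent of [t]. *)
Lemma triangle_sum (n : nat) (F : nat -> nat -> nat) :
  (\sum_(1 <= s < n.+1) \sum_(1 <= t < s) F t s <=
   \sum_(1 <= t < n.+1) \sum_(1 <= a < n.+1) F t (t + a))%N.
Proof.
have -> : (\sum_(1 <= s < n.+1) \sum_(1 <= t < s) F t s =
  \sum_(1 <= s < n.+1) \sum_(1 <= t < n.+1) (t < s) * F t s)%N.
  apply: eq_big_nat => s hs.
  rewrite (@big_cat_nat _ _ _ s 1 n.+1) /=; [|lia|lia].
  rewrite [X in (_ = _ + X)%N]big1_seq; last first.
    by move=> t /andP[_]; rewrite mem_index_iota => ht; rewrite ltnNge (_ : (s <= t)%N) //; lia.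
  rewrite addn0; apply: eq_big_nat => t ht; by rewrite (_ : (t < s)%N) ?mul1n //; lia.
rewrite exchange_big /= !big_nat; apply: leq_sum => t ht.
rewrite (@big_cat_nat _ _ _ t.+1 1 n.+1) /=; [|lia|lia].
rewrite big1_seq ?add0n; last first.
  by move=> s /andP[_]; rewrite mem_index_iota => hs; rewrite ltnNge (_ : (s <= t)%N) //; lia.
rewrite -{1}(add1n t) big_addn (@big_cat_nat _ _ _ (n.+1 - t) 1 n.+1) /=; [|lia|lia].
apply: leq_trans (leq_addr _ _); apply: leq_sum => a _.
by rewrite addnC; case: (_ < _)%N; rewrite ?mul1n ?mul0n.
Qed.

(** Differencing for a set: its squared size counts ordered pairs, the diagonal gives the first term
    and the symmetry of the rest the factor 2. *)
Lemma pairs_bound (n : nat) (A : pred nat) :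
  ((\sum_(1 <= s < n.+1) A s) ^ 2 <=
    \sum_(1 <= s < n.+1) A s +
    2 * \sum_(1 <= t < n.+1) \sum_(1 <= a < n.+1) (A t && A (t + a)%N))%N.
Proof.
have H : ((\sum_(1 <= s < n.+1) A s) ^ 2 =
    \sum_(1 <= s < n.+1) A s +
    2 * \sum_(1 <= s < n.+1) \sum_(1 <= t < s) (A t && A s))%N.
  elim: n => [|n IH]; first by rewrite !big_geq.
  rewrite !(@big_nat_recr _ _ _ n.+1 1) //=.
  have -> : (\sum_(1 <= i < n.+1) (A i && A n.+1) = (\sum_(1 <= i < n.+1) A i) * A n.+1)%N.
    by rewrite big_distrl; apply: eq_bigr => i _; case: (A i); case: (A n.+1).
  move: IH; set c := (\sum_(1 <= i < n.+1) A i)%N; set D := (\sum_(_ <= _ < _) _)%N.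
  by case: (A n.+1) => /= IH; nia.
rewrite H leq_add2l leq_mul2l; apply: (triangle_sum n (fun t s => (A t && A s))).
Qed.

Lemma sum_sqr_le (V : nat) (c : nat -> nat) :
  ((\sum_(1 <= v < V.+1) c v) ^ 2 <= V * \sum_(1 <= v < V.+1) (c v) ^ 2)%N.
Proof.
elim: V => [|n IH]; first by rewrite !big_geq.
rewrite !(@big_nat_recr _ _ _ n.+1 1) //=.
have : (2 * (\sum_(1 <= v < n.+1) c v) * c n.+1 <= \sum_(1 <= v < n.+1) (c v) ^ 2 + n * c n.+1 ^ 2)%N.
  elim: n {IH} (c n.+1) => [|n IH] z; first by rewrite !big_geq.
  rewrite !(@big_nat_recr _ _ _ n.+1 1) //=; have := IH z.
  set A := (\sum_(_ <= _ < _) _)%N; set B := (\sum_(_ <= _ < _) _)%N => H.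
  have : (2 * c n.+1 * z <= c n.+1 ^ 2 + z ^ 2)%N by rewrite -[(2 * _ * _)%N]mulnA nat_Cauchy.
  nia.
move: IH; set A := (\sum_(_ <= _ < _) _)%N; set B := (\sum_(_ <= _ < _) _)%N => IH H.
nia.
Qed.

Lemma RlebP (a b : R) : reflect (a <= b) (Rleb a b).
Proof. by rewrite /Rleb; case: Rle_dec => h; constructor. Qed.

Lemma RltbP (a b : R) : reflect (a < b) (Rltb a b).
Proof. by rewrite /Rltb; case: Rlt_dec => h; constructor. Qed.

(* [th] is within [eta] of an integer: [up (th - 1/2)] is an integer nearest to [th]. *)
Definition nearb (eta th : R) : bool := Rleb (Rabs (th - IZR (up (th - 1 / 2)))) eta.

Lemma nearP (eta th : R) : reflect (exists z : Z, Rabs (th - IZR z) <= eta) (nearb eta th).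
Proof.
rewrite /nearb /Rleb; case: Rle_dec => H; constructor; first by eexists; exact: H.
case=> z Hz; apply: H; apply: Rle_trans Hz.
have [h1 h2] := archimed (th - 1 / 2).
set m := up _ in h1 h2 *.
case: (Z.eq_dec m z) => [->|ne]; first lra.
have : (m <= z - 1 \/ z + 1 <= m)%Z by lia.
case=> /IZR_le; rewrite ?minus_IZR ?plus_IZR => h; split_Rabs; lra.
Qed.

Lemma near_le (e1 e2 th : R) : e1 <= e2 -> nearb e1 th -> nearb e2 th.
Proof. move=> h /nearP [z hz]; apply/nearP; exists z; lra. Qed.

Lemma near_sub (e1 e2 a b : R) : nearb e1 a -> nearb e2 b -> nearb (e1 + e2) (a - b).
Proof.
move=> /nearP [z hz] /nearP [z' hz']; apply/nearP; exists (z - z')%Z.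
rewrite minus_IZR; split_Rabs; lra.
Qed.

Lemma near_opp (e1 a : R) : nearb e1 (- a) = nearb e1 a.
Proof.
apply/nearP/nearP => -[z hz]; exists (- z)%Z; rewrite opp_IZR; split_Rabs; lra.
Qed.

Definition cnt (w eta : R) (Y : nat) : nat :=
  (\sum_(1 <= u < Y.+1) nearb eta (w * INR u))%N.
Definition cnt2 (w eta : R) (V S : nat) : nat :=
  (\sum_(1 <= v < V.+1) \sum_(1 <= s < S.+1) nearb eta (w * INR (v * s ^ 2)))%N.
Definition cnt3 (w eta : R) (V H S : nat) : nat :=
  (\sum_(1 <= v < V.+1) \sum_(1 <= h < H.+1) \sum_(1 <= s < S.+1)
     nearb eta (w * INR (v * h ^ 3 * s ^ 2)))%N.

Lemma sum_sqr_le2 (V S : nat) (c : nat -> nat -> nat) :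
  ((\sum_(1 <= v < V.+1) \sum_(1 <= s < S.+1) c v s) ^ 2 <=
   V * S * \sum_(1 <= v < V.+1) \sum_(1 <= s < S.+1) (c v s) ^ 2)%N.
Proof.
apply: leq_trans (sum_sqr_le _ _) _; rewrite -mulnA leq_mul2l; apply/orP; right.
by rewrite big_distrr /=; apply: leq_sum => v _; apply: sum_sqr_le.
Qed.

Lemma cnt2_absorb w eta V S M :
  (forall u, (0 < u <= V * S ^ 2)%N -> (tau u <= M)%N) ->
  (cnt2 w eta V S <= M * cnt w eta (V * S ^ 2))%N.
Proof.
move=> HM; rewrite /cnt2 /cnt.
apply: leq_trans (mul_collapse (fun u => nearb eta (w * INR u) : nat) HM).
apply: leq_sum => v _.
apply: (leq_sum_inj (f := fun s => s ^ 2)%N (fun c => nearb eta (w * INR (v * c)) : nat)).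
  by move=> t; rewrite expn_gt0 leq_exp2r //; lia.
by move=> t t' _ _ /eqP; rewrite eqn_exp2r // => /eqP.
Qed.

Lemma near_diff w e1 e2 (a b c : nat) : (a = b + c)%N ->
  nearb e1 (w * INR a) -> nearb e2 (w * INR b) -> nearb (e1 + e2) (w * INR c).
Proof.
move=> -> ha hb; have := near_sub ha hb; rewrite plus_INR.
by congr (is_true (nearb _ _)); ring.
Qed.

Lemma leq_bool (b c : bool) : (b -> c) -> (b <= c)%N.
Proof. by case: b; case: c => // H; have := H isT. Qed.

(* Cauchy over [v], then [v s^2 - v t^2 = v a (2 t + a)] with [a = s - t], so the square in the count
   is traded for a linear form at the cost of doubling [eta]. *)
Lemma cnt2_diff w eta V S M :
  (forall u, (0 < u <= V * S * (3 * S))%N -> (tau u <= M)%N) ->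
  ((cnt2 w eta V S) ^ 2 <=
     V * (cnt2 w eta V S + 2 * (M * (M * cnt w (eta + eta) (V * S * (3 * S))))))%N.
Proof.
move=> HM; apply: leq_trans (sum_sqr_le _ _) _.
rewrite leq_mul2l; apply/orP; right.
set W := (M * _)%N.
suff H : (\sum_(1 <= v < V.+1) \sum_(1 <= t < S.+1) \sum_(1 <= a < S.+1)
   nearb (eta + eta) (w * INR (v * a * (2 * t + a))) <= W)%N.
  apply: leq_trans (_ : cnt2 w eta V S + 2 * _ <= _)%N; last first.
    by rewrite leq_add2l leq_mul2l; exact: H.
  rewrite /cnt2 big_distrr -big_split /=; apply: leq_sum => v _.
  apply: leq_trans (pairs_bound S (fun s => nearb eta (w * INR (v * s ^ 2)))) _.
  rewrite leq_add2l leq_mul2l; apply: leq_sum => t _; apply: leq_sum => a _.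
  by apply: leq_bool => /andP [h1 h2]; apply: near_diff h2 h1; rewrite !expnS; nia.
rewrite /W.
apply: leq_trans (_ : _ <= M * \sum_(1 <= z < (V * S).+1) \sum_(1 <= c < (3 * S).+1)
   nearb (eta + eta) (w * INR (z * c)))%N _.
  apply: leq_trans (mul_collapse (fun z => \sum_(1 <= c < (3 * S).+1)
   nearb (eta + eta) (w * INR (z * c)) )%N _); last first.
    by move=> u hu; apply: HM; case: (S) hu => [|s]; nia.
  apply: leq_sum => v _; rewrite exchange_big /= !big_nat; apply: leq_sum => a ha.
  (* For [t, a <= S] the linear factor [2 t + a] is at most [3 S], whence the range [3 * S]. *)
  apply: (leq_sum_inj (f := fun t => 2 * t + a)%N (fun c => nearb (eta + eta) (w * INR (v * a * c)) : nat)); lia.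
rewrite leq_mul2l; apply/orP; right.
exact: (mul_collapse (fun u => nearb (eta + eta) (w * INR u) : nat) HM).
Qed.

Lemma cnt3_absorb w eta V H S M :
  (forall u, (0 < u <= V * H ^ 3)%N -> (tau u <= M)%N) ->
  (cnt3 w eta V H S <= M * cnt2 w eta (V * H ^ 3) S)%N.
Proof.
move=> HM; rewrite /cnt3 /cnt2.
apply: leq_trans (mul_collapse (fun u => \sum_(1 <= s < S.+1) nearb eta (w * INR (u * s ^ 2)) )%N HM).
apply: leq_sum => v _.
apply: (leq_sum_inj (f := fun s => s ^ 3)%N (fun c => \sum_(1 <= s < S.+1) nearb eta (w * INR (v * c * s ^ 2)))%N).
  by move=> t; rewrite expn_gt0 leq_exp2r //; lia.
by move=> t t' _ _ /eqP; rewrite eqn_exp2r // => /eqP.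
Qed.

(* Two differencing steps in [h] make the cube linear:
   [(t+a)^3 - t^3 = a (3t^2 + 3ta + a^2)], and differencing this in [t] with shift [b] gives [3ab (2t + a + b)]. *)
Lemma cnt3_diff w eta V H S M :
  (forall u, (0 < u <= V * H * H * (12 * H))%N -> (tau u <= M)%N) ->
  exists X : nat, 
  ((cnt3 w eta V H S) ^ 2 <= V * S * (cnt3 w eta V H S + 2 * X))%N /\
  (X ^ 2 <= V * S * H * (X + 2 * (M * (M * (M * cnt2 w (eta + eta + (eta + eta)) (V * H * H * (12 * H)) S)))))%N.
Proof.
move=> HM.
(* [X] is the count after the first differencing, with tolerance [2 eta]; the second one raises the
   tolerance to [4 eta]. *)
pose e2 := eta + eta; pose e4 := e2 + e2.
exists (\sum_(1 <= v < V.+1) \sum_(1 <= s < S.+1) \sum_(1 <= a < H.+1) \sum_(1 <= t < H.+1)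
   nearb e2 (w * INR (v * (a * (3 * t * t + 3 * t * a + a * a)) * s ^ 2)))%N.
have E : cnt3 w eta V H S = (\sum_(1 <= v < V.+1) \sum_(1 <= s < S.+1) \sum_(1 <= h < H.+1)
     nearb eta (w * INR (v * h ^ 3 * s ^ 2)))%N.
  by apply: eq_bigr => v _; rewrite exchange_big.
split.
  rewrite E; apply: leq_trans (sum_sqr_le2 _ _ _) _.
  rewrite leq_mul2l; apply/orP; right.
  rewrite big_distrr -big_split /=; apply: leq_sum => v _.
  rewrite big_distrr -big_split /=; apply: leq_sum => s _.
  apply: leq_trans (pairs_bound H (fun h => nearb eta (w * INR (v * h ^ 3 * s ^ 2)))) _.
  rewrite leq_add2l leq_mul2l exchange_big /=.
  apply: leq_sum => a _; apply: leq_sum => t _.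
  apply: leq_bool => /andP [h1 h2]; apply: near_diff h2 h1; rewrite !expnS !expn0; lia.
set X := (\sum_(1 <= v < _) _)%N.
apply: leq_trans (sum_sqr_le2 _ _ _) _.
rewrite -(mulnA (V * S)%N) leq_mul2l; apply/orP; right.
apply: leq_trans (_ : _ <= \sum_(1 <= v < V.+1) \sum_(1 <= s < S.+1)
   H * \sum_(1 <= a < H.+1) (\sum_(1 <= t < H.+1)
   nearb e2 (w * INR (v * (a * (3 * t * t + 3 * t * a + a * a)) * s ^ 2))) ^ 2)%N _.
  by apply: leq_sum => v _; apply: leq_sum => s _; apply: sum_sqr_le.
under eq_bigr do rewrite -big_distrr.
rewrite -big_distrr leq_mul2l; apply/orP; right => /=.
set W := (M * _)%N.
suff HW : (\sum_(1 <= v < V.+1) \sum_(1 <= s < S.+1) \sum_(1 <= a < H.+1) 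
   \sum_(1 <= t < H.+1) \sum_(1 <= b < H.+1)
   nearb e4 (w * INR (v * a * b * (3 * (2 * t + a + b)) * s ^ 2)) <= W)%N.
  apply: leq_trans (_ : X + 2 * _ <= _)%N; last first.
    by rewrite leq_add2l leq_mul2l; exact: HW.
  rewrite /X big_distrr -big_split /=; apply: leq_sum => v _.
  rewrite big_distrr -big_split /=; apply: leq_sum => s _.
  rewrite big_distrr -big_split /=; apply: leq_sum => a _.
  apply: leq_trans (pairs_bound H (fun t => nearb e2 (w * INR (v * (a * (3 * t * t + 3 * t * a + a * a)) * s ^ 2)))) _.
  rewrite leq_add2l leq_mul2l; apply: leq_sum => t _; apply: leq_sum => b _.
  apply: leq_bool => /andP [h1 h2]; apply: near_diff h2 h1; rewrite !expnS !expn0; lia.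
have -> : (\sum_(1 <= v < V.+1) \sum_(1 <= s < S.+1) \sum_(1 <= a < H.+1) 
   \sum_(1 <= t < H.+1) \sum_(1 <= b < H.+1)
   nearb e4 (w * INR (v * a * b * (3 * (2 * t + a + b)) * s ^ 2)) =
   \sum_(1 <= s < S.+1) \sum_(1 <= v < V.+1) \sum_(1 <= a < H.+1)
   \sum_(1 <= b < H.+1) \sum_(1 <= t < H.+1) 
   nearb e4 (w * INR (v * a * b * (3 * (2 * t + a + b)) * s ^ 2)))%N.
  rewrite exchange_big; apply: eq_bigr => s _; apply: eq_bigr => v _; apply: eq_bigr => a _.
  by rewrite exchange_big.
have -> : W = (\sum_(1 <= s < S.+1) M * (M * (M * \sum_(1 <= v < (V * H * H * (12 * H)).+1)
   nearb e4 (w * INR (v * s ^ 2)))))%N.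
  by rewrite /W /cnt2 exchange_big /= !big_distrr.
apply: leq_sum => s _.
pose Q z := nearb e4 (w * INR (z * s ^ 2)).
have HM1 u : (0 < u <= V * H)%N -> (tau u <= M)%N.
  by move=> hu; apply: HM; case: (H) hu => [|h]; nia.
have HM2 u : (0 < u <= V * H * H)%N -> (tau u <= M)%N.
  by move=> hu; apply: HM; case: (H) hu => [|h]; nia.
apply: leq_trans (leq_mul (leqnn M) (leq_mul (leqnn M) (mul_collapse Q HM))).
apply: leq_trans (leq_mul (leqnn M) (mul_collapse (fun v => \sum_(1 <= a < (12 * H).+1) Q (v * a))%N HM2)).
apply: leq_trans (mul_collapse (fun v => \sum_(1 <= b < H.+1) \sum_(1 <= a < (12 * H).+1) Q (v * b * a))%N HM1).
apply: leq_sum => v _; rewrite !big_nat; apply: leq_sum => a ha.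
rewrite !big_nat; apply: leq_sum => b hb.
(* The factor [3 (2 t + a + b)] is at most [12 H]. It is merged with [v], [a] and [b] by three uses
   of the divisor bound, which give the three factors [M]. *)
apply: (leq_sum_inj (f := fun t => 3 * (2 * t + a + b))%N (fun c => Q (v * a * b * c) : nat))%N; lia.
Qed.

(** After a differencing the count reappears on the right as its own diagonal. If [Z > d m E], the
    right side would be below [(1/d + c/d^2) Z^2], and [c + d <= d^2] makes this at most [Z^2]. *)
Lemma quad_bound (Z E m c d : R) : 0 <= E -> 1 <= m -> 0 < d -> 0 <= c -> c + d <= d ^ 2 ->
  Z ^ 2 <= E * Z + c * m ^ 2 * E ^ 2 -> Z <= d * m * E.
Proof.
move=> E0 m1 d0 c0 cd H; case: (Rle_lt_dec Z (d * m * E)) => // lt; exfalso.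
set F := d * m * E in lt.
have F0 : 0 <= F by rewrite /F; positivity.
have Z0 : 0 < Z by lra.
have h1 : d * E <= F by rewrite /F; have hh : 0 <= d * E; nra.
have h2 : d ^ 2 * Z ^ 2 <= d * (d * E) * Z + c * F ^ 2.
  have -> : d * (d * E) * Z + c * F ^ 2 = d ^ 2 * (E * Z + c * m ^ 2 * E ^ 2) by rewrite /F; ring.
  by apply: Rmult_le_compat_l => //; nra.
have h3 : d * (d * E) * Z <= d * F * Z.
  by apply: Rmult_le_compat_r; [lra|apply: Rmult_le_compat_l; lra].
have h4 : d * F * Z < d * Z * Z by apply: Rmult_lt_compat_r => //; apply: Rmult_lt_compat_l.
have h5 : c * F ^ 2 <= c * Z ^ 2 by apply: Rmult_le_compat_l => //; nra.
have h6 : (c + d) * Z ^ 2 <= d ^ 2 * Z ^ 2 by apply: Rmult_le_compat_r => //; nra.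
nra.
Qed.

Lemma leq_cnt w e1 e2 Y : e1 <= e2 -> (cnt w e1 Y <= cnt w e2 Y)%N.
Proof. by move=> h; apply: leq_sum => u _; apply: leq_bool; apply: near_le. Qed.

Lemma pow_le1 (t : R) (n m : nat) : 0 < t <= 1 -> (n <= m)%N -> t ^ m <= t ^ n.
Proof.
move=> [t0 t1] h; have -> : m = (n + (m - n))%N by lia.
rewrite pow_add; have p := pow_lt t n t0; have : t ^ (m - n) <= 1.
  elim: (m - n)%N => [|k IH] /=; first lra.
  by have := pow_lt t k t0; nra.
by have := pow_lt t (m - n) t0; nra.
Qed.

(* If [S] is short compared with [xi] the square is absorbed into [v] at the cost of a factor [S]; otherwise
   differencing reduces a saving [xi^40] for [cnt] to [xi^20]. *)
Lemma cnt2_le w eta (V S M : nat) (xi g : R) :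
  (0 < M)%N -> (0 < V)%N -> (0 < S)%N -> 0 < xi <= 1 -> 0 <= eta -> 0 <= g ->
  (forall u, (0 < u <= 3 * V * S ^ 2)%N -> (tau u <= M)%N) ->
  (forall Y, (V * S ^ 2 <= Y)%N -> INR (cnt w (eta + eta) Y) <= g * INR Y) ->
  (INR S * xi ^ 20 <= 1 /\ INR S * g <= xi ^ 20) \/ g <= xi ^ 40 ->
  INR (cnt2 w eta V S) <= 8 * INR M * INR V * INR S * xi ^ 20.
Proof.
move=> M0 V0 S0 Hxi eta0 g0 HM Hg Hcase.
have M1 : 1 <= INR M by apply: (leq_INR (a := 1)).
have V1 : 1 <= INR V by apply: (leq_INR (a := 1)).
have S1 : 1 <= INR S by apply: (leq_INR (a := 1)).
have x20 : 0 < xi ^ 20 by positivity.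
set E := INR V * INR S * xi ^ 20.
have E0 : 0 <= E by rewrite /E; positivity.
have -> : 8 * INR M * INR V * INR S * xi ^ 20 = 8 * INR M * E by rewrite /E; ring.
have Habs : INR S * g <= xi ^ 20 -> INR (cnt2 w eta V S) <= 8 * INR M * E.
  move=> H1.
  have HM' u : (0 < u <= V * S ^ 2)%N -> (tau u <= M)%N by move=> hu; apply: HM; lia.
  have := leq_INR (cnt2_absorb w eta HM').
  rewrite mul_INR => /Rle_trans; apply.
  have h2 : INR (cnt w eta (V * S ^ 2)%N) <= g * (INR V * INR S ^ 2).
    apply: Rle_trans (leq_INR (leq_cnt w (V * S ^ 2)%N (_ : eta <= eta + eta))) _; first lra.
    by apply: Rle_trans (Hg _ (leqnn _)) _; rewrite !INRE; lra.
  have h3 : g * (INR V * INR S ^ 2) <= E.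
    rewrite /E; have -> : g * (INR V * INR S ^ 2) = INR V * INR S * (INR S * g) by ring.
    by apply: Rmult_le_compat_l => //; nra.
  apply: Rle_trans (_ : INR M * E <= _); first by apply: Rmult_le_compat_l; lra.
  by nra.
case: Hcase => [[_ h]|hg]; first exact: Habs.
case: (Rle_lt_dec (INR S * xi ^ 20) 1) => HS.
  apply: Habs; have : xi ^ 40 = xi ^ 20 * xi ^ 20 by ring.
  by nra.
apply: (@quad_bound _ _ (INR M) 12) => //; [lra|lra|lra|].
have HM' u : (0 < u <= V * S * (3 * S))%N -> (tau u <= M)%N.
  by move=> hu; apply: HM; rewrite !expnS expn0; nia.
have := leq_INR (cnt2_diff w eta HM'); rewrite !INRE => HD.
have h2 := Hg (V * S * (3 * S))%N ltac:(rewrite !expnS expn0; nia).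
rewrite !INRE /= in h2.
have h3 : g * INR V * INR S ^ 2 * INR V <= E ^ 2.
  have -> : E ^ 2 = xi ^ 40 * INR V * INR S ^ 2 * INR V by rewrite /E; ring.
  do 3 (apply: Rmult_le_compat_r; first by [lra|nra]); lra.
set Z := INR (cnt2 w eta V S) in HD *; set C := INR (cnt _ _ _) in h2 HD.
have Z0 : 0 <= Z by apply: pos_INR.
have h4 : INR V <= E by rewrite /E; nra.
have h5 : INR V * Z <= E * Z by apply: Rmult_le_compat_r.
have h6 : INR V * C <= 3 * E ^ 2.
  apply: Rle_trans (Rmult_le_compat_l (INR V) _ _ _ h2) _; [lra|]; lra.
have h7 : INR M ^ 2 * (INR V * C) <= INR M ^ 2 * (3 * E ^ 2) by apply: Rmult_le_compat_l => //; nra.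
have M2E : 0 <= INR M ^ 2 * E ^ 2 by positivity.
rewrite (_ : INR 2 = 2) // in HD; lra.
Qed.

(** If [H xi^8 <= 1], the cube is absorbed: the loss [H^2 <= xi^(-16)] lowers the saving [xi^20] of
    [cnt2] to [xi^4]. Otherwise [H xi^8 > 1] makes both diagonals admissible, and the two
    differencings lower [xi^20] to [xi^8] and then to [xi^4]. They quadruple [eta] and [cnt2_le]
    doubles it once more, whence [8 * eta]; likewise [36 = 3 * 12] in the range of the divisor
    bound. *)
Lemma cnt3_le w eta (V H S M : nat) (xi g : R) :
  (0 < M)%N -> (0 < V)%N -> (0 < H)%N -> (0 < S)%N -> 0 < xi <= 1 -> 0 <= eta -> 0 <= g ->
  (forall u, (0 < u <= 36 * V * H ^ 3 * S ^ 2)%N -> (tau u <= M)%N) ->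
  (forall Y, (V * H ^ 3 * S ^ 2 <= Y)%N -> INR (cnt w (8 * eta) Y) <= g * INR Y) ->
  (INR S * xi ^ 20 <= 1 /\ INR S * g <= xi ^ 20) \/ g <= xi ^ 40 ->
  INR (cnt3 w eta V H S) <= 8 * INR M ^ 2 * (INR V * INR H * INR S) * xi ^ 4.
Proof.
move=> M0 V0 H0 S0 Hxi eta0 g0 HM Hg Hcase.
have M1 : 1 <= INR M by apply: (leq_INR (a := 1)).
have V1 : 1 <= INR V by apply: (leq_INR (a := 1)).
have S1 : 1 <= INR S by apply: (leq_INR (a := 1)).
have H1 : 1 <= INR H by apply: (leq_INR (a := 1)).
have x8 : 0 < xi ^ 8 by positivity.
have x4 : 0 < xi ^ 4 by positivity.
have VS1 : 1 <= INR V * INR S by nra.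
have VHS1 : 1 <= INR V * INR H * INR S by nra.
have x84 : xi ^ 8 <= xi ^ 4 by apply: pow_le1.
set E := INR V * INR H * INR S * xi ^ 4.
have E0 : 0 <= E by rewrite /E; positivity.
have M2 : 1 <= INR M ^ 2 by rewrite -(pow1 2); apply: pow_incr; lra.
have -> : 8 * INR M ^ 2 * (INR V * INR H * INR S) * xi ^ 4 = 8 * INR M ^ 2 * E by rewrite /E; ring.
case: (Rle_lt_dec (INR H * xi ^ 8) 1) => HH.
  have HM' u : (0 < u <= V * H ^ 3)%N -> (tau u <= M)%N.
    move=> hu; apply: HM; have : (0 < S ^ 2)%N by rewrite expn_gt0 S0.
    nia.
  have /Rle_trans := leq_INR (cnt3_absorb w eta S HM'); rewrite mul_INR; apply.
  have h := @cnt2_le w eta (V * H ^ 3)%N S M xi g M0 _ S0 Hxi eta0 g0 _ _ Hcase.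
  have {}h : INR (cnt2 w eta (V * H ^ 3) S) <= 8 * INR M * INR (V * H ^ 3) * INR S * xi ^ 20.
    apply: h; first by rewrite muln_gt0 V0 expn_gt0 H0.
      by move=> u hu; apply: HM; lia.
    move=> Y hY; apply: Rle_trans (Hg Y _); last by lia.
    by apply: leq_INR; apply: leq_cnt; lra.
  apply: Rle_trans (Rmult_le_compat_l (INR M) _ _ ltac:(lra) h) _.
  have h16 : INR H ^ 2 * xi ^ 16 <= 1.
    have -> : INR H ^ 2 * xi ^ 16 = (INR H * xi ^ 8) ^ 2 by ring.
    have p : 0 <= INR H * xi ^ 8 by positivity.
    nra.
  have -> : INR M * (8 * INR M * INR (V * H ^ 3) * INR S * xi ^ 20) =
     8 * INR M ^ 2 * (E * (INR H ^ 2 * xi ^ 16)) by rewrite !INRE /E; ring.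
  by apply: Rmult_le_compat_l; [lra|nra].
have HM' u : (0 < u <= V * H * H * (12 * H))%N -> (tau u <= M)%N.
  move=> hu; apply: HM; have : (0 < S ^ 2)%N by rewrite expn_gt0 S0.
  have -> : (36 * V * H ^ 3 = 3 * (V * H * H * (12 * H)))%N by rewrite !expnS expn0; lia.
  by nia.
have [X []] := cnt3_diff w eta S HM'.
move/leq_INR => D1 /leq_INR D2.
rewrite !INRE in D1; rewrite !INRE in D2.
have h := @cnt2_le w (eta + eta + (eta + eta)) (V * H * H * (12 * H))%N S M xi g M0 _ S0 Hxi _ g0 _ _ Hcase.
have {h} : INR (cnt2 w (eta + eta + (eta + eta)) (V * H * H * (12 * H)) S) <=
   8 * INR M * INR (V * H * H * (12 * H)) * INR S * xi ^ 20.
  apply: h; [by rewrite !muln_gt0 V0 H0|lra| |].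
    by move=> u hu; apply: HM; move: hu; rewrite !expnS !expn0; lia.
  move=> Y hY; rewrite (_ : _ + _ = 8 * eta); last by ring.
  apply: Hg; apply: leq_trans hY; rewrite !expnS !expn0; lia.
rewrite !INRE; set C := INR (cnt2 _ _ _ _) in D2 *; set x := INR X in D1 D2.
set Z := INR (cnt3 w eta V H S) in D1 *.
rewrite (_ : INR 2 = 2) // in D1; rewrite (_ : INR 2 = 2) // in D2.
rewrite (_ : INR 12 = 12); last by rewrite /=; ring.
move=> hC.
have x0 : 0 <= x by apply: pos_INR.
have Z0 : 0 <= Z by apply: pos_INR.
pose G := INR V * INR S * INR H ^ 2 * xi ^ 8.
have G0 : 0 <= G by rewrite /G; positivity.
have VSHG : INR V * INR S * INR H <= G.
  have -> : G = (INR V * INR S * INR H) * (INR H * xi ^ 8) by rewrite /G; ring.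
  have p : 1 <= INR V * INR S * INR H by nra.
  nra.
have M4 : 1 <= INR M ^ 4 by rewrite -(pow1 4); apply: pow_incr; lra.
have hx : x <= 15 * INR M ^ 2 * G.
  apply: (@quad_bound _ _ (INR M ^ 2) 192) => //; [lra|lra|lra|].
  apply: Rle_trans D2 _.
  have -> : INR V * INR S * INR H * (x + 2 * (INR M * (INR M * (INR M * C)))) =
   INR V * INR S * INR H * x + 2 * (INR V * INR S * INR H) * INR M ^ 3 * C by ring.
  have a1 : INR V * INR S * INR H * x <= G * x by apply: Rmult_le_compat_r.
  have a2 : 2 * (INR V * INR S * INR H) * INR M ^ 3 * C <=
     2 * (INR V * INR S * INR H) * INR M ^ 3 * (8 * INR M * (INR V * INR H * INR H * (12 * INR H)) * INR S * xi ^ 20).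
    apply: Rmult_le_compat_l hC; apply: Rmult_le_pos; last by positivity.
    nra.
  have a3 : 2 * (INR V * INR S * INR H) * INR M ^ 3 * (8 * INR M * (INR V * INR H * INR H * (12 * INR H)) * INR S * xi ^ 20)
    = 192 * (INR M ^ 2) ^ 2 * (G ^ 2 * xi ^ 4) by rewrite /G; ring.
  have a4 : xi ^ 4 <= 1 by rewrite -(pow_O xi); apply: pow_le1.
  have a5 : 192 * (INR M ^ 2) ^ 2 * (G ^ 2 * xi ^ 4) <= 192 * (INR M ^ 2) ^ 2 * G ^ 2.
    apply: Rmult_le_compat_l; first by nra.
    have : 0 <= G ^ 2 by positivity.
    by nra.
  lra.
apply: Rle_trans (_ : 7 * INR M * E <= _); last first.
  have : INR M <= INR M ^ 2 by nra.
  nra.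
apply: (@quad_bound _ _ (INR M) 30) => //; [lra|lra|lra|].
apply: Rle_trans D1 _.
have VSE : INR V * INR S <= E.
  have -> : E = (INR V * INR S) * (INR H * xi ^ 4) by rewrite /E; ring.
  have : 1 <= INR H * xi ^ 4 by nra.
  nra.
have b1 : INR V * INR S * Z <= E * Z by apply: Rmult_le_compat_r.
have b2 : INR V * INR S * x <= INR V * INR S * (15 * INR M ^ 2 * G) by apply: Rmult_le_compat_l; lra.
have b3 : INR V * INR S * (15 * INR M ^ 2 * G) = 15 * INR M ^ 2 * E ^ 2 by rewrite /G /E; ring.
lra.
Qed.

(* The floor of a nonnegative real (junk value [0] for negative ones). *)
Definition natfl (r : R) : nat := Z.to_nat (up r - 1).

Lemma natflP (r : R) : 0 <= r -> INR (natfl r) <= r < INR (natfl r) + 1.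
Proof.
move=> r0; have [h1 h2] := archimed r; rewrite /natfl.
have u0 : (0 < up r)%Z by apply: lt_IZR; lra.
rewrite INR_IZR_INZ Z2Nat.id; last by lia.
by rewrite minus_IZR; lra.
Qed.

Lemma le_natfl (r : R) (n : nat) : 0 <= r -> (INR n <= r <-> (n <= natfl r)%N).
Proof.
move=> r0; have [h1 h2] := natflP r0; split=> h.
  have : INR n < INR (natfl r).+1 by rewrite S_INR; lra.
  by move/INR_lt; lia.
by move/leq_INR: h; lra.
Qed.

(* On a block of length [q] the integers [a t - q z t], with [z t] the integer near [alpha t + beta],
   are pairwise distinct because [gcd a q = 1], and they lie in an interval of length [2 eta q + O(1)]. *)
Lemma block_count (alpha beta eta : R) (a : Z) (q : nat) :
  (0 < q)%N -> Z.gcd a (Z.of_nat q) = 1%Z ->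
  Rabs (alpha - IZR a / INR q) < 1 / (INR q) ^ 2 -> 0 <= eta ->
  INR (\sum_(0 <= t < q) nearb eta (alpha * INR t + beta))%N <= 2 * eta * INR q + 4.
Proof.
move=> q0 gaq Hal eta0.
have q1 : 1 <= INR q by apply: (leq_INR (a := 1)).
pose z t := up (alpha * INR t + beta - 1 / 2).
pose n t := (a * Z.of_nat t - Z.of_nat q * z t)%Z.
pose r := - beta * INR q - INR q * eta - 1.
pose lo := (up r - 1)%Z.
have [r1 r2] := archimed r.
have hlo : IZR lo <= r < IZR lo + 1 by rewrite /lo minus_IZR; lra.
have F0 : 0 <= 2 * eta * INR q + 3 by nra.
pose F := natfl (2 * eta * INR q + 3).
rewrite -big_mkcond sum1_count /= -size_filter.
set s := filter _ _.
have Hn t : t \in s -> IZR lo <= IZR (n t) <= IZR lo + (2 * eta * INR q + 3).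
  rewrite mem_filter mem_index_iota => /andP [hn ht].
  have hz : Rabs (alpha * INR t + beta - IZR (z t)) <= eta by apply/RlebP; exact: hn.
  rewrite /n minus_IZR !mult_IZR -!INR_IZR_INZ.
  have ht' : 0 <= INR t <= INR q.
    split; first exact: pos_INR.
    have tq : (t <= q)%N by lia.
    exact: leq_INR tq.
  set d := alpha - IZR a / INR q in Hal.
  have e : IZR a * INR t - INR q * IZR (z t) =
    INR q * (alpha * INR t + beta - IZR (z t)) - d * INR q * INR t - beta * INR q.
    by rewrite /d; field; lra.
  have hd : Rabs (d * INR q * INR t) <= 1.
    rewrite !Rabs_mult (Rabs_pos_eq (INR q)); last lra.
    rewrite (Rabs_pos_eq (INR t)); last lra.
    have : Rabs d * INR q * INR t <= 1 / INR q ^ 2 * INR q * INR q.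
      apply: Rmult_le_compat; try lra.
        by apply: Rmult_le_pos; [apply: Rabs_pos|lra].
      by apply: Rmult_le_compat_r; lra.
    by have -> : 1 / INR q ^ 2 * INR q * INR q = 1 by field; lra.
  have hq : Rabs (INR q * (alpha * INR t + beta - IZR (z t))) <= INR q * eta.
    by rewrite Rabs_mult Rabs_pos_eq; first apply: Rmult_le_compat_l; lra.
  rewrite e /r in hlo *; move: hd hq; split_Rabs; nra.
pose m t := Z.to_nat (n t - lo)%Z.
have mE t : t \in s -> Z.of_nat (m t) = (n t - lo)%Z.
  by move=> /Hn [h _]; rewrite /m Z2Nat.id //; have := le_IZR _ _ h; lia.
have us : uniq [seq m t | t <- s].
  rewrite map_inj_in_uniq; first by rewrite filter_uniq // iota_uniq.
  move=> t t' ts ts' e.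
  have := mE _ ts; rewrite e mE // => {}e.
  have {}e : (a * (Z.of_nat t - Z.of_nat t') = Z.of_nat q * (z t - z t'))%Z by rewrite /n in e; lia.
  have : (Z.of_nat q | Z.of_nat t - Z.of_nat t')%Z.
    apply: (Z.gauss _ a); last by rewrite Z.gcd_comm.
    by exists (z t - z t')%Z; rewrite e; ring.
  move: ts ts'; rewrite !mem_filter !mem_index_iota => /andP[_ h1] /andP[_ h2] [c hc].
  have : (-1 < c < 1)%Z by split; nia.
  nia.
have sub : {subset [seq m t | t <- s] <= iota 0 F.+1}.
  move=> _ /mapP [t ts ->]; rewrite mem_iota add0n ltnS /=.
  apply/le_natfl => //; rewrite INR_IZR_INZ (mE _ ts) minus_IZR.
  by have := Hn _ ts; lra.
have := uniq_leq_size us sub; rewrite size_map size_iota => /leq_INR.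
rewrite S_INR; have := natflP F0; rewrite -/F; lra.
Qed.

Lemma cnt_le (alpha eta : R) (a : Z) (q Y : nat) :
  (0 < q)%N -> Z.gcd a (Z.of_nat q) = 1%Z ->
  Rabs (alpha - IZR a / INR q) < 1 / (INR q) ^ 2 -> 0 <= eta ->
  INR (cnt alpha eta Y) <= (INR Y / INR q + 1) * (2 * eta * INR q + 4).
Proof.
move=> q0 gaq Hal eta0.
have q1 : 1 <= INR q by apply: (leq_INR (a := 1)).
have H : (cnt alpha eta Y <= \sum_(0 <= j < (Y %/ q).+1) \sum_(0 <= t < q)
    nearb eta (alpha * INR t + alpha * INR (j * q + 1)))%N.
  rewrite /cnt big_add1 /=.
  have -> : (\sum_(0 <= j < (Y %/ q).+1) \sum_(0 <= t < q) nearb eta (alpha * INR t + alpha * INR (j * q + 1)) =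
     \sum_(0 <= i < (Y %/ q).+1 * q) nearb eta (alpha * INR i.+1))%N.
    rewrite big_nat_mul; apply: eq_bigr => j _.
    rewrite -{2}(add0n (j * q)%N) big_addn (_ : j.+1 * q - j * q = q)%N; last by lia.
    apply: eq_bigr => t _; congr (nat_of_bool (nearb _ _)).
    by rewrite S_INR !INRE /=; ring.
  rewrite [X in (_ <= X)%N](@big_cat_nat _ _ _ Y) //=; last by have := ltn_ceil Y q0; lia.
  exact: leq_addr.
apply: Rle_trans (leq_INR H) _.
have H2 n : INR (\sum_(0 <= j < n) \sum_(0 <= t < q)
    nearb eta (alpha * INR t + alpha * INR (j * q + 1)))%N <= INR n * (2 * eta * INR q + 4).
  elim: n => [|n IH]; first by rewrite big_geq //= Rmult_0_l; lra.
  rewrite S_INR big_nat_recr //=; set A := (\sum_(0 <= j < n) _)%N; set B := (\sum_(_ <= _ < _) _)%N.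
  rewrite (add_INR A B) /B {}/A.
  have := block_count (alpha * INR (n * q + 1)) q0 gaq Hal eta0; lra.
apply: Rle_trans (H2 _) _; apply: Rmult_le_compat_r; first by nra.
rewrite S_INR; apply: Rplus_le_compat_r.
have := leq_INR (leq_trunc_div Y q); rewrite mul_INR => h.
by apply/Rle_div_r => //; lra.
Qed.

(** The factor [k] is moved into the variable: the [|k| u] are distinct integers up to [|k| Y], and
    a change of sign preserves the distance to the integers. Thus the one approximation [a / q] of
    [alpha] serves every [k]. *)
Lemma cnt_mul_le (alpha eta K : R) (a k : Z) (q Y : nat) :
  (0 < q)%N -> Z.gcd a (Z.of_nat q) = 1%Z ->
  Rabs (alpha - IZR a / INR q) < 1 / (INR q) ^ 2 -> 0 <= eta ->
  (1 <= Z.abs k)%Z -> IZR (Z.abs k) <= K ->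
  INR (cnt (alpha * IZR k) eta Y) <= (K * INR Y / INR q + 1) * (2 * eta * INR q + 4).
Proof.
move=> q0 gaq Hal eta0 k1 kK.
have q1 : 1 <= INR q by apply: (leq_INR (a := 1)).
pose m := Z.to_nat (Z.abs k).
have m0 : (0 < m)%N by rewrite /m; lia.
have mE : INR m = IZR (Z.abs k) by rewrite INR_IZR_INZ /m Z2Nat.id //; lia.
have H : (cnt (alpha * IZR k) eta Y <= cnt alpha eta (m * Y))%N.
  apply: leq_trans (leq_sum_inj (f := muln m) (fun c => nearb eta (alpha * INR c) : nat) _ _).
  - apply: leq_sum => u _; apply: leq_bool; rewrite mul_INR mE abs_IZR.
    have [h|h] : 0 <= IZR k \/ IZR k < 0 by lra.
      by rewrite Rabs_pos_eq // => h2; rewrite (_ : _ * _ = alpha * IZR k * INR u) //; ring.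
    rewrite Rabs_left // -near_opp => h2; rewrite (_ : _ * _ = - (alpha * IZR k * INR u)) //; ring.
  - by move=> t ht; rewrite muln_gt0 m0 leq_mul2l; lia.
  - by move=> t t' _ _ /eqP; rewrite eqn_pmul2l // => /eqP.
apply: Rle_trans (leq_INR H) _; apply: Rle_trans (cnt_le _ q0 gaq Hal eta0) _.
apply: Rmult_le_compat_r; first by nra.
apply: Rplus_le_compat_r; apply: Rmult_le_compat_r; first by positivity.
rewrite mul_INR mE; apply: Rmult_le_compat_r => //; exact: pos_INR.
Qed.

(** * Exponential sums: geometric sums, Weyl differencing, partial summation *)

Lemma e_add a b : e (a + b) = Cmult (e a) (e b).
Proof.
rewrite /e /Cmult /= !Rmult_plus_distr_l cos_plus sin_plus.
by congr pair; ring.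
Qed.

Lemma Cmod_e a : Cmod (e a) = 1.
Proof.
rewrite /Cmod /e /=; have := sin2_cos2 (2 * PI * a); rewrite /Rsqr => h.
by rewrite (_ : _ + _ = 1) ?sqrt_1 //; lra.
Qed.

Lemma Cconj_e a : Cconj (e a) = e (- a).
Proof. by rewrite /Cconj /e /= !Ropp_mult_distr_r_reverse cos_neg sin_neg. Qed.

Lemma e0 : e 0 = RtoC 1.
Proof. by rewrite /e Rmult_0_r cos_0 sin_0. Qed.

(** A weak form of Jordan's inequality. On [[0, 1]] the cosine is at least 1/2, so the mean value
    theorem gives [sin v >= v / 2]; beyond 1 the monotonicity of the sine is enough, as
    [PI / 2 <= 2]. *)
Lemma sin_ge (u : R) : 0 <= u <= PI / 2 -> u / 4 <= sin u.
Proof.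
have small v : 0 <= v <= 1 -> v / 2 <= sin v.
  move=> [v0 v1]; case: (Rle_lt_or_eq_dec 0 v v0) => [lt|<-]; last by rewrite sin_0; lra.
  have [c [hc [c0 c1]]] := MVT_cor2 sin cos 0 v lt (fun c _ => derivable_pt_lim_sin c).
  rewrite sin_0 !Rminus_0_r in hc; rewrite hc.
  have : 1 / 2 <= cos c; last by nra.
  have -> : c = 2 * (c / 2) by field.
  rewrite cos_2a_sin; have h1 : sin (c / 2) < c / 2 by apply: sin_lt_x; lra.
  have h2 : 0 <= sin (c / 2) by apply: sin_ge_0; have := PI2_3_2; lra.
  nra.
move=> [u0 u2]; have := PI2_3_2; have := PI_4 => p4 p3.
case: (Rle_lt_dec u 1) => h; first by have := small u; lra.
have : sin 1 <= sin u by apply: sin_incr_1; lra.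
by have := small 1; lra.
Qed.

(** The modulus of [e th - 1] equals [2 |sin (PI p)|], where [p] is the signed distance from [th] to
    a nearest integer, and [|p| <= 1/2] keeps [PI |p|] in the range of [sin_ge]. *)
Lemma e_sub1_ge (eta th : R) : ~~ nearb eta th -> eta <= Cmod (e th - 1)%C.
Proof.
move=> H.
have Hz : forall z : Z, eta < Rabs (th - IZR z).
  by move=> z; case: (Rlt_le_dec eta (Rabs (th - IZR z))) => // h; move: H => /nearP; case; exists z.
pose z := up (th - 1 / 2); have [h1 h2] := archimed (th - 1 / 2); rewrite -/z in h1 h2.
set p := th - IZR z.
have ez : e (IZR z) = RtoC 1.
  have nat_case (n : nat) : e (INR n) = RtoC 1.
    elim: n => [|n IH]; first exact: e0.
    rewrite S_INR e_add IH /e Rmult_1_r cos_2PI sin_2PI /Cmult /RtoC /=; congr pair; ring.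
  case: (Z_le_gt_dec 0 z) => hz.
    by rewrite -(Z2Nat.id z hz) -INR_IZR_INZ nat_case.
  have -> : IZR z = - INR (Z.to_nat (- z)) by rewrite INR_IZR_INZ Z2Nat.id ?opp_IZR; [ring|lia].
  rewrite -Cconj_e nat_case /Cconj /RtoC /=; congr pair; ring.
have -> : th = p + IZR z by rewrite /p; ring.
rewrite e_add ez Cmult_1_r; have := Hz z; rewrite -/p => hp.
have p1 : Rabs p <= 1 / 2 by rewrite /p; split_Rabs; lra.
have p4 := PI_4; have p3 := PI2_3_2.
have hs : Rabs p / 4 <= Rabs (sin (PI * p)) / 3.
  have hh : 0 <= PI * Rabs p <= PI / 2 by have := Rabs_pos p; nra.
  have := sin_ge hh; case: (Rcase_abs p) => hc.
    rewrite (Rabs_left p hc) Ropp_mult_distr_r_reverse sin_neg.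
    by have := Rle_abs (- sin (PI * p)); rewrite Rabs_Ropp; nra.
  rewrite (Rabs_right p hc); have := Rle_abs (sin (PI * p)); nra.
apply: Rle_trans (_ : Rabs (2 * sin (PI * p)) <= _).
  by have := Rabs_pos p; rewrite Rabs_mult (Rabs_pos_eq 2); lra.
rewrite -sqrt_Rsqr_abs /Cmod; apply: sqrt_le_1_alt.
rewrite /e /= (_ : 2 * PI * p = 2 * (PI * p)); last by ring.
rewrite cos_2a_sin sin_2a; have := sin2_cos2 (PI * p); rewrite /Rsqr => h; nra.
Qed.

Lemma geom_bound (th c eta : R) (n : nat) : 0 < eta -> ~~ nearb eta th ->
  Cmod (\csum_(0 <= t < n) e (th * INR t + c)) <= 2 / eta.
Proof.
move=> eta0 H; have h1 := e_sub1_ge H.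
set S := \csum_(_ <= _ < _) _.
have E : Cmult (e th - 1)%C S = (e (th * INR n + c) - e c)%C.
  rewrite /S; elim: n {S} => [|n IH].
    by rewrite big_geq //= Rmult_0_r Rplus_0_l; ring.
  rewrite csum_recr // Cmult_plus_distr_l IH S_INR.
  rewrite (_ : th * (INR n + 1) + c = th + (th * INR n + c)); last by ring.
  rewrite (e_add th (th * INR n + c)); ring.
have : Cmod (Cmult (e th - 1)%C S) <= 2.
  rewrite E /Cminus; apply: Rle_trans (Cmod_triangle _ _) _.
  by rewrite Cmod_opp !Cmod_e; lra.
rewrite Cmod_mult => h2; apply/Rle_div_r => //.
have := Cmod_ge_0 S; nra.
Qed.

Lemma rsum_triangle (n : nat) (F : nat -> nat -> R) :
  \rsum_(0 <= s < n) \rsum_(0 <= t < s) F t s =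
  \rsum_(1 <= l < n) \rsum_(0 <= t < n - l) F t (t + l)%N.
Proof.
elim: n => [|n IH]; first by rewrite !big_geq.
rewrite rsum_recr // IH.
have -> : \rsum_(1 <= l < n.+1) \rsum_(0 <= t < n.+1 - l) F t (t + l)%N =
  \rsum_(1 <= l < n.+1) (\rsum_(0 <= t < n - l) F t (t + l)%N + F (n - l)%N n).
  apply: eq_big_nat => l hl; rewrite subSn; last by lia.
  by rewrite rsum_recr // (_ : n - l + l = n)%N; last lia.
rewrite rsum_split.
have -> : \rsum_(1 <= l < n.+1) F (n - l)%N n = \rsum_(0 <= t < n) F t n.
  rewrite big_add1 big_nat_rev /=; apply: eq_big_nat => t ht; congr F; lia.
congr Rplus; case: n {IH} => [|n]; first by rewrite !big_geq.
by rewrite [RHS]rsum_recr // subnn [X in _ + X]big_geq // Rplus_0_r.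
Qed.

Lemma Cmod_sqr_add (a b : C) : Cmod (a + b)%C ^ 2 = Cmod a ^ 2 + Cmod b ^ 2 + 2 * Re (Cmult b (Cconj a)).
Proof. by rewrite !Cmod2_alt; case: a => a a'; case: b => b b'; rewrite /Re /Im /=; ring. Qed.

Lemma Cmod_sqr_sum_le (n : nat) (z : nat -> C) :
  Cmod (\csum_(0 <= t < n) z t) ^ 2 <=
  \rsum_(0 <= t < n) Cmod (z t) ^ 2 +
  2 * \rsum_(1 <= l < n) Cmod (\csum_(0 <= t < n - l) Cmult (z (t + l)%N) (Cconj (z t))).
Proof.
have -> : Cmod (\csum_(0 <= t < n) z t) ^ 2 = \rsum_(0 <= t < n) Cmod (z t) ^ 2 +
   2 * \rsum_(0 <= s < n) \rsum_(0 <= t < s) Re (Cmult (z s) (Cconj (z t))).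
  elim: n => [|n IH]; first by rewrite !big_geq // Cmod_0; ring.
  rewrite csum_recr // (rsum_recr (fun s => \rsum_(0 <= t < s) _)) // rsum_recr // Cmod_sqr_add IH.
  by rewrite -Re_sum csum_mulr -Cconj_sum; ring.
apply: Rplus_le_compat_l; apply: Rmult_le_compat_l; first lra.
rewrite (rsum_triangle n (fun t s => Re (Cmult (z s) (Cconj (z t))))).
by apply: rsum_le => l _; rewrite -Re_sum; exact: Rle_trans (Rle_abs _) (re_le_Cmod _).
Qed.

(* The Weyl-differenced bound: a geometric sum is at most [2 / eta] when its ratio is [eta]-far from the integers,
   and the remaining shifts are only counted. *)
Definition weylB (gam eta : R) (L : nat) : R :=
  INR L + 4 * INR L / eta + 2 * INR L * INR (cnt (2 * gam) eta L).

(** The bound sees only the leading coefficient and an upper bound [L] for the length. It therefore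
    holds for all partial sums and all starting points of a progression at once, as partial
    summation and the averaging over moduli demand. *)
Lemma weyl (gam b d eta : R) (L0 L : nat) : 0 < eta -> (L0 <= L)%N ->
  Cmod (\csum_(0 <= t < L0) e (gam * INR t ^ 2 + b * INR t + d)) ^ 2 <= weylB gam eta L.
Proof.
move=> eta0 hL; apply: Rle_trans (Cmod_sqr_sum_le _ _) _.
have L0L := leq_INR hL; have ie : 0 < / eta by positivity.
have -> : \rsum_(0 <= t < L0) Cmod (e (gam * INR t ^ 2 + b * INR t + d)) ^ 2 = INR L0.
  under eq_bigr do rewrite Cmod_e pow1.
  by rewrite rsum_const subn0 Rmult_1_r.
rewrite /weylB Rplus_assoc; apply: Rplus_le_compat => //.
apply: Rle_trans (_ : 2 * \rsum_(1 <= l < L.+1) (2 / eta + INR L * INR (nearb eta (2 * gam * INR l))) <= _).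
  apply: Rmult_le_compat_l; first lra.
  apply: Rle_trans (_ : \rsum_(1 <= l < L0) (2 / eta + INR L * INR (nearb eta (2 * gam * INR l))) <= _); last first.
    case: L0 hL {L0L} => [|k] hL.
      rewrite [X in X <= _]big_geq //; apply: rsum_ge0 => l _.
      have := pos_INR (nearb eta (2 * gam * INR l)); have := pos_INR L; rewrite /Rdiv; nra.
    rewrite [X in _ <= X](@big_cat_nat _ _ _ k.+1) //=; last by lia.
    rewrite -[X in X <= _]Rplus_0_r; apply: Rplus_le_compat_l; apply: rsum_ge0 => l _.
    have := pos_INR (nearb eta (2 * gam * INR l)); have := pos_INR L; rewrite /Rdiv; nra.
  apply: rsum_nat_le => l hl.
  have -> : \csum_(0 <= t < L0 - l) Cmult (e (gam * INR (t + l) ^ 2 + b * INR (t + l) + d))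
        (Cconj (e (gam * INR t ^ 2 + b * INR t + d)))
     = \csum_(0 <= t < L0 - l) e ((2 * gam * INR l) * INR t + (gam * INR l ^ 2 + b * INR l)).
    apply: eq_bigr => t _; rewrite Cconj_e -e_add add_INR; congr e; ring.
  case: (boolP (nearb _ _)) => hn.
    rewrite Rmult_1_r; apply: Rle_trans (Cmod_sum _ _) _.
    under eq_bigr do rewrite Cmod_e.
    rewrite rsum_const Rmult_1_r.
    have h : (L0 - l <= L)%N by lia.
    have := leq_INR h; rewrite subn0 /Rdiv; lra.
  by rewrite (_ : INR false = 0) // Rmult_0_r Rplus_0_r; apply: geom_bound.
rewrite rsum_split rsum_const rsum_mulr -INR_sum subSS subn0.
right; rewrite /cnt; field; lra.
Qed.

(** A segment of a progression is recognised by closure properties: its members are congruent, and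
    whatever lies between two members and is congruent to them is a member. No residue has to be
    computed, neither an inverse of [n] modulo [d] nor a solution of two simultaneous congruences.
    The least and the greatest member give [m0] and [L0]. *)
Lemma ap_sum (P : pred nat) (X r : nat) : (0 < r)%N ->
  (forall m, P m -> (m <= X)%N) ->
  (forall m m', P m -> P m' -> (m <= m')%N -> (r %| m' - m)%N) ->
  (forall m m' j, P m -> P m' -> (m <= j <= m')%N -> (r %| j - m)%N -> P j) ->
  exists m0 L0, [/\ (L0 <= X %/ r + 1)%N, (forall t, (t < L0)%N -> P (m0 + r * t)%N) &
    forall f : nat -> C, \csum_(0 <= m < X.+1) (if P m then f m else RtoC 0)
      = \csum_(0 <= t < L0) f (m0 + r * t)%N].
Proof.
move=> r0 Pb Pap Pc; case: (boolP (has P (iota 0 X.+1))) => [/hasP|/hasPn] H; last first.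
  exists 0%N, 0%N; split => // f; rewrite [RHS]big_geq // big1_seq // => m /andP[_].
  by rewrite mem_index_iota => hm; rewrite (negPf (H m _)) // mem_iota.
have exP : exists m, P m by case: H => m _ Pm; exists m.
case: (ex_minnP exP) => m0 Pm0 min0; case: (ex_maxnP exP Pb) => m1 Pm1 max1.
have m01 := min0 _ Pm1.
have d01 := Pap _ _ Pm0 Pm1 m01.
have inP t : (t < ((m1 - m0) %/ r).+1)%N -> P (m0 + r * t)%N.
  move=> ht; apply: (Pc m0 m1) => //; last by rewrite addKn dvdn_mulr.
  have : (r * t <= m1 - m0)%N; last by lia.
  by apply: leq_trans (leq_trunc_div (m1 - m0) r); rewrite mulnC leq_mul2r; apply/orP; right.
exists m0, ((m1 - m0) %/ r).+1; split => //.
  rewrite addn1 ltnS; apply: leq_div2r; have := Pb _ Pm1; lia.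
move=> f; rewrite -big_mkcond /= -big_filter -(big_map (fun t => m0 + r * t)%N xpredT f).
apply: perm_big; apply: uniq_perm.
- by rewrite filter_uniq // iota_uniq.
- rewrite map_inj_uniq ?iota_uniq // => t t' /eqP.
  by rewrite eqn_add2l eqn_pmul2l // => /eqP.
move=> m; rewrite mem_filter mem_index_iota; apply/andP/mapP => [[Pm _]|[t]].
  exists ((m - m0) %/ r)%N; last first.
    have := Pap _ _ Pm0 Pm (min0 _ Pm); rewrite mulnC => /divnK ->; have := min0 _ Pm; lia.
  rewrite mem_index_iota ltnS /=; apply: leq_div2r; have := max1 _ Pm; lia.
rewrite mem_index_iota => ht ->; have Pt := inP t ht; split => //.
by have := Pb _ Pt; lia.
Qed.

(** Partial summation: the increments of the increasing weight are nonnegative and telescope, so the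
    boundary term and the sum of the increments cost [Wm * B] each. The weight will be a logarithm
    or 1. *)
Lemma abel_bound (w : nat -> R) (z : nat -> C) (n : nat) (B Wm : R) :
  (forall t, (t < n)%N -> 0 <= w t <= Wm) ->
  (forall t, (t.+1 < n)%N -> w t <= w t.+1) ->
  0 <= Wm -> 0 <= B ->
  (forall m, (m <= n)%N -> Cmod (\csum_(0 <= t < m) z t) <= B) ->
  Cmod (\csum_(0 <= t < n) Cmult (RtoC (w t)) (z t)) <= 2 * Wm * B.
Proof.
move=> Hw Hmon Wm0 B0 HB.
case: n Hw Hmon HB => [|n] Hw Hmon HB.
  by rewrite big_geq // Cmod_0; nra.
pose S m := \csum_(0 <= t < m) z t.
have E m : \csum_(0 <= t < m.+1) Cmult (RtoC (w t)) (z t) =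
  (Cmult (RtoC (w m)) (S m.+1) - \csum_(0 <= t < m) Cmult (RtoC (w t.+1 - w t)) (S t.+1))%C.
  elim: m => [|m IH].
    by rewrite /S csum_recr // csum_recr // !big_geq //; ring.
  have ES : S m.+2 = (S m.+1 + z m.+1)%C by rewrite /S csum_recr.
  rewrite csum_recr // IH [in RHS]csum_recr // ES RtoC_minus.
  by ring.
rewrite E /Cminus; apply: Rle_trans (Cmod_triangle _ _) _; rewrite Cmod_opp.
have h1 : Cmod (Cmult (RtoC (w n)) (S n.+1)) <= Wm * B.
  rewrite Cmod_mult Cmod_R; have [h h'] := Hw n (ltnSn n); rewrite Rabs_pos_eq //.
  by apply: Rmult_le_compat => //; [apply: Cmod_ge_0|apply: HB].
have h2 m : (m <= n)%N -> \rsum_(0 <= t < m) (Cmod (Cmult (RtoC (w t.+1 - w t)) (S t.+1))) <= (w m - w 0%N) * B.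
  elim: m => [|m IH] hm; first by rewrite big_geq //; lra.
  rewrite rsum_recr //; have := IH (ltnW hm).
  rewrite Cmod_mult Cmod_R; have := Hmon m ltac:(lia) => h.
  rewrite Rabs_pos_eq; last lra.
  have := HB m.+1 ltac:(lia); rewrite -/(S _) => h3.
  have : (w m.+1 - w m) * Cmod (S m.+1) <= (w m.+1 - w m) * B by apply: Rmult_le_compat_l; lra.
  lra.
have h3 := h2 n (leqnn n).
have := Cmod_sum (index_iota 0 n) (fun t => Cmult (RtoC (w t.+1 - w t)) (S t.+1)).
have [a1 a2] := Hw n (ltnSn n); have [b1 b2] := Hw 0%N (ltn0Sn n).
have : (w n - w 0%N) * B <= Wm * B by apply: Rmult_le_compat_r => //; lra.
lra.
Qed.

Lemma weylB_ge0 gam eta L : 0 < eta -> 0 <= weylB gam eta L.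
Proof.
move=> h; rewrite /weylB; have := pos_INR L; have := pos_INR (cnt (2 * gam) eta L).
have := Rinv_0_lt_compat _ h => h1 h2 h3; rewrite /Rdiv.
have : 0 <= INR L * / eta by nra.
nra.
Qed.

(** On [m = m0 + r t] the leading coefficient becomes [w r^2]; the unknown [m0] enters only the
    lower terms, which the bound of [weyl] does not see. *)
Lemma inner_bound (P : pred nat) (X r L : nat) (w eta Wm : R) (wt : nat -> R) :
  (0 < r)%N -> 0 < eta -> (X %/ r + 1 <= L)%N ->
  (forall m, P m -> (m <= X)%N) ->
  (forall m m', P m -> P m' -> (m <= m')%N -> (r %| m' - m)%N) ->
  (forall m m' j, P m -> P m' -> (m <= j <= m')%N -> (r %| j - m)%N -> P j) ->
  (forall m, P m -> 0 <= wt m <= Wm) ->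
  (forall m m', (m <= m')%N -> wt m <= wt m') -> 0 <= Wm ->
  Cmod (\csum_(0 <= m < X.+1) (if P m then Cmult (RtoC (wt m)) (e (w * INR m ^ 2)) else RtoC 0))
    <= 2 * Wm * sqrt (weylB (w * INR r ^ 2) eta L).
Proof.
move=> r0 eta0 hL Pb Pap Pc Hwt Hmon Wm0.
have [m0 [L0 [hL0 HP E]]] := ap_sum r0 Pb Pap Pc.
rewrite E; apply: (abel_bound (w := fun t => wt (m0 + r * t)%N)) => //.
- by move=> t ht; apply: Hwt; apply: HP.
- by move=> t _; apply: Hmon; rewrite mulnS; lia.
- exact: sqrt_pos.
move=> m hm; rewrite -(sqrt_Rsqr (Cmod _)); last exact: Cmod_ge_0.
apply: sqrt_le_1_alt; rewrite Rsqr_pow2.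
have -> : \csum_(0 <= t < m) e (w * INR (m0 + r * t) ^ 2) =
  \csum_(0 <= t < m) e (w * INR r ^ 2 * INR t ^ 2 + 2 * w * INR m0 * INR r * INR t + w * INR m0 ^ 2).
  by apply: eq_bigr => t _; rewrite !INRE; congr e; ring.
by apply: weyl => //; lia.
Qed.

Lemma dyadic (T : Type) (idx : T) (op : Monoid.law idx) (F : nat -> T) (J : nat) :
  \big[op/idx]_(1 <= u < 2 ^ J) F u =
  \big[op/idx]_(0 <= i < J) \big[op/idx]_(2 ^ i <= u < 2 ^ i.+1) F u.
Proof.
elim: J => [|J IH]; first by rewrite !big_geq.
rewrite big_nat_recr //= -IH -big_cat_nat //=; first by rewrite expn_gt0.
by rewrite leq_exp2l.
Qed.

Lemma rsum_dyadic_le (N J : nat) (f : nat -> R) (c : R) : (N < 2 ^ J)%N ->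
  (forall u, 0 <= f u) -> 0 <= c ->
  (forall i, (2 ^ i <= N)%N -> \rsum_(2 ^ i <= u < 2 * 2 ^ i) f u <= c) ->
  \rsum_(1 <= u < N.+1) f u <= INR J * c.
Proof.
move=> NJ f0 c0 Hc.
apply: Rle_trans (_ : \rsum_(1 <= u < 2 ^ J) (if (u <= N)%N then f u else 0) <= _).
  rewrite [X in _ <= X](@big_cat_nat _ _ _ N.+1) //.
  rewrite -[X in X <= _]Rplus_0_r; apply: Rplus_le_compat.
    by apply: rsum_nat_le => u hu; rewrite (_ : (u <= N)%N); [exact: Rle_refl|lia].
  by apply: rsum_ge0 => u _; case: ifP => _; [exact: f0|lra].
rewrite dyadic; apply: Rle_trans (_ : \rsum_(0 <= i < J) c <= _); last first.
  by rewrite rsum_const subn0; lra.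
apply: rsum_nat_le => i _; case: (leqP (2 ^ i) N) => hi.
  apply: Rle_trans (Hc i hi); rewrite expnS; apply: rsum_nat_le => u _.
  by case: ifP => _; [exact: Rle_refl|exact: f0].
rewrite big1_seq // => u /andP [_]; rewrite mem_index_iota => hu.
by case: ifP => //; lia.
Qed.

Lemma ltn_pow2 (x : R) (n M : nat) : INR n <= x -> x < INR (2 ^ M) -> (n < 2 ^ M)%N.
Proof. by move=> h1 h2; apply/ltP; apply: INR_lt; lra. Qed.

(** * The integers of [[x/2, x)] in a residue class *)

Section Arcs.
Variables (x : R) (b : Z).

(** Literally the condition on [n] in [W], so that it can be folded there. *)
Definition inAP (n d : nat) : bool :=
  Rleb (x / 2) (INR n) && Rltb (INR n) x && Z.eqb (Z.modulo (Z.of_nat n - b) (Z.of_nat d)) 0.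

Lemma inAPP n d : (0 < d)%N -> inAP n d ->
  x / 2 <= INR n < x /\ exists k, Z.of_nat n = (b + k * Z.of_nat d)%Z.
Proof.
move=> d0 /andP [/andP [/RlebP h1 /RltbP h2]] /Z.eqb_spec /Z.mod_divide h.
split => //; have [|k hk] := h; first by lia.
by exists k; lia.
Qed.

Lemma inAPI n d k : (0 < d)%N -> x / 2 <= INR n < x -> Z.of_nat n = (b + k * Z.of_nat d)%Z -> inAP n d.
Proof.
move=> d0 [h1 h2] e; apply/andP; split; first by apply/andP; split; [apply/RlebP|apply/RltbP].
apply/Z.eqb_spec; apply/Z.mod_divide; first by lia.
by exists k; lia.
Qed.

Lemma inAP_dvd n n' d : (0 < d)%N -> inAP n d -> inAP n' d -> (n <= n')%N -> (d %| n' - n)%N.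
Proof.
move=> d0 /(inAPP d0) [_ [k hk]] /(inAPP d0) [_ [k' hk']] h.
apply/dvdnP; exists (Z.to_nat (k' - k)).
nia.
Qed.

(** A common divisor of [n] and [d] divides [b] too. *)
Lemma inAP_coprime n d : (0 < d)%N -> Z.gcd b (Z.of_nat d) = 1%Z -> inAP n d -> coprime n d.
Proof.
move=> d0 g /(inAPP d0) [_ [k hk]].
rewrite /coprime eqn_leq gcdn_gt0 d0 orbT andbT.
set c := gcdn n d.
have [n' hn] : exists n', n = (n' * c)%N by apply/dvdnP; apply: dvdn_gcdl.
have [d' hd] : exists d', d = (d' * c)%N by apply/dvdnP; apply: dvdn_gcdr.
have : (Z.of_nat c | 1)%Z.
  rewrite -g; apply: Z.gcd_greatest; last by exists (Z.of_nat d'); lia.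
  by exists (Z.of_nat n' - k * Z.of_nat d')%Z; nia.
by move=> /Z.divide_pos_le; lia.
Qed.

Lemma inAP_mid n1 n2 n d : (0 < d)%N -> inAP n1 d -> inAP n2 d -> (n1 <= n <= n2)%N ->
  (d %| n - n1)%N -> inAP n d.
Proof.
move=> d0 /(inAPP d0) [[h1 h2] [k hk]] /(inAPP d0) [[h3 h4] _] /andP[a1 a2] /dvdnP [k' hk'].
have := leq_INR a1; have := leq_INR a2 => b1 b2.
by apply: (@inAPI _ _ (k + Z.of_nat k')%Z) => //; [lra|nia].
Qed.

(** As [m] divides an integer prime to [d], it can be cancelled modulo [d]. This is what the
    coprimality of [d] and [b] is for. *)
Lemma inAP_mul_dvd m l l' d : (0 < d)%N -> Z.gcd b (Z.of_nat d) = 1%Z ->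
  inAP (m * l) d -> inAP (m * l') d -> (l <= l')%N -> (d %| l' - l)%N.
Proof.
move=> d0 g h h' ll.
have := inAP_dvd d0 h h' (leq_mul (leqnn m) ll).
rewrite -mulnBr Gauss_dvdr // coprime_sym.
by have := inAP_coprime d0 g h; rewrite coprimeMl => /andP [].
Qed.

Lemma inAP_mul_mid m l1 l2 l d : (0 < d)%N -> inAP (m * l1) d -> inAP (m * l2) d ->
  (l1 <= l <= l2)%N -> (d %| l - l1)%N -> inAP (m * l) d.
Proof.
move=> d0 h1 h2 /andP [a1 a2] hd; apply: (inAP_mid d0 h1 h2).
  by rewrite !leq_mul.
by rewrite -mulnBr dvdn_mull.
Qed.

Lemma inAP_le n d : 0 <= x -> (0 < d)%N -> inAP n d -> (n <= natfl x)%N.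
Proof. by move=> x0 d0 /(inAPP d0) [[_ h] _]; apply/le_natfl => //; lra. Qed.

End Arcs.

(** * Type I sums *)

(* [w = alpha k] for a fixed [k], [y = Delta^(1/32)], and [M], of size [x^eps], dominates the divisor function,
   the logarithms and their powers. The constraints on [q] exclude the ranges where the fourth or fifth
   term of the theorem exceeds the trivial bound. *)
Record setting (x y K w : R) (q M : nat) : Prop := Setting {
  set_K : 1 <= K <= INR M * y;
  set_M : (10 <= M)%N;
  set_My : 100 * INR M <= y;
  set_xy : y ^ 150 <= x;
  set_q : y ^ 64 <= INR q;
  set_qx : INR q * y ^ 64 <= x ^ 2 * K;
  set_cnt : forall eta Y, 0 <= eta ->
    INR (cnt w eta Y) <= (K * INR Y / INR q + 1) * (2 * eta * INR q + 4);
  set_tau : forall u, (0 < u)%N -> INR u <= x ^ 5 -> (tau u <= M)%N;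
  set_log : x < INR (2 ^ M)
}.

Lemma Rle_mul_div (a b c : R) : 0 < b -> a <= c * b -> a / b <= c.
Proof. by move=> h h2; apply/Rle_div_l. Qed.

Section Setting.
Variables (x y K w : R) (q M : nat).
Hypothesis HS : setting x y K w q M.

Lemma set_M1 : 10 <= INR M.
Proof. by have := leq_INR (set_M HS); rewrite (_ : INR 10 = 10) //=; lra. Qed.

Lemma set_y : 1000 <= y.
Proof. by have := set_M1; have := set_My HS; lra. Qed.

Lemma set_x : 1000 <= x.
Proof.
apply: Rle_trans (set_xy HS); apply: Rle_trans set_y _.
rewrite -{1}(pow_1 y); apply: Rle_pow; [have := set_y; lra|lia].
Qed.

Lemma set_ypow (m n : nat) : (m <= n)%N -> y ^ m <= y ^ n.
Proof. by move=> h; apply: Rle_pow; [have := set_y; lra|lia]. Qed.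

Lemma set_ypos n : 0 < y ^ n.
Proof. by apply: pow_lt; have := set_y; lra. Qed.

Lemma set_tau_le u : (0 < u)%N -> INR u <= x -> (tau u <= M)%N.
Proof.
move=> u0 ux; apply: (set_tau HS) => //; apply: Rle_trans ux _; have := set_x.
by rewrite -{2}(pow_1 x) => h; apply: Rle_pow; [lra|lia].
Qed.

(** The product in [set_cnt] has four terms. The lower bound for [L] controls [eta K Y], [q >= y^64]
    controls [K Y / q], the bound [q y^64 <= x^2 K] with [x^2 <= Y L] controls [eta q], and
    [Y >= x / 2] controls the constant. Together they are at most [44 M Y / y^(n + 5)], and
    [100 M <= y] absorbs [44 M]. *)
Lemma cnt_setting (n L Y : nat) : (n <= 40)%N ->
  y ^ (n + 10) <= INR L -> INR L <= 2 * x -> x ^ 2 <= INR Y * INR L ->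
  INR (cnt w (8 * (y ^ 4 / INR L)) Y) <= (/ y) ^ n * INR Y.
Proof.
move=> n40 hL L2 hY.
have y3 := set_y; have x3 := set_x; have m1 := set_M1; have my := set_My HS.
have [K1 KM] := set_K HS.
have L0 : 0 < INR L by apply: Rlt_le_trans hL; apply: set_ypos.
have q0 : 0 < INR q by apply: Rlt_le_trans (set_q HS); apply: set_ypos.
have Y0 : 0 <= INR Y by apply: pos_INR.
set eta := 8 * (y ^ 4 / INR L).
have eta0 : 0 <= eta.
  by rewrite /eta; positivity.
apply: Rle_trans (set_cnt HS Y eta0) _.
set a := / y ^ (n + 5).
have a0 : 0 < a by apply: Rinv_0_lt_compat; apply: set_ypos.
have aE : a * y ^ (n + 5) = 1 by rewrite /a Rinv_l //; have := set_ypos (n + 5); lra.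
have h1 : y ^ 5 / INR L <= a.
  apply: Rle_mul_div => //; have -> : y ^ 5 = a * y ^ (n + 10).
    have -> : y ^ (n + 10) = y ^ (n + 5) * y ^ 5 by rewrite -pow_add; congr pow; lia.
    by rewrite -Rmult_assoc aE; ring.
  by apply: Rmult_le_compat_l; lra.
have h59 : / y ^ 59 <= a.
  by apply: Rinv_le_contravar; [apply: set_ypos|apply: set_ypow; lia].
have i1 : y ^ 4 / INR L * y = y ^ 5 / INR L by field; lra.
have p4 : 0 < y ^ 4 / INR L by positivity.
have t1 : 2 * eta * K <= 16 * INR M * a.
  have -> : 2 * eta * K = 16 * (y ^ 4 / INR L * K) by rewrite /eta; ring.
  have : y ^ 4 / INR L * K <= y ^ 4 / INR L * (INR M * y) by apply: Rmult_le_compat_l; lra.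
  have -> : y ^ 4 / INR L * (INR M * y) = INR M * (y ^ 5 / INR L) by rewrite -i1; ring.
  have : INR M * (y ^ 5 / INR L) <= INR M * a by apply: Rmult_le_compat_l; lra.
  lra.
have i64 : INR M * y / y ^ 64 <= INR M * a.
  apply: Rle_trans (_ : INR M * / y ^ 59 <= _); last by apply: Rmult_le_compat_l; lra.
  have -> : INR M * y / y ^ 64 = INR M * / y ^ 59 * / y ^ 4 by field; lra.
  rewrite -[X in _ <= X]Rmult_1_r; apply: Rmult_le_compat_l.
    by positivity.
  by rewrite -Rinv_1; apply: Rinv_le_contravar; [lra|have := set_ypow (leq0n 4); rewrite pow_O].
have t2 : 4 * (K / INR q) <= 4 * INR M * a.
  have : K / INR q <= INR M * y / y ^ 64.
    rewrite /Rdiv; apply: Rmult_le_compat => //; [lra|by left; apply: Rinv_0_lt_compat|].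
    by apply: Rinv_le_contravar; [apply: set_ypos|apply: (set_q HS)].
  lra.
have t3 : 2 * eta * INR q <= 16 * INR M * a * INR Y.
  have e1 : 2 * eta * INR q = 16 * y ^ 4 * (INR q / INR L) by rewrite /eta; field; lra.
  rewrite e1.
  have hq : INR q / INR L <= INR Y * (INR M * y / y ^ 64).
    apply: Rle_mul_div => //.
    have -> : INR Y * (INR M * y / y ^ 64) * INR L = (INR Y * INR L) * (INR M * y) / y ^ 64 by field; lra.
    apply/Rle_div_r; first exact: set_ypos.
    apply: Rle_trans (set_qx HS) _; apply: Rmult_le_compat => //; [by apply: pow_le; lra|lra].
  have -> : 16 * INR M * a * INR Y = 16 * (INR M * a * INR Y) by ring.
  have h2 : y ^ 4 * (INR q / INR L) <= INR M * a * INR Y.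
    apply: Rle_trans (_ : y ^ 4 * (INR Y * (INR M * y / y ^ 64)) <= _).
      by apply: Rmult_le_compat_l => //; left; apply: set_ypos.
    have -> : y ^ 4 * (INR Y * (INR M * y / y ^ 64)) = INR M * INR Y * / y ^ 59 by field; lra.
    have : INR M * INR Y * / y ^ 59 <= INR M * INR Y * a.
      by apply: Rmult_le_compat_l => //; apply: Rmult_le_pos; lra.
    lra.
  lra.
have t4 : 4 <= 8 * a * INR Y.
  have h : x <= 2 * INR Y by nra.
  have : 1 <= a * x.
    rewrite -aE; apply: Rmult_le_compat_l; first lra.
    by apply: Rle_trans (set_xy HS); apply: set_ypow; lia.
  nra.
have -> : (/ y) ^ n * INR Y = a * y ^ 5 * INR Y.
  rewrite pow_inv; congr (_ * _); rewrite /a pow_add; field.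
  by split; have := set_y; [lra|have := set_ypos n; lra].
have f : 44 * INR M * a * INR Y <= a * y ^ 5 * INR Y.
  apply: Rmult_le_compat_r => //; rewrite (Rmult_comm a); apply: Rmult_le_compat_r; first lra.
  have := set_ypow (isT : 1 <= 5)%N; rewrite pow_1; lra.
have -> : (K * INR Y / INR q + 1) * (2 * eta * INR q + 4) =
  2 * eta * K * INR Y + 4 * (K / INR q) * INR Y + 2 * eta * INR q + 4 by field; lra.
have s1 : 2 * eta * K * INR Y <= 16 * INR M * a * INR Y by apply: Rmult_le_compat_r.
have s2 : 4 * (K / INR q) * INR Y <= 4 * INR M * a * INR Y by apply: Rmult_le_compat_r.
have s4 : 8 * a * INR Y <= 8 * INR M * a * INR Y.
  apply: Rmult_le_compat_r => //; apply: Rmult_le_compat_r; lra.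
lra.
Qed.

Lemma rsum_sqrt_le (I : eqType) (s : seq I) (f : I -> R) :
  (forall i, i \in s -> 0 <= f i) ->
  \rsum_(i <- s) sqrt (f i) <= sqrt (INR (size s) * \rsum_(i <- s) f i).
Proof.
move=> f0.
have h0 : 0 <= \rsum_(i <- s) sqrt (f i) by apply: rsum_ge0 => i _; apply: sqrt_pos.
rewrite -(sqrt_pow2 _ h0); apply: sqrt_le_1_alt; apply: Rle_trans (rsum_sqr_le _ _) _.
apply: Rmult_le_compat_l; first exact: pos_INR.
by apply: rsum_le => i hi; rewrite pow2_sqrt; [lra|apply: f0].
Qed.

(** For [r] the power of two below [d m], this bounds the number of [l <= x / m] in a class modulo
    [d], uniformly over the dyadic block of [d m]. *)
Definition blockL (r : nat) : nat := (natfl x %/ r + 1)%N.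
(** With this tolerance the term [4 L / eta] of [weylB] is [4 L^2 / y^4], so that [y^2] is saved
    after the square root. *)
Definition blockE (r : nat) : R := y ^ 4 / INR (blockL r).

Lemma blockL_bounds r : (0 < r)%N -> INR r <= x ->
  x <= INR r * INR (blockL r) <= 2 * x /\ INR (blockL r) <= 2 * x.
Proof.
move=> R0 Rx; have x3 := set_x; have x0 : 0 <= x by lra.
have [f1 f2] := natflP x0.
rewrite -!mul_INR.
have h1 : ((natfl x).+1 <= r * blockL r)%N by rewrite /blockL mulnC addn1 ltn_ceil.
have h2 : (r * blockL r <= natfl x + r)%N.
  by rewrite /blockL mulnDr muln1 leq_add2r mulnC leq_trunc_div.
move: (leq_INR h1) (leq_INR h2); rewrite S_INR add_INR => a1 a2.
split; first lra.
apply: Rle_trans (_ : INR (r * blockL r) <= _); last by lra.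
by apply: leq_INR; rewrite leq_pmull.
Qed.

(** Cauchy-Schwarz over [u] moves the square root outside. Then [u] and the Weyl shift [l] together
    count the values [w (2 l) u^2] near integers, whence the ranges [2 * L] and [2 * r]. From
    [r y^60 <= x] follows [L >= y^60], enough to save [y^40] in the linear count. *)
Lemma typeI_block r : (0 < r)%N -> INR r * y ^ 60 <= x ->
  \rsum_(r <= u < 2 * r) sqrt (weylB (w * INR u ^ 2) (blockE r) (blockL r)) <= 6 * x / y ^ 2.
Proof.
move=> R0 HR; set L := blockL r; set eta := blockE r.
have y3 := set_y; have x3 := set_x; have m1 := set_M1; have my := set_My HS.
have R1 := leq_INR R0; rewrite /= in R1.
have y60 := set_ypos 60; have y601 := set_ypow (leq0n 60); rewrite pow_O in y601.
have Rx : INR r <= x by nra.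
have [[b1 b2] b3] := blockL_bounds R0 Rx; rewrite -/L in b1 b2 b3.
have L60 : y ^ 60 <= INR L.
  apply: (Rmult_le_reg_l (INR r)); first lra.
  by lra.
have L0 : 0 < INR L by lra.
have eta0 : 0 < eta by rewrite /eta /blockE; apply: Rdiv_lt_0_compat => //; apply: set_ypos.
apply: Rle_trans (rsum_sqrt_le _) _; first by move=> u _; apply: weylB_ge0.
rewrite size_iota (_ : 2 * r - r = r)%N; last by lia.
have Lnat : (0 < L)%N by rewrite /L /blockL addn1.
have C := @cnt2_le w eta (2 * L) (2 * r) M (/ y) ((/ y) ^ 40) _ _ _ _ _ _ _ _ (or_intror (Rle_refl _)).
have {C} HC : INR (cnt2 w eta (2 * L) (2 * r)) <= 8 * INR M * INR (2 * L) * INR (2 * r) * (/ y) ^ 20.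
  apply: C.
  - by have := set_M HS; lia.
  - by rewrite muln_gt0.
  - by rewrite muln_gt0.
  - split; first by positivity.
    by rewrite -Rinv_1; apply: Rinv_le_contravar; lra.
  - lra.
  - by positivity.
  - move=> u hu; apply: (set_tau HS); first by lia.
    have : (u <= 3 * (2 * L) * (2 * r) ^ 2)%N by lia.
    move/leq_INR; rewrite !(mul_INR, exp_INR) (_ : INR 2 = 2) // (_ : INR 3 = 3); last by rewrite /=; ring.
    move=> h; apply: Rle_trans (_ : 24 * (INR r * INR L) * INR r <= _); first by lra.
    apply: Rle_trans (_ : 24 * (2 * x) * x <= _).
      by apply: Rmult_le_compat; [nra|lra|lra|lra].
    have -> : x ^ 5 = x ^ 3 * (x * x) by ring.
    have -> : 24 * (2 * x) * x = 48 * (x * x) by ring.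
    by apply: Rmult_le_compat_r; simpl; nra.
  move=> Y hY.
  apply: Rle_trans (_ : INR (cnt w (8 * (y ^ 4 / INR L)) Y) <= _).
    by apply: leq_INR; apply: leq_cnt; rewrite -/eta in eta0 *; move: eta0; rewrite /eta /blockE -/L; lra.
  apply: cnt_setting => //.
    by apply: Rle_trans L60; apply: set_ypow.
  have := leq_INR hY; rewrite !(mul_INR, exp_INR) (_ : INR 2 = 2) // => h.
  have h8 : 8 * (INR r * INR L) ^ 2 <= INR Y * INR L.
    have -> : 8 * (INR r * INR L) ^ 2 = (2 * INR L * (2 * INR r) ^ 2) * INR L by ring.
    by apply: Rmult_le_compat_r; lra.
  nra.
have S1 : \rsum_(r <= u < 2 * r) weylB (w * INR u ^ 2) eta L =
   INR r * (INR L + 4 * INR L / eta) + 2 * INR L * \rsum_(r <= u < 2 * r) INR (cnt (2 * (w * INR u ^ 2)) eta L).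
  by rewrite /weylB rsum_split rsum_mulr rsum_const (_ : 2 * r - r = r)%N //; lia.
have S2 : \rsum_(r <= u < 2 * r) INR (cnt (2 * (w * INR u ^ 2)) eta L) <= INR (cnt2 w eta (2 * L) (2 * r)).
  rewrite -INR_sum; apply: leq_INR; rewrite /cnt2 [X in (_ <= X)%N]exchange_big.
  apply: leq_trans (leq_sum_subset (s1 := index_iota r (2 * r)) _ _ _).
  - apply: leq_sum => u _; rewrite /cnt.
    apply: leq_trans (leq_sum_inj (f := muln 2) (fun v => nearb eta (w * INR (v * u ^ 2)) : nat) _ _).
    + apply: leq_sum => l _; apply: leq_bool; rewrite !(mul_INR, exp_INR) (_ : INR 2 = 2) //.
      by have -> : w * (2 * INR l * INR u ^ 2) = 2 * (w * INR u ^ 2) * INR l by ring.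
    + by move=> t; lia.
    + by move=> t t'; lia.
  - exact: iota_uniq.
  - by move=> u; rewrite !mem_index_iota; lia.
apply: Rle_trans (_ : sqrt ((3 * (INR r * INR L) / y ^ 2) ^ 2) <= _); last first.
  have p : 0 <= 3 * (INR r * INR L) / y ^ 2.
    apply: Rmult_le_pos; first nra.
    by positivity.
  rewrite sqrt_pow2 //; apply: Rmult_le_compat_r; last by lra.
  by positivity.
apply: sqrt_le_1_alt; rewrite S1.
have y4 := set_ypos 4.
have e1 : 4 * INR L / eta = 4 * INR L ^ 2 / y ^ 4.
  by rewrite /eta /blockE -/L; field; lra.
have e2 : INR L <= INR L ^ 2 / y ^ 4.
  apply/Rle_div_r => //; have -> : INR L ^ 2 = INR L * INR L by ring.
  by apply: Rmult_le_compat_l; [lra|apply: Rle_trans L60; apply: set_ypow].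
have e3 : 2 * INR L * INR (cnt2 w eta (2 * L) (2 * r)) <= INR r * INR L ^ 2 / y ^ 4.
  apply: Rle_trans (_ : 2 * INR L * (8 * INR M * INR (2 * L) * INR (2 * r) * (/ y) ^ 20) <= _).
    by apply: Rmult_le_compat_l => //; lra.
  rewrite !mul_INR (_ : INR 2 = 2) // pow_inv.
  have -> : 2 * INR L * (8 * INR M * (2 * INR L) * (2 * INR r) * / y ^ 20) =
     (INR r * INR L ^ 2 / y ^ 4) * (64 * INR M / y ^ 16) by field; lra.
  rewrite -[X in _ <= X]Rmult_1_r; apply: Rmult_le_compat_l.
    by positivity.
  apply: Rle_mul_div; first exact: set_ypos.
  have := set_ypow (isT : 1 <= 16)%N; rewrite pow_1; lra.
have e4 : 2 * INR L * \rsum_(r <= u < 2 * r) INR (cnt (2 * (w * INR u ^ 2)) eta L) <=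
   2 * INR L * INR (cnt2 w eta (2 * L) (2 * r)) by apply: Rmult_le_compat_l => //; lra.
rewrite e1.
have -> : (3 * (INR r * INR L) / y ^ 2) ^ 2 = INR r * (9 * (INR r * INR L ^ 2 / y ^ 4)) by field; lra.
apply: Rmult_le_compat_l; first lra.
have e5 : INR r * INR L <= INR r * (INR L ^ 2 / y ^ 4) by apply: Rmult_le_compat_l; lra.
have e6 : INR r * (INR L ^ 2 / y ^ 4) = INR r * INR L ^ 2 / y ^ 4 by rewrite /Rdiv; ring.
have e7 : INR r * (4 * INR L ^ 2 / y ^ 4) = 4 * (INR r * INR L ^ 2 / y ^ 4) by rewrite /Rdiv; ring.
have e8 : 0 <= INR r * INR L ^ 2 / y ^ 4.
  by positivity.
lra.
Qed.

End Setting.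

Lemma csum_widen (P : pred nat) (X N : nat) (f : nat -> C) : (X < N)%N ->
  (forall m, P m -> (m <= X)%N) ->
  \csum_(0 <= m < N) (if P m then f m else RtoC 0) =
  \csum_(0 <= m < X.+1) (if P m then f m else RtoC 0).
Proof.
move=> h HP; rewrite (@big_cat_nat _ _ _ X.+1) //= [X in (_ + X)%C]big1_seq ?Cplus_0_r //.
move=> m /andP[_]; rewrite mem_index_iota => hm.
by case: (boolP (P m)) => // /HP; lia.
Qed.

Lemma Cmod_csum_mul_le (I : eqType) (s : seq I) (a f : I -> C) (A : R) (g : I -> R) :
  (forall i, i \in s -> Cmod (a i) <= A) -> (forall i, i \in s -> Cmod (Cmult (a i) (f i)) <= Cmod (a i) * g i) ->
  (forall i, i \in s -> 0 <= g i) ->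
  Cmod (\csum_(i <- s) Cmult (a i) (f i)) <= A * \rsum_(i <- s) g i.
Proof.
move=> Ha Hf g0; apply: Rle_trans (Cmod_sum _ _) _; rewrite -rsum_mulr; apply: rsum_le => i hi.
apply: Rle_trans (Hf i hi) _; apply: Rmult_le_compat_r; [exact: g0|exact: Ha].
Qed.

Section Setting.
Variables (x y K w : R) (q M : nat).
Hypothesis HS : setting x y K w q M.

(** Only the product [u = d m] matters: [m] scales the phase by [m^2], and the step [d] of the
    progression by [d^2]. The divisor bound merges the pair into [u], which is then cut
    dyadically. *)
Lemma typeI (b : Z) (Dn U : nat) (lam cm : nat -> C) (wt : nat -> R) (A B Wm : R) :
  (forall d, (0 < d <= Dn)%N -> Cmod (lam d) <= A) ->
  (forall d, (0 < d <= Dn)%N -> Z.gcd b (Z.of_nat d) <> 1%Z -> lam d = RtoC 0) ->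
  (forall m, (0 < m <= U)%N -> Cmod (cm m) <= B) ->
  (forall l l', (l <= l')%N -> wt l <= wt l') ->
  (forall l, (l <= natfl x)%N -> 0 <= wt l <= Wm) ->
  0 <= A -> 0 <= B -> INR (Dn * U) * y ^ 60 <= x ->
  Cmod (\csum_(1 <= d < Dn.+1) Cmult (lam d) (\csum_(1 <= m < U.+1) Cmult (cm m)
     (\csum_(0 <= l < (natfl x).+1)
        (if inAP x b (m * l) d then Cmult (RtoC (wt l)) (e (w * INR (m * l) ^ 2)) else RtoC 0))))
   <= 12 * A * B * Wm * INR M ^ 2 * (x / y ^ 2).
Proof.
move=> HA Hg HB Hmon Hwt A0 B0 HDU.
have y3 := set_y HS; have x3 := set_x HS; have m1 := set_M1 HS.
have x0 : 0 <= x by lra.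
have Wm0 : 0 <= Wm by have := Hwt _ (leq0n _); lra.
have y60 := set_ypow HS (leq0n 60); rewrite pow_O in y60.
(* [bk u] is the power of two with [bk u <= u < 2 * bk u]; taking the Weyl parameters from it makes
   [Psi] a function of [u] alone. *)
pose bk u := (2 ^ trunc_log 2 u)%N.
pose Psi u := sqrt (weylB (w * INR u ^ 2) (blockE x y (bk u)) (blockL x (bk u))).
have Psi0 u : 0 <= Psi u by apply: sqrt_pos.
have inner d m : (0 < d <= Dn)%N -> (0 < m <= U)%N -> Z.gcd b (Z.of_nat d) = 1%Z ->
  Cmod (\csum_(0 <= l < (natfl x).+1)
        (if inAP x b (m * l) d then Cmult (RtoC (wt l)) (e (w * INR (m * l) ^ 2)) else RtoC 0))
   <= 2 * Wm * Psi (d * m)%N.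
  move=> /andP [d0 dD] /andP [m0 mU] g1.
  pose P l := inAP x b (m * l) d.
  have Pb l : P l -> (l <= natfl x %/ m)%N.
    by move=> /(inAP_le x0 d0) h; rewrite leq_divRL // mulnC.
  rewrite (@csum_widen P (natfl x %/ m)) //; last by rewrite ltnS leq_div.
  have -> : \csum_(0 <= l < (natfl x %/ m).+1) (if P l then Cmult (RtoC (wt l)) (e (w * INR (m * l) ^ 2)) else RtoC 0)
    = \csum_(0 <= l < (natfl x %/ m).+1) (if P l then Cmult (RtoC (wt l)) (e ((w * INR m ^ 2) * INR l ^ 2)) else RtoC 0).
    apply: eq_bigr => l _; rewrite mul_INR.
    by have -> : w * (INR m * INR l) ^ 2 = w * INR m ^ 2 * INR l ^ 2 by ring.
  have -> : Psi (d * m)%N = sqrt (weylB ((w * INR m ^ 2) * INR d ^ 2) (blockE x y (bk (d * m)%N)) (blockL x (bk (d * m)%N))).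
    by rewrite /Psi mul_INR; congr (sqrt (weylB _ _ _)); ring.
  have bk0 : (0 < bk (d * m))%N by rewrite expn_gt0.
  apply: inner_bound => //.
  - rewrite /blockE; apply: Rdiv_lt_0_compat; first exact: (set_ypos HS).
    by apply: (ltn_INR (a := 0)); rewrite /blockL addn1.
  - rewrite /blockL leq_add2r -divnMA mulnC; apply: leq_div2l => //.
    by apply: trunc_logP => //; rewrite muln_gt0 d0.
  - by move=> l l' h h' ll; apply: (inAP_mul_dvd d0 g1 h h').
  - by move=> l l' j h h' hj hd; apply: (inAP_mul_mid d0 h h').
  - move=> l /Pb h; apply: Hwt; apply: leq_trans h _; exact: leq_div.
apply: Rle_trans (_ : A * \rsum_(1 <= d < Dn.+1) (B * \rsum_(1 <= m < U.+1) (2 * Wm * Psi (d * m)%N)) <= _).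
  apply: Cmod_csum_mul_le.
  - by move=> d; rewrite mem_index_iota => hd; apply: HA; lia.
  - move=> d; rewrite mem_index_iota => hd.
    case: (Z.eq_dec (Z.gcd b (Z.of_nat d)) 1) => g1; last first.
      by rewrite Hg ?Cmult_0_l ?Cmod_0; [lra|lia|exact: g1].
    rewrite Cmod_mult; apply: Rmult_le_compat_l; first exact: Cmod_ge_0.
    apply: Cmod_csum_mul_le.
    + by move=> m; rewrite mem_index_iota => hm; apply: HB; lia.
    + move=> m; rewrite mem_index_iota => hm; rewrite Cmod_mult.
      by apply: Rmult_le_compat_l; [exact: Cmod_ge_0|apply: inner; lia].
    + by move=> m _; apply: Rmult_le_pos => //; lra.
  - move=> d _; apply: Rmult_le_pos => //; apply: rsum_ge0 => m _.
    by apply: Rmult_le_pos => //; lra.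
have DUx : INR (Dn * U) <= x by have := pos_INR (Dn * U); nra.
have S1 : \rsum_(1 <= u < (Dn * U).+1) Psi u <= INR M * (6 * x / y ^ 2).
  have e0 : 0 <= 6 * x / y ^ 2.
    by positivity.
  apply: rsum_dyadic_le => //; first exact: ltn_pow2 DUx (set_log HS).
  move=> i hi.
  apply: Rle_trans (_ : \rsum_(2 ^ i <= u < 2 * 2 ^ i) sqrt (weylB (w * INR u ^ 2) (blockE x y (2 ^ i)) (blockL x (2 ^ i))) <= _).
    apply: rsum_nat_le => u hu; rewrite /Psi /bk (@trunc_log_eq 2 i) //; first exact: Rle_refl.
    by rewrite expnS.
  apply: (typeI_block HS); first by rewrite expn_gt0.
  apply: Rle_trans HDU; apply: Rmult_le_compat_r; first by lra.
  exact: leq_INR.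
have S2 := @rmul_collapse Dn U M Psi _ Psi0.
have {}S2 : \rsum_(1 <= d < Dn.+1) \rsum_(1 <= m < U.+1) Psi (d * m)%N <= INR M * (INR M * (6 * x / y ^ 2)).
  apply: Rle_trans (S2 _) _; last by apply: Rmult_le_compat_l; lra.
  move=> u hu; apply: (set_tau_le HS); first by lia.
  by apply: Rle_trans DUx; apply: leq_INR; lia.
under eq_bigr do rewrite rsum_mulr.
rewrite rsum_mulr rsum_mulr.
have -> : 12 * A * B * Wm * INR M ^ 2 * (x / y ^ 2) = A * (B * (2 * Wm * (INR M * (INR M * (6 * x / y ^ 2))))).
  by field; have := set_ypos HS 1; rewrite pow_1; lra.
apply: Rmult_le_compat_l => //; apply: Rmult_le_compat_l => //.
by apply: Rmult_le_compat_l => //; lra.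
Qed.

End Setting.

(** * Type II sums *)

Section Setting.
Variables (x y K w : R) (q M : nat).
Hypothesis HS : setting x y K w q M.

(** The range of [v] is that of the product of [j <= J], [2 n + h j <= 6 N] and [2 l <= 2 L]. As
    [J Hb] has size [N] and [Hb Sb L N] has size [x], the range of [v h^3 s^2] multiplied by [L] is
    at least [x^2], as [cnt_setting] requires. *)
Lemma typeII_cnt3 (N Hb Sb : nat) (L := (natfl x %/ N %/ (Hb * Sb) + 1)%N) (J := (N %/ Hb)%N) :
  (0 < N)%N -> (0 < Hb)%N -> (0 < Sb)%N -> (Hb <= N)%N -> INR N <= x ->
  (Hb * Sb <= natfl x %/ N)%N ->
  y ^ 50 <= INR L \/ Sb = 1%N /\ y ^ 31 <= INR L ->
  [/\ INR (cnt3 w (y ^ 4 / INR L) (J * (6 * N) * (2 * L)) (2 * Hb) (2 * Sb)) <=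
      384 * INR M ^ 2 * (INR Hb * INR Sb * INR N * INR J) * INR L / y ^ 4,
     forall u, (0 < u <= J * (6 * N) * (2 * L))%N -> (tau u <= M)%N &
     INR Hb * INR Sb * INR L * INR N <= 4 * x].
Proof.
move=> N0 H0 S0 HN Nx HSX Hcase.
have y3 := set_y HS; have x3 := set_x HS; have m1 := set_M1 HS; have my := set_My HS.
have x0 : 0 <= x by lra.
have [f1 f2] := natflP x0.
have J0 : (0 < J)%N by rewrite /J divn_gt0.
have L0 : (0 < L)%N by rewrite /L addn1.
have N1 := leq_INR N0; have H1 := leq_INR H0; have S1 := leq_INR S0; have J1 := leq_INR J0.
have L1 := leq_INR L0; rewrite (_ : INR 1 = 1) // in N1 H1 S1 J1 L1.
set X := (natfl x %/ N)%N in L L0 L1 Hcase HSX *.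
have XL : (X.+1 <= Hb * Sb * L)%N by rewrite /L addn1 mulnC; apply: ltn_ceil; rewrite muln_gt0 H0.
have LX : (Hb * Sb * L <= 2 * X)%N.
  rewrite /L mulnDr muln1; have := leq_trunc_div X (Hb * Sb); lia.
have NX : ((natfl x).+1 <= N * X.+1)%N by rewrite mulnC /X ltn_ceil.
have XN : (N * X <= natfl x)%N by rewrite mulnC /X leq_trunc_div.
have lo : x <= INR N * (INR Hb * INR Sb * INR L).
  have h : ((natfl x).+1 <= N * (Hb * Sb * L))%N by apply: leq_trans NX _; rewrite leq_mul2l XL orbT.
  by move/leq_INR: h; rewrite S_INR !mul_INR; lra.
have hi : INR Hb * INR Sb * INR L * INR N <= 2 * x.
  have h : (Hb * Sb * L * N <= 2 * natfl x)%N by nia.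
  by move/leq_INR: h; rewrite !mul_INR (_ : INR 2 = 2) //; lra.
have JH : (J * Hb <= N)%N by rewrite /J leq_trunc_div.
have HJ : (N <= 2 * (J * Hb))%N.
  have : (N < J.+1 * Hb)%N by rewrite /J ltn_ceil.
  nia.
clearbody L J.
have y31 := set_ypow HS (leq0n 31); rewrite pow_O in y31.
have Lx : INR L <= 2 * x.
  have : 1 <= INR Hb * INR Sb * INR N by have : 1 <= INR Hb * INR Sb; nra.
  nra.
have e2 : INR 2 = 2 by [].
have HJr := leq_INR HJ; have JHr := leq_INR JH; rewrite !mul_INR ?e2 in HJr JHr.
have Ntau u : (0 < u <= 36 * (J * (6 * N) * (2 * L)) * (2 * Hb) ^ 3 * (2 * Sb) ^ 2)%N -> (tau u <= M)%N.
  move=> /andP [u0 hu]; apply: (set_tau HS) => //.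
  have h : (u <= 24 * 24 * 24 * ((Hb * Sb * L * N) ^ 2))%N.
    apply: leq_trans hu _.
    have -> : (36 * (J * (6 * N) * (2 * L)) * (2 * Hb) ^ 3 * (2 * Sb) ^ 2 =
      24 * 24 * 24 * ((J * Hb) * N * Hb ^ 2 * Sb ^ 2 * L))%N by rewrite !expnMn !expnS !expn0; lia.
    rewrite leq_mul2l /=.
    have -> : ((Hb * Sb * L * N) ^ 2 = (N * N * Hb ^ 2 * Sb ^ 2 * L) * L)%N by rewrite !expnMn !expnS !expn0; lia.
    apply: leq_trans (leq_pmulr _ L0); by rewrite !leq_mul.
  have e24 : INR 24 = 24 by rewrite INR_IZR_INZ.
  move/leq_INR: h; rewrite mul_INR exp_INR !mul_INR e24 (_ : 24 * 24 * 24 = 13824); last by ring.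
  move=> h; apply: Rle_trans h _.
  have p : 0 <= INR Hb * INR Sb * INR L * INR N by do 3 (apply: Rmult_le_pos; last lra); lra.
  apply: Rle_trans (_ : 13824 * (2 * x) ^ 2 <= _).
    by apply: Rmult_le_compat_l; [lra|apply: pow_incr].
  have -> : 13824 * (2 * x) ^ 2 = 55296 * x ^ 2 by ring.
  have -> : x ^ 5 = x ^ 3 * x ^ 2 by ring.
  apply: Rmult_le_compat_r; [nra|]; simpl; nra.
have eta0 : 0 < y ^ 4 / INR L by positivity.
have iy : 0 < / y <= 1.
  split; first by positivity.
  by rewrite -Rinv_1; apply: Rinv_le_contravar; lra.
have Hn n : (n <= 40)%N -> y ^ (n + 10) <= INR L -> forall Y,
  (J * (6 * N) * (2 * L) * (2 * Hb) ^ 3 * (2 * Sb) ^ 2 <= Y)%N ->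
   INR (cnt w (8 * (y ^ 4 / INR L)) Y) <= (/ y) ^ n * INR Y.
  move=> n40 hL Y hY; apply: (cnt_setting HS) => //.
  have {}hY : (192 * (N * N * Hb ^ 2 * Sb ^ 2 * L) <= Y)%N.
    apply: leq_trans hY.
    have -> : (J * (6 * N) * (2 * L) * (2 * Hb) ^ 3 * (2 * Sb) ^ 2 =
      192 * ((2 * (J * Hb)) * N * Hb ^ 2 * Sb ^ 2 * L))%N by rewrite !expnMn !expnS !expn0; lia.
    by rewrite leq_mul2l /= !leq_mul.
  move/leq_INR: hY; rewrite !(mul_INR, exp_INR) => hY.
  apply: Rle_trans (_ : (INR N * (INR Hb * INR Sb * INR L)) ^ 2 <= _); first by apply: pow_incr; lra.
  have -> : (INR N * (INR Hb * INR Sb * INR L)) ^ 2 = (INR N * INR N * INR Hb ^ 2 * INR Sb ^ 2 * INR L) * INR L by ring.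
  apply: Rmult_le_compat_r; first lra.
  apply: Rle_trans hY; rewrite -{1}(Rmult_1_l (_ * _ * _ * _ * _)); apply: Rmult_le_compat_r.
    do 4 (apply: Rmult_le_pos; last by [lra|apply: pow_le; lra]); lra.
  by rewrite INR_IZR_INZ; apply: IZR_le.
have Vp : (0 < J * (6 * N) * (2 * L))%N by rewrite !muln_gt0 J0 N0 L0.
split; last lra.
- have C g := @cnt3_le w (y ^ 4 / INR L) (J * (6 * N) * (2 * L)) (2 * Hb) (2 * Sb) M (/ y) g
    (leq_trans (isT : 0 < 10)%N (set_M HS)) Vp ltac:(by rewrite muln_gt0) ltac:(by rewrite muln_gt0) iy ltac:(lra).
  have ip n : 0 <= (/ y) ^ n by positivity.
  have {C} : INR (cnt3 w (y ^ 4 / INR L) (J * (6 * N) * (2 * L)) (2 * Hb) (2 * Sb)) <=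
     8 * INR M ^ 2 * (INR (J * (6 * N) * (2 * L)) * INR (2 * Hb) * INR (2 * Sb)) * (/ y) ^ 4.
    case: Hcase => [hL|[S1' hL]].
      by apply: (C ((/ y) ^ 40)) => //; [apply: Hn|right; lra].
    (* Only [y^21] is saved in the linear count here, but for [Sb = 1] the square is absorbed at the
       cost of a factor 2. *)
    apply: (C ((/ y) ^ 21)) => //; first by apply: Hn.
    left; rewrite S1' (_ : INR (2 * 1) = 2) //.
    have a1 : 2 * / y <= 1 by apply: Rle_mul_div; lra.
    have a2 : (/ y) ^ 20 <= / y by rewrite -{2}(pow_1 (/ y)); apply: pow_le1.
    have a3 : 0 <= (/ y) ^ 20 := ip _.
    split; first lra.
    have -> : 2 * (/ y) ^ 21 = (2 * / y) * (/ y) ^ 20 by ring.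
    nra.
  rewrite !mul_INR e2 (_ : INR 6 = 6); last by rewrite /=; ring.
  move=> h; apply: Rle_trans h _; rewrite pow_inv /Rdiv; right; ring.
- move=> u hu; apply: Ntau.
  have h1 : (0 < (2 * Hb) ^ 3)%N by rewrite expn_gt0 muln_gt0 H0.
  have h2 : (0 < (2 * Sb) ^ 2)%N by rewrite expn_gt0 muln_gt0 S0.
  move: hu; set V := (J * _ * _)%N => /andP [-> hu] /=.
  apply: leq_trans hu _.
  have p : (0 < 36 * (2 * Hb) ^ 3 * (2 * Sb) ^ 2)%N by rewrite muln_gt0 h2 andbT muln_gt0 h1.
  have -> : (36 * V * (2 * Hb) ^ 3 * (2 * Sb) ^ 2 = V * (36 * (2 * Hb) ^ 3 * (2 * Sb) ^ 2))%N.
    by rewrite (mulnC 36%N) -!mulnA.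
  exact: leq_pmulr.
Qed.

(* [h j (2 n + h j) (h s)^2] is the phase difference [(n + h j)^2 - n^2] times the squared modulus:
   [h^3 s^2] times the integer [j (2 n + h j)], which is absorbed into a single variable. *)
Lemma typeII_count (N Hb Sb : nat) (L := (natfl x %/ N %/ (Hb * Sb) + 1)%N) (J := (N %/ Hb)%N) :
  (0 < N)%N -> (0 < Hb)%N -> (0 < Sb)%N -> (Hb <= N)%N -> INR N <= x ->
  (Hb * Sb <= natfl x %/ N)%N ->
  y ^ 50 <= INR L \/ Sb = 1%N /\ y ^ 31 <= INR L ->
  \rsum_(Hb <= h < 2 * Hb) \rsum_(Sb <= s < 2 * Sb) \rsum_(N <= n < 2 * N) \rsum_(1 <= j < J.+1)
     sqrt (weylB (w * INR (h * j * (2 * n + h * j)) * INR (h * s) ^ 2) (y ^ 4 / INR L) L)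
  <= 28 * INR M ^ 2 * (INR Sb * INR N ^ 2 * INR L) / y ^ 2.
Proof.
move=> N0 H0 S0 HN Nx HSX Hcase.
have [C3 Htau _] := typeII_cnt3 N0 H0 S0 HN Nx HSX Hcase; rewrite -/L -/J in C3 Htau.
set eta := y ^ 4 / INR L in C3 *.
have y3 := set_y HS; have m1 := set_M1 HS; have my := set_My HS.
have J0 : (0 < J)%N by rewrite /J divn_gt0.
have L0 : (0 < L)%N by rewrite /L addn1.
have N1 := leq_INR N0; have H1 := leq_INR H0; have S1 := leq_INR S0; have J1 := leq_INR J0.
have L1 := leq_INR L0; rewrite (_ : INR 1 = 1) // in N1 H1 S1 J1 L1.
have eta0 : 0 < eta by apply: Rdiv_lt_0_compat; [exact: (set_ypos HS)|lra].
have JHN : (J * Hb <= N)%N by rewrite /J leq_trunc_div.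
clearbody L J.
pose gam (p : nat * nat * nat * nat) := w * INR (p.1.1.1 * p.2 * (2 * p.1.2 + p.1.1.1 * p.2)) * INR (p.1.1.1 * p.1.1.2) ^ 2.
pose quads := [seq (t, j) | t <- [seq (u, n) | u <- [seq (h, s) | h <- index_iota Hb (2 * Hb), s <- index_iota Sb (2 * Sb)],
  n <- index_iota N (2 * N)], j <- index_iota 1 J.+1].
have sz : INR (size quads) = INR Hb * INR Sb * INR N * INR J.
  rewrite !size_allpairs !size_iota -!mul_INR; congr INR.
  by rewrite !mul2n -!addnn !addnK subSS subn0.
apply: Rle_trans (_ : \rsum_(p <- quads) sqrt (weylB (gam p) eta L) <= _).
  by rewrite !big_allpairs; exact: Rle_refl.
apply: Rle_trans (rsum_sqrt_le _) _; first by move=> p _; apply: weylB_ge0.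
rewrite sz; set P := INR Hb * INR Sb * INR N * INR J in C3 *.
have P0 : 0 < P.
  by rewrite /P; positivity.
have E : \rsum_(p <- quads) weylB (gam p) eta L =
  P * (INR L + 4 * INR L / eta) + 2 * INR L * INR (\sum_(p <- quads) cnt (2 * gam p) eta L)%N.
  by rewrite /weylB rsum_split rsum_seq_const sz INR_sum rsum_mulr.
have Z : INR (\sum_(p <- quads) cnt (2 * gam p) eta L)%N
  <= INR M ^ 2 * INR (cnt3 w eta (J * (6 * N) * (2 * L)) (2 * Hb) (2 * Sb)).
  have e1 : INR M ^ 2 = INR (M * M) by rewrite mul_INR; ring.
  rewrite e1 -mul_INR; apply: leq_INR; rewrite !big_allpairs /gam.
  have -> : cnt3 w eta (J * (6 * N) * (2 * L)) (2 * Hb) (2 * Sb) =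
    (\sum_(1 <= h < (2 * Hb).+1) \sum_(1 <= s < (2 * Sb).+1) \sum_(1 <= v < (J * (6 * N) * (2 * L)).+1)
       nearb eta (w * INR (v * h ^ 3 * s ^ 2)))%N.
    by rewrite /cnt3 exchange_big; apply: eq_bigr => h _; rewrite exchange_big.
  apply: leq_trans (_ : _ <= \sum_(Hb <= h < 2 * Hb) \sum_(Sb <= s < 2 * Sb) (M * M) * \sum_(1 <= v < (J * (6 * N) * (2 * L)).+1)
       nearb eta (w * INR (v * h ^ 3 * s ^ 2)))%N _; last first.
    rewrite big_distrr /=.
    apply: leq_trans (leq_sum_subset (s1 := index_iota Hb (2 * Hb)) _ _ _).
    - apply: leq_sum => h _; rewrite big_distrr /=.
      apply: leq_sum_subset; first exact: iota_uniq.
      by move=> z; rewrite !mem_index_iota; lia.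
    - exact: iota_uniq.
    - by move=> z; rewrite !mem_index_iota; lia.
  rewrite !big_nat; apply: leq_sum => h hh; apply: leq_sum => s _.
  pose Q v := nearb eta (w * INR (v * h ^ 3 * s ^ 2)) : nat.
  have tau1 u : (0 < u <= J * (6 * N))%N -> (tau u <= M)%N.
    by move=> hu; apply: Htau; nia.
  (* For fixed [h] and [s], the factors [j], [c = 2 n + h j] and [2 l] are merged into [v] by two
     uses of the divisor bound; for fixed [j] the passage from [n] to [c] is injective. *)
  rewrite -mulnA; apply: leq_trans (leq_mul (leqnn M) (mul_collapse Q Htau)).
  apply: leq_trans (mul_collapse (fun v => \sum_(1 <= l < (2 * L).+1) Q (v * l))%N tau1).
  rewrite exchange_big /= !big_nat; apply: leq_sum => j hj.
  have hJ : (h * j <= 2 * N)%N.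
    apply: leq_trans (_ : 2 * Hb * J <= _)%N; first by apply: leq_mul; lia.
    by move: JHN; lia.
  have fr t : (0 < t <= 2 * N)%N -> (0 < 2 * t + h * j <= 6 * N)%N by lia.
  have fi t t' : (0 < t <= 2 * N)%N -> (0 < t' <= 2 * N)%N -> (2 * t + h * j = 2 * t' + h * j)%N -> t = t' by lia.
  apply: leq_trans (leq_sum_inj (fun c => \sum_(1 <= l < (2 * L).+1) Q (j * c * l))%N fr fi).
  apply: leq_trans (leq_sum_subset (s1 := index_iota N (2 * N)) _ _ _).
  - apply: leq_sum => n _; rewrite /cnt.
    apply: leq_trans (leq_sum_inj (f := muln 2) (fun c => Q (j * (2 * n + h * j) * c)%N) _ _).
    + apply: leq_sum => l _; apply: leq_bool; rewrite /Q.
      have -> : w * INR (j * (2 * n + h * j) * (2 * l) * h ^ 3 * s ^ 2) =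
         2 * (w * INR (h * j * (2 * n + h * j)) * INR (h * s) ^ 2) * INR l.
        rewrite !(mul_INR, exp_INR) (_ : INR 2 = 2) //; ring.
      by [].
    + by move=> t; lia.
    + by move=> t t'; lia.
  - exact: iota_uniq.
  - by move=> z; rewrite !mem_index_iota; lia.
rewrite E; set Zc := INR (\sum_(_ <- _) _)%N in Z *.
have y4 := set_ypos HS 4; have y2 := set_ypos HS 2.
have LyL : INR L <= INR L ^ 2 / y ^ 4.
  apply/Rle_div_r => //; have -> : INR L ^ 2 = INR L * INR L by ring.
  apply: Rmult_le_compat_l; first by lra.
  case: Hcase => [|[_]] h; apply: Rle_trans h; by apply: (set_ypow HS).
have e1 : 4 * INR L / eta = 4 * (INR L ^ 2 / y ^ 4) by rewrite /eta; field; lra.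
have M4 : 1 <= INR M ^ 4 by rewrite -(pow1 4); apply: pow_incr; lra.
have T0 : 0 < INR L ^ 2 / y ^ 4 by positivity.
have h1 : P * (INR L + 4 * INR L / eta) <= 5 * (P * (INR L ^ 2 / y ^ 4)).
  have : P * INR L <= P * (INR L ^ 2 / y ^ 4) by apply: Rmult_le_compat_l; lra.
  by rewrite e1; lra.
have h2 : 2 * INR L * Zc <= 768 * INR M ^ 4 * (P * (INR L ^ 2 / y ^ 4)).
  apply: Rle_trans (_ : 2 * INR L * (INR M ^ 2 * (384 * INR M ^ 2 * P * INR L / y ^ 4)) <= _).
    apply: Rmult_le_compat_l; first lra.
    apply: Rle_trans Z _; apply: Rmult_le_compat_l; last by lra.
    by positivity.
  by right; field; lra.
have PT : 0 < P * (INR L ^ 2 / y ^ 4) by positivity.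
have h3 : 5 * (P * (INR L ^ 2 / y ^ 4)) <= 5 * INR M ^ 4 * (P * (INR L ^ 2 / y ^ 4)).
  by apply: Rmult_le_compat_r; lra.
have PS : P <= INR Sb * INR N ^ 2.
  have -> : P = INR Sb * INR N * (INR J * INR Hb) by rewrite /P; ring.
  have -> : INR Sb * INR N ^ 2 = INR Sb * INR N * INR N by ring.
  apply: Rmult_le_compat_l; first by nra.
  by rewrite -mul_INR; exact: leq_INR.
apply: Rle_trans (_ : sqrt ((28 * INR M ^ 2 * (P * INR L) / y ^ 2) ^ 2) <= _).
  apply: sqrt_le_1_alt.
  have -> : (28 * INR M ^ 2 * (P * INR L) / y ^ 2) ^ 2 = P * (784 * INR M ^ 4 * (P * (INR L ^ 2 / y ^ 4))) by field; lra.
  apply: Rmult_le_compat_l; first by lra.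
  have : 0 <= INR M ^ 4 * (P * (INR L ^ 2 / y ^ 4)) by positivity.
  lra.
have iy2 : 0 < / y ^ 2 by positivity.
have M2 : 0 <= INR M ^ 2 by positivity.
rewrite sqrt_pow2; last first.
  by positivity.
apply: Rmult_le_compat_r; first lra.
apply: Rmult_le_compat_l; first by lra.
by apply: Rmult_le_compat_r; lra.
Qed.
End Setting.

Lemma rsum_subset (I : eqType) (s1 s2 : seq I) (F : I -> R) :
  uniq s1 -> {subset s1 <= s2} -> (forall i, 0 <= F i) ->
  \rsum_(i <- s1) F i <= \rsum_(i <- s2) F i.
Proof.
move=> us sub F0; elim: s1 s2 us sub => [|a s1 IH] s2 /=.
  by move=> _ _; rewrite big_nil; apply: rsum_ge0.
case/andP=> as1 us1 sub.
have as2 : a \in s2 by apply: sub; rewrite inE eqxx.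
rewrite big_cons (big_rem a as2) /=; apply: Rplus_le_compat_l; apply: IH => // z zs1.
have zs2 : z \in s2 by apply: sub; rewrite inE zs1 orbT.
have za : z != a by apply: contraNneq as1 => <-.
by move: zs2; rewrite (perm_mem (perm_to_rem as2)) inE (negPf za).
Qed.

Lemma sum_sqr_expand (I : eqType) (s : seq I) (J : eqType) (ms : seq J) (c : I -> C) (z : I -> J -> C) :
  \rsum_(m <- ms) Cmod (\csum_(p <- s) Cmult (c p) (z p m)) ^ 2 <=
  \rsum_(p <- s) \rsum_(r <- s) (Cmod (c p) * Cmod (c r) * Cmod (\csum_(m <- ms) Cmult (z p m) (Cconj (z r m)))).
Proof.
set LHS := \rsum_(m <- ms) _.
have L0 : 0 <= LHS by apply: rsum_ge0 => m _; apply: pow2_ge_0.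
have -> : LHS = Cmod (RtoC LHS) by rewrite Cmod_R Rabs_pos_eq.
have -> : RtoC LHS = \csum_(p <- s) \csum_(r <- s) (Cmult (Cmult (c p) (Cconj (c r))) (\csum_(m <- ms) Cmult (z p m) (Cconj (z r m)))).
  rewrite /LHS RtoC_sum.
  have -> : \csum_(m <- ms) RtoC (Cmod (\csum_(p <- s) Cmult (c p) (z p m)) ^ 2) =
    \csum_(m <- ms) \csum_(p <- s) \csum_(r <- s) (Cmult (Cmult (c p) (Cconj (c r))) (Cmult (z p m) (Cconj (z r m)))).
    apply: eq_bigr => m _; rewrite Cmod2_conj Cconj_sum Cmult_comm -csum_mulr; apply: eq_bigr => p _.
    rewrite Cmult_comm -csum_mulr; apply: eq_bigr => r _; rewrite Cmult_conj; ring.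
  rewrite exchange_big; apply: eq_bigr => p _; rewrite exchange_big; apply: eq_bigr => r _.
  by rewrite csum_mulr.
apply: Rle_trans (Cmod_sum _ _) _; apply: rsum_le => p _.
apply: Rle_trans (Cmod_sum _ _) _; apply: rsum_le => r _.
by rewrite !Cmod_mult Cmod_conj; lra.
Qed.

Section Pairs.
Variables (x y w : R) (b : Z).
Hypothesis x0 : 0 <= x.
Hypothesis y0 : 0 < y.
Variable N : nat.
Hypothesis N0 : (0 < N)%N.

Definition mrange : nat := (natfl x %/ N)%N.
(* The factor [h * s] of the modulus is kept split, so that Cauchy-Schwarz can be applied with [h] outside. *)
Definition zc (h s n m : nat) : C :=
  if inAP x b (n * m) (h * s) then e (w * INR (n * m) ^ 2) else RtoC 0.
Definition bilin (Dn : nat) (lam : nat -> C) (ns ms : seq nat) (bn am : nat -> C) : C :=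
  \csum_(1 <= d < Dn.+1) Cmult (lam d) (\csum_(n <- ns) \csum_(m <- ms)
     Cmult (Cmult (bn n) (am m)) (zc 1 d n m)).
Definition mangoldt_sum (d : nat) : C :=
  \csum_(1 <= n < (natfl x).+1) Cmult (RtoC (vonMangoldt n)) (zc 1 d n 1).
(* An upper bound for the number of [m <= x / N] in a class modulo [h * sg], depending on [h] and [sg] only
   through their dyadic ranges. *)
Definition pairL (Hb sg : nat) : nat := (mrange %/ (Hb * 2 ^ trunc_log 2 sg) + 1)%N.
Definition pairW (Hb h sg n1 n2 : nat) : R :=
  if (n2 < n1)%N && (h %| n1 - n2)%N then
    2 * sqrt (weylB (w * INR (n1 ^ 2 - n2 ^ 2) * INR (h * sg) ^ 2) (y ^ 4 / INR (pairL Hb sg)) (pairL Hb sg))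
  else 0.
(* Both congruences modulo [h] force [h] to divide [n1 - n2], whence the case distinction in [pairW];
   [sg] is the least common multiple of the two values of [s]. *)
Definition pairB (Hb h sg n1 n2 : nat) : R :=
  (if n1 == n2 then INR (pairL Hb sg) else 0) + pairW Hb h sg n1 n2 + pairW Hb h sg n2 n1.

Lemma pairW_ge0 Hb h sg n1 n2 : 0 <= pairW Hb h sg n1 n2.
Proof. by rewrite /pairW; case: ifP => _; [apply: Rmult_le_pos; [lra|exact: sqrt_pos]|lra]. Qed.

Lemma pairB_ge0 Hb h sg n1 n2 : 0 <= pairB Hb h sg n1 n2.
Proof.
rewrite /pairB; have := pairW_ge0 Hb h sg n1 n2; have := pairW_ge0 Hb h sg n2 n1.
by case: ifP => _; [have := pos_INR (pairL Hb sg)|]; lra.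
Qed.

Lemma inAP_weaken n h s : (0 < h)%N -> (0 < s)%N -> inAP x b n (h * s) -> inAP x b n h.
Proof.
move=> h0 s0 H; have hs0 : (0 < h * s)%N by rewrite muln_gt0 h0.
have [hn [k hk]] := inAPP hs0 H.
by apply: (@inAPI x b n h (k * Z.of_nat s)%Z) => //; lia.
Qed.

(** Cancelling [n1] and [n2] turns the two congruences into a progression of [m] modulo
    [lcm(h s1, h s2) = h * lcm(s1, s2)], on which the phase is [w (n1^2 - n2^2) m^2]. *)
Lemma pair_inner Hb h s1 s2 n1 n2 : (0 < Hb <= h)%N -> (0 < s1)%N -> (0 < s2)%N ->
  (N <= n1)%N -> (N <= n2)%N ->
  Z.gcd b (Z.of_nat (h * s1)) = 1%Z -> Z.gcd b (Z.of_nat (h * s2)) = 1%Z ->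
  Cmod (\csum_(0 <= m < mrange.+1) Cmult (zc h s1 n1 m) (Cconj (zc h s2 n2 m)))
    <= pairB Hb h (lcmn s1 s2) n1 n2.
Proof.
move=> /andP [Hb0 hHb] s10 s20 hn1 hn2 g1 g2.
have h0 : (0 < h)%N by lia.
(* Conjugation exchanges the two factors. The order matters because [n1 ^ 2 - n2 ^ 2] is a truncated
   difference of natural numbers. *)
wlog le21 : s1 s2 n1 n2 s10 s20 hn1 hn2 g1 g2 / (n2 <= n1)%N.
  move=> H; case: (leqP n2 n1) => [|/ltnW] le; first exact: H.
  have := H s2 s1 n2 n1 s20 s10 hn2 hn1 g2 g1 le.
  rewrite /pairB lcmnC eq_sym -Cmod_conj Cconj_sum.
  under eq_bigr do rewrite Cmult_conj Cconj_conj Cmult_comm.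
  by move=> h1; apply: Rle_trans h1 _; lra.
set sg := lcmn s1 s2; set L := pairL Hb sg.
pose P m := inAP x b (n1 * m) (h * s1) && inAP x b (n2 * m) (h * s2).
have hs1 : (0 < h * s1)%N by rewrite muln_gt0 h0.
have hs2 : (0 < h * s2)%N by rewrite muln_gt0 h0.
have -> : \csum_(0 <= m < mrange.+1) Cmult (zc h s1 n1 m) (Cconj (zc h s2 n2 m)) =
  \csum_(0 <= m < mrange.+1) (if P m then Cmult (RtoC 1) (e (w * INR (n1 ^ 2 - n2 ^ 2) * INR m ^ 2)) else RtoC 0).
  apply: eq_bigr => m _; rewrite /zc /P.
  case: (inAP _ _ _ _) => /=; last by rewrite Cmult_0_l.
  case: (inAP _ _ _ _) => /=; last by rewrite /Cconj /RtoC /= Ropp_0 -/(RtoC 0) Cmult_0_r.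
  rewrite Cmult_1_l Cconj_e -e_add minus_INR; last by apply/leP; rewrite leq_sqr.
  rewrite !(mul_INR, exp_INR); congr e; ring.
have Pb m : P m -> (m <= mrange)%N.
  move=> /andP [/(inAP_le x0 hs1) hx _]; rewrite /mrange leq_divRL //.
  by apply: leq_trans hx; rewrite mulnC leq_mul2r hn1 orbT.
have sg0 : (0 < sg)%N by rewrite lcmn_gt0 s10.
have r0 : (0 < h * sg)%N by rewrite muln_gt0 h0.
have Pap m m' : P m -> P m' -> (m <= m')%N -> (h * sg %| m' - m)%N.
  move=> /andP [a1 a2] /andP [b1 b2] le; rewrite /sg muln_lcmr dvdn_lcm.
  by rewrite (inAP_mul_dvd hs1 g1 a1 b1 le) (inAP_mul_dvd hs2 g2 a2 b2 le).
have Pc m m' j : P m -> P m' -> (m <= j <= m')%N -> (h * sg %| j - m)%N -> P j.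
  move=> /andP [a1 a2] /andP [b1 b2] le; rewrite /sg muln_lcmr dvdn_lcm => /andP [d1 d2].
  by rewrite /P (inAP_mul_mid hs1 a1 b1 le d1) (inAP_mul_mid hs2 a2 b2 le d2).
have hL : (mrange %/ (h * sg) + 1 <= L)%N.
  rewrite /L /pairL leq_add2r; apply: leq_div2l; first by rewrite muln_gt0 Hb0 expn_gt0.
  by apply: leq_mul => //; apply: trunc_logP.
have L0 : 0 < INR L by apply: (ltn_INR (a := 0)); rewrite /L /pairL addn1.
case: (eqVneq n1 n2) => [e12|ne].
  apply: Rle_trans (_ : INR L <= _); last first.
    rewrite /pairB e12 eqxx -/L; have := pairW_ge0 Hb h sg n2 n2; lra.
  have [m0 [L1 [hL1 HP ->]]] := ap_sum r0 Pb Pap Pc.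
  apply: Rle_trans (Cmod_sum _ _) _.
  under eq_bigr do rewrite Cmult_1_l Cmod_e.
  by rewrite rsum_const subn0 Rmult_1_r; apply: leq_INR; apply: leq_trans hL1 hL.
have lt21 : (n2 < n1)%N by rewrite ltn_neqAle eq_sym ne.
(* Either the sum is empty, or a single common [m] already forces [h] to divide [n1 - n2]. *)
case: (boolP (has P (iota 0 mrange.+1))) => [/hasP [m hm Pm]|/hasPn noP]; last first.
  rewrite big1_seq ?Cmod_0; first exact: pairB_ge0.
  by move=> m /andP [_]; rewrite mem_index_iota => hm; rewrite (negPf (noP m _)) // mem_iota.
have hd : (h %| n1 - n2)%N.
  move: Pm => /andP [/(inAP_weaken h0 s10) a1 /(inAP_weaken h0 s20) a2].
  rewrite mulnC in a1; rewrite mulnC in a2.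
  apply: (inAP_mul_dvd h0 _ a2 a1 le21).
  have := Z.gcd_divide_l b (Z.of_nat h); have := Z.gcd_divide_r b (Z.of_nat h).
  move=> d2 d1; have : (Z.gcd b (Z.of_nat h) | 1)%Z.
    rewrite -g1; apply: Z.gcd_greatest => //.
    by apply: Z.divide_trans d2 _; exists (Z.of_nat s1); lia.
  by move/Z.divide_1_r_nonneg; apply; apply: Z.gcd_nonneg.
apply: Rle_trans (_ : pairW Hb h sg n1 n2 <= _); last first.
  by rewrite /pairB (negPf ne); have := pairW_ge0 Hb h sg n2 n1; lra.
rewrite /pairW lt21 hd -/L -[X in X * sqrt _]Rmult_1_r.
apply: (@inner_bound P (mrange) (h * sg) L _ _ 1 (fun=> 1)) => //; [|by move=> *; lra|by move=> *; lra|lra].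
by positivity.
Qed.

End Pairs.

Lemma rsum_diag (s : seq nat) (c : R) : uniq s -> 0 <= c ->
  \rsum_(i <- s) \rsum_(j <- s) (if i == j then c else 0) <= INR (size s) * c.
Proof.
move=> us c0; rewrite -rsum_seq_const; apply: rsum_le => i hi.
rewrite (bigD1_seq _ hi) //= eqxx big1 ?Rplus_0_r; first exact: Rle_refl.
by move=> j; rewrite eq_sym => /negPf ->.
Qed.

Lemma rsum_shift_le (N h n J : nat) (F : nat -> R) : (0 < h)%N -> (N <= n)%N -> (N %/ h <= J)%N ->
  (forall i, 0 <= F i) ->
  \rsum_(N <= i < 2 * N) (if (n < i)%N && (h %| i - n)%N then F i else 0) <=
  \rsum_(1 <= j < J.+1) F (n + h * j)%N.
Proof.
move=> h0 Nn HJ F0.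
have -> : \rsum_(1 <= j < J.+1) F (n + h * j)%N =
   \rsum_(i <- [seq (n + h * j)%N | j <- index_iota 1 J.+1]) F i by rewrite big_map.
rewrite -big_mkcond -big_filter; apply: rsum_subset => //.
  by rewrite filter_uniq // iota_uniq.
move=> i; rewrite mem_filter mem_index_iota => /andP [/andP [lt /dvdnP [k hk]] hi].
apply/mapP; exists k; last by lia.
have kJ : (k <= N %/ h)%N by rewrite leq_divRL //; lia.
rewrite mem_index_iota; case: k hk kJ => [|k] hk kJ; lia.
Qed.

Section Setting.
Variables (x y K w : R) (q M : nat).
Hypothesis HS : setting x y K w q M.

(** The two off-diagonal parts are equal by symmetry and each carries the factor 2 of [pairW],
    whence the 4. A multiple of [h] below [N] is [h i] with [i <= N / Hb]. *)
Lemma pairB_sum (N Hb h sg j : nat) (Sb := (2 ^ j)%N) (L := (natfl x %/ N %/ (Hb * Sb) + 1)%N) :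
  (0 < N)%N -> (0 < Hb <= h)%N -> (Sb <= sg < 2 * Sb)%N ->
  \rsum_(N <= n1 < 2 * N) \rsum_(N <= n2 < 2 * N) pairB x y w N Hb h sg n1 n2 <=
  INR N * INR L + 4 * \rsum_(N <= n < 2 * N) \rsum_(1 <= i < (N %/ Hb).+1)
     sqrt (weylB (w * INR (h * i * (2 * n + h * i)) * INR (h * sg) ^ 2) (y ^ 4 / INR L) L).
Proof.
move=> N0 /andP [Hb0 hHb] hsg.
have EL : pairL x N Hb sg = L.
  rewrite /pairL (@trunc_log_eq 2 j) // expnS; lia.
have y3 := set_y HS.
have W : \rsum_(N <= n1 < 2 * N) \rsum_(N <= n2 < 2 * N) pairW x y w N Hb h sg n2 n1 <=
   2 * \rsum_(N <= n < 2 * N) \rsum_(1 <= i < (N %/ Hb).+1)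
     sqrt (weylB (w * INR (h * i * (2 * n + h * i)) * INR (h * sg) ^ 2) (y ^ 4 / INR L) L).
  rewrite -rsum_mulr; apply: rsum_nat_le => n hn; rewrite -rsum_mulr.
  pose F i := 2 * sqrt (weylB (w * INR (i ^ 2 - n ^ 2) * INR (h * sg) ^ 2) (y ^ 4 / INR L) L).
  have F0 i : 0 <= F i by apply: Rmult_le_pos; [lra|exact: sqrt_pos].
  apply: Rle_trans (_ : \rsum_(1 <= i < (N %/ Hb).+1) F (n + h * i)%N <= _); last first.
    apply: rsum_nat_le => i hi; rewrite /F.
    have -> : ((n + h * i) ^ 2 - n ^ 2 = h * i * (2 * n + h * i))%N by rewrite !expnS !expn0; lia.
    exact: Rle_refl.
  apply: Rle_trans (@rsum_shift_le N h n _ F _ _ _ F0); [|lia|lia|].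
    apply: rsum_nat_le => i hi; rewrite /pairW EL; case: ifP => _; exact: Rle_refl.
  by apply: leq_div2l.
have W' : \rsum_(N <= n1 < 2 * N) \rsum_(N <= n2 < 2 * N) pairW x y w N Hb h sg n1 n2 =
   \rsum_(N <= n1 < 2 * N) \rsum_(N <= n2 < 2 * N) pairW x y w N Hb h sg n2 n1 by rewrite exchange_big.
rewrite /pairB; under eq_bigr do rewrite !rsum_split.
rewrite !rsum_split EL W'.
have := @rsum_diag (index_iota N (2 * N)) (INR L) (iota_uniq _ _) (pos_INR _).
rewrite size_iota (_ : 2 * N - N = N)%N; last by lia.
lra.
Qed.

(** The diagonal contributes [Hb Sb N L] and the rest [Sb N^2 L / y^2], up to powers of [M]; by
    [Hb y^2 <= N] the diagonal is no larger. Since [Hb Sb L] has size [x / N], the result is the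
    same for every dyadic range [Sb] of the least common multiple, which runs up to [Sn ^ 2]. *)
Lemma typeII_block (b : Z) (N Hb Sn : nat) (mu : nat -> nat -> C) (am bn : nat -> C) (A Ba Bb : R) :
  (0 < N)%N -> (0 < Hb)%N -> INR Hb * y ^ 2 <= INR N -> INR N <= x ->
  (forall Sb, (0 < Sb <= Sn ^ 2)%N -> (Hb * Sb <= natfl x %/ N)%N /\
     (y ^ 50 <= INR (natfl x %/ N %/ (Hb * Sb) + 1) \/
      Sb = 1%N /\ y ^ 31 <= INR (natfl x %/ N %/ (Hb * Sb) + 1))) ->
  0 <= A -> 0 <= Ba -> 0 <= Bb ->
  (forall h s, (Hb <= h < 2 * Hb)%N -> (0 < s <= Sn)%N -> Cmod (mu h s) <= A) ->
  (forall h s, (Hb <= h < 2 * Hb)%N -> (0 < s <= Sn)%N -> Z.gcd b (Z.of_nat (h * s)) <> 1%Z -> mu h s = RtoC 0) ->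
  (forall m, (m <= natfl x)%N -> Cmod (am m) <= Ba) ->
  (forall n, (N <= n < 2 * N)%N -> Cmod (bn n) <= Bb) ->
  Cmod (\csum_(Hb <= h < 2 * Hb) \csum_(0 <= m < (natfl x %/ N).+1) Cmult (am m)
     (\csum_(1 <= s < Sn.+1) \csum_(N <= n < 2 * N) Cmult (Cmult (mu h s) (bn n)) (zc x w b h s n m)))
  <= 31 * A * Ba * Bb * INR M ^ 3 * (x / y).
Proof.
move=> N0 H0 HN Nx HSb A0 Ba0 Bb0 HA Hg HBa HBb.
have y3 := set_y HS; have x3 := set_x HS; have m1 := set_M1 HS; have my := set_My HS.
have x0 : 0 <= x by lra.
have y0 : 0 < y by lra.
have [f1 f2] := natflP x0.
have N1 := leq_INR N0; have H1 := leq_INR H0; rewrite (_ : INR 1 = 1) // in N1 H1.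
have HbN : (Hb <= N)%N.
  have y2 := set_ypow HS (leq0n 2); rewrite pow_O in y2.
  have : INR Hb <= INR N by nra.
  by move/INR_le; lia.
set X := (natfl x %/ N)%N in HSb *.
pose ps := [seq (s, n) | s <- index_iota 1 Sn.+1, n <- index_iota N (2 * N)].
pose cf h (p : nat * nat) := Cmult (mu h p.1) (bn p.2).
pose G h m := \csum_(p <- ps) Cmult (cf h p) (zc x w b h p.1 p.2 m).
have GE h m : \csum_(1 <= s < Sn.+1) \csum_(N <= n < 2 * N) Cmult (Cmult (mu h s) (bn n)) (zc x w b h s n m) = G h m.
  by rewrite /G /ps big_allpairs.
pose U := \rsum_(Hb <= h < 2 * Hb) \rsum_(0 <= m < X.+1) Cmod (G h m).
pose V := \rsum_(Hb <= h < 2 * Hb) \rsum_(0 <= m < X.+1) Cmod (G h m) ^ 2.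
have szH : size (index_iota Hb (2 * Hb)) = Hb by rewrite size_iota; lia.
have U0 : 0 <= U by apply: rsum_ge0 => h _; apply: rsum_ge0 => m _; exact: Cmod_ge_0.
have step1 : Cmod (\csum_(Hb <= h < 2 * Hb) \csum_(0 <= m < X.+1) Cmult (am m)
     (\csum_(1 <= s < Sn.+1) \csum_(N <= n < 2 * N) Cmult (Cmult (mu h s) (bn n)) (zc x w b h s n m))) <= Ba * U.
  apply: Rle_trans (Cmod_sum _ _) _; rewrite /U -rsum_mulr; apply: rsum_le => h _.
  apply: Cmod_csum_mul_le.
  - by move=> m; rewrite mem_index_iota => hm; apply: HBa; have := leq_div (natfl x) N; rewrite -/X; lia.
  - by move=> m _; rewrite GE Cmod_mult; exact: Rle_refl.
  - by move=> m _; exact: Cmod_ge_0.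
have step2 : U ^ 2 <= INR Hb * INR X.+1 * V.
  apply: Rle_trans (rsum_sqr_le _ _) _; rewrite szH Rmult_assoc; apply: Rmult_le_compat_l; first lra.
  rewrite /V -rsum_mulr; apply: rsum_le => h _.
  apply: Rle_trans (rsum_sqr_le _ _) _; rewrite size_iota subn0; exact: Rle_refl.
pose f sg := \rsum_(Hb <= h < 2 * Hb) \rsum_(N <= n1 < 2 * N) \rsum_(N <= n2 < 2 * N) pairB x y w N Hb h sg n1 n2.
have f0 sg : 0 <= f sg.
  by apply: rsum_ge0 => h _; apply: rsum_ge0 => n1 _; apply: rsum_ge0 => n2 _; exact: pairB_ge0.
have step3 : V <= (A * Bb) ^ 2 * \rsum_(1 <= s < Sn.+1) \rsum_(1 <= t < Sn.+1) f (lcmn s t).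
  have -> : \rsum_(1 <= s < Sn.+1) \rsum_(1 <= t < Sn.+1) f (lcmn s t) =
    \rsum_(Hb <= h < 2 * Hb) \rsum_(p <- ps) \rsum_(r <- ps) pairB x y w N Hb h (lcmn p.1 r.1) p.2 r.2.
    rewrite /f; under eq_bigr do rewrite exchange_big.
    rewrite exchange_big; apply: eq_bigr => h _; rewrite /ps big_allpairs; apply: eq_bigr => s _.
    rewrite exchange_big; apply: eq_bigr => n1 _; rewrite big_allpairs; apply: eq_bigr => t _.
    by [].
  rewrite /V -rsum_mulr; apply: rsum_nat_le => h hh.
  apply: Rle_trans (sum_sqr_expand _ _ _ _) _.
  rewrite -rsum_mulr; apply: rsum_le => p hp; rewrite -rsum_mulr; apply: rsum_le => r hr.
  have inps (z : nat * nat) : z \in ps -> (0 < z.1 <= Sn)%N /\ (N <= z.2 < 2 * N)%N.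
    by move=> /allpairsP [[u v] /= [h1 h2 ->]] /=; move: h1 h2; rewrite !mem_index_iota; lia.
  have [p1 p2] := inps _ hp; have [r1 r2] := inps _ hr.
  have B0 := pairB_ge0 x y w N Hb h (lcmn p.1 r.1) p.2 r.2.
  have R0 : 0 <= (A * Bb) ^ 2 * pairB x y w N Hb h (lcmn p.1 r.1) p.2 r.2.
    by positivity.
  case: (Z.eq_dec (Z.gcd b (Z.of_nat (h * p.1))) 1) => gp; last first.
    by rewrite {1}/cf (Hg _ _ hh p1 gp) Cmult_0_l Cmod_0 !Rmult_0_l.
  case: (Z.eq_dec (Z.gcd b (Z.of_nat (h * r.1))) 1) => gr; last first.
    by rewrite {2}/cf (Hg _ _ hh r1 gr) Cmult_0_l Cmod_0 Rmult_0_r !Rmult_0_l.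
  apply: Rmult_le_compat; last first.
  - apply: pair_inner => //; lia.
  - have b1 z : (0 < z.1 <= Sn)%N -> (N <= z.2 < 2 * N)%N -> 0 <= Cmod (cf h z) <= A * Bb.
      move=> z1 z2; split; first exact: Cmod_ge_0.
      by rewrite Cmod_mult; apply: Rmult_le_compat; [exact: Cmod_ge_0|exact: Cmod_ge_0|exact: HA|exact: HBb].
    have [c1 c2] := b1 _ p1 p2; have [d1 d2] := b1 _ r1 r2.
    by rewrite (_ : (A * Bb) ^ 2 = A * Bb * (A * Bb)); [apply: Rmult_le_compat|ring].
  - exact: Cmod_ge_0.
  - by positivity.
have SnX : (Sn ^ 2 <= X)%N.
  case: (posnP Sn) => [->|S0]; first by [].
  have [h _] := HSb (Sn ^ 2)%N ltac:(by rewrite expn_gt0 S0 leqnn).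
  by apply: leq_trans h; apply: leq_pmull.
have Xx : INR X <= x.
  by apply: Rle_trans f1; apply: leq_INR; exact: leq_div.
have step4 : \rsum_(1 <= s < Sn.+1) \rsum_(1 <= t < Sn.+1) f (lcmn s t) <= INR M ^ 2 * \rsum_(1 <= u < (Sn ^ 2).+1) f u.
  apply: rsum_mul_lcm => // u hu; apply: (set_tau_le HS); first by lia.
  by apply: Rle_trans Xx; apply: leq_INR; lia.
(* The constant 117 exceeds [1 + 4 * 28], the diagonal and the off-diagonal part. *)
pose T := 117 * INR M ^ 2 * (2 * INR X.+1 * INR N ^ 2) / (INR Hb * y ^ 2).
have iy2 : 0 < / y ^ 2 by positivity.
have M2 : 1 <= INR M ^ 2 by rewrite -(pow1 2); apply: pow_incr; lra.
have X1 : 1 <= INR X.+1 by apply: (leq_INR (a := 1)).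
have T0 : 0 <= T.
  apply: Rmult_le_pos; last first.
    by positivity.
  apply: Rmult_le_pos; first by lra.
  by positivity.
have step5 : \rsum_(1 <= u < (Sn ^ 2).+1) f u <= INR M * T.
  apply: rsum_dyadic_le => //.
    by apply: ltn_pow2 (set_log HS); apply: Rle_trans Xx; exact: leq_INR.
  move=> j hj.
  set Sb := (2 ^ j)%N in hj *.
  have Sb0 : (0 < Sb)%N by rewrite expn_gt0.
  have S1 := leq_INR Sb0; rewrite (_ : INR 1 = 1) // in S1.
  have [HSX Hcase] := HSb Sb ltac:(by rewrite Sb0).
  have HC := typeII_count HS N0 H0 Sb0 HbN Nx HSX Hcase.
  rewrite -/X in HC; set L := (X %/ (Hb * Sb) + 1)%N in HC Hcase.
  apply: Rle_trans (_ : INR Hb * INR Sb * INR N * INR L + 4 * (28 * INR M ^ 2 * (INR Sb * INR N ^ 2 * INR L) / y ^ 2) <= _).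
    apply: Rle_trans (_ : _ <= INR Hb * INR Sb * INR N * INR L + 4 * (\rsum_(Hb <= h < 2 * Hb) \rsum_(Sb <= s < 2 * Sb) \rsum_(N <= n < 2 * N) \rsum_(1 <= j < (N %/ Hb).+1)
     sqrt (weylB (w * INR (h * j * (2 * n + h * j)) * INR (h * s) ^ 2) (y ^ 4 / INR L) L))) _; last by lra.
    rewrite /f exchange_big -rsum_mulr.
    have -> : INR Hb * INR Sb * INR N * INR L = \rsum_(Hb <= h < 2 * Hb) (INR Sb * INR N * INR L).
      by rewrite rsum_seq_const szH; ring.
    rewrite -rsum_split; apply: rsum_nat_le => h hh; rewrite -rsum_mulr.
    have -> : INR Sb * INR N * INR L = \rsum_(Sb <= s < 2 * Sb) (INR N * INR L).
      by rewrite rsum_const (_ : 2 * Sb - Sb = Sb)%N; [ring|lia].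
    rewrite -rsum_split; apply: rsum_nat_le => s hs.
    by apply: pairB_sum => //; lia.
  have y2 := set_ypos HS 2.
  have PL : INR Hb * INR Sb * INR L <= 2 * INR X.+1.
    have : (Hb * Sb * L <= 2 * X.+1)%N.
      rewrite /L mulnDr muln1; have := leq_trunc_div X (Hb * Sb); lia.
    by move/leq_INR; rewrite !mul_INR (_ : INR 2 = 2).
  have L0 : 0 < INR L by apply: (ltn_INR (a := 0)); rewrite /L addn1.
  apply: Rle_trans (_ : 117 * INR M ^ 2 * (INR Sb * INR N ^ 2 * INR L) / y ^ 2 <= _).
    have h1 : INR Hb * INR Sb * INR N * INR L <= INR M ^ 2 * (INR Sb * INR N ^ 2 * INR L) / y ^ 2.
      apply: (proj1 (Rle_div_r _ _ _ y2)).
      have p : 0 <= INR Sb * INR N * INR L by positivity.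
      apply: Rle_trans (_ : INR N * (INR Sb * INR N * INR L) <= _).
        have h : INR Hb * y ^ 2 * (INR Sb * INR N * INR L) <= INR N * (INR Sb * INR N * INR L).
          by apply: Rmult_le_compat_r.
        lra.
      have h : 0 <= INR N * (INR Sb * INR N * INR L) by positivity.
      have : INR N * (INR Sb * INR N * INR L) <= INR M ^ 2 * (INR N * (INR Sb * INR N * INR L)) by nra.
      lra.
    have : 0 <= INR M ^ 2 * (INR Sb * INR N ^ 2 * INR L) / y ^ 2.
      apply: Rle_trans h1; apply: Rmult_le_pos; last lra.
      by positivity.
    rewrite /Rdiv in h1 *; lra.
  rewrite /T.
  have -> : 117 * INR M ^ 2 * (INR Sb * INR N ^ 2 * INR L) / y ^ 2 =
    117 * INR M ^ 2 * ((INR Hb * INR Sb * INR L) * INR N ^ 2) / (INR Hb * y ^ 2) by field; lra.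
  apply: Rmult_le_compat_r.
    by positivity.
  apply: Rmult_le_compat_l; first by lra.
  by apply: Rmult_le_compat_r => //; apply: pow_le; lra.
have NX : INR X.+1 * INR N <= 2 * x.
  have : (X.+1 * N <= natfl x + N)%N by rewrite mulSn addnC leq_add2r /X leq_trunc_div.
  by move/leq_INR; rewrite mul_INR add_INR; lra.
have M3 : 0 <= INR M ^ 3 by positivity.
(* The constant 31 is chosen for [31^2 = 961 >= 4 * 234], where [234 = 2 * 117] and the 4 comes from
   [X.+1 * N <= 2 x]. *)
have fin : U <= 31 * A * Bb * INR M ^ 3 * (x / y).
  have ABM : 0 <= 31 * A * Bb * INR M ^ 3 * (x / y).
    apply: Rmult_le_pos; last by positivity.
    by positivity.
  rewrite -(sqrt_pow2 _ U0) -(sqrt_pow2 _ ABM); apply: sqrt_le_1_alt.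
  apply: Rle_trans step2 _.
  apply: Rle_trans (_ : INR Hb * INR X.+1 * ((A * Bb) ^ 2 * (INR M ^ 2 * (INR M * T))) <= _).
    apply: Rmult_le_compat_l; first by nra.
    apply: Rle_trans step3 _; apply: Rmult_le_compat_l; first exact: pow2_ge_0.
    apply: Rle_trans step4 _; apply: Rmult_le_compat_l; first by lra.
    exact: step5.
  have -> : INR Hb * INR X.+1 * ((A * Bb) ^ 2 * (INR M ^ 2 * (INR M * T))) =
     (A * Bb) ^ 2 * INR M ^ 5 * (234 * (INR X.+1 * INR N) ^ 2) / y ^ 2.
    by rewrite /T; field; lra.
  have -> : (31 * A * Bb * INR M ^ 3 * (x / y)) ^ 2 = (A * Bb) ^ 2 * INR M ^ 5 * (961 * INR M * x ^ 2) / y ^ 2.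
    by field; lra.
  apply: Rmult_le_compat_r; first by lra.
  apply: Rmult_le_compat_l.
    by positivity.
  have : (INR X.+1 * INR N) ^ 2 <= (2 * x) ^ 2 by apply: pow_incr; split => //; apply: Rmult_le_pos; lra.
  have : x ^ 2 <= INR M * x ^ 2 by have := pow2_ge_0 x; nra.
  have := pow2_ge_0 x; lra.
apply: Rle_trans step1 _.
have -> : 31 * A * Ba * Bb * INR M ^ 3 * (x / y) = Ba * (31 * A * Bb * INR M ^ 3 * (x / y)) by ring.
by apply: Rmult_le_compat_l.
Qed.

End Setting.

(* [pick] chooses one factorisation of each [d], so that no [d] is counted twice. *)
Lemma pick_sum (ps : seq (nat * nat)) (ds : seq nat) (pick : nat -> nat * nat) (lam Phi : nat -> C) :
  uniq ps -> uniq ds ->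
  (forall d, d \in ds -> lam d <> RtoC 0 -> pick d \in ps /\ ((pick d).1 * (pick d).2)%N = d) ->
  (forall p, p \in ps -> (p.1 * p.2)%N \in ds) ->
  \csum_(d <- ds) Cmult (lam d) (Phi d) =
  \csum_(p <- ps) Cmult (if pick (p.1 * p.2)%N == p then lam (p.1 * p.2)%N else RtoC 0) (Phi (p.1 * p.2)%N).
Proof.
move=> ups uds H1 H2.
have -> : \csum_(d <- ds) Cmult (lam d) (Phi d) =
  \csum_(d <- ds) \csum_(p <- ps) (if (pick d == p) && ((p.1 * p.2)%N == d) then Cmult (lam d) (Phi d) else RtoC 0).
  apply: eq_big_seq => d hd.
  case: (Req_EM_T (Cmod (lam d)) 0) => [/Cmod_eq_0 z|nz].
    by rewrite z Cmult_0_l big1 // => p _; case: ifP.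
  have [|pp e] := H1 d hd; first by move=> z; apply: nz; rewrite z Cmod_0.
  rewrite (bigD1_seq _ pp) //= eqxx e eqxx /= big1 ?Cplus_0_r // => p ne.
  by rewrite eq_sym (negPf ne).
rewrite exchange_big; apply: eq_big_seq => p hp.
rewrite (bigD1_seq _ (H2 p hp)) //= eqxx andbT big1; last first.
  by move=> d ne; rewrite [_ == d]eq_sym (negPf ne) andbF.
by rewrite Cplus_0_r; case: ifP => // _; rewrite Cmult_0_l.
Qed.

Section Setting.
Variables (x y K w : R) (q M : nat).
Hypothesis HS : setting x y K w q M.

Lemma typeII_len (N k r : nat) : (0 < N)%N -> (0 < r)%N -> INR r * INR N * y ^ k <= x ->
  (r <= natfl x %/ N)%N /\ y ^ k <= INR (natfl x %/ N %/ r + 1).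
Proof.
move=> N0 r0 h.
have x3 := set_x HS; have x0 : 0 <= x by lra.
have [f1 f2] := natflP x0; have yk := set_ypow HS (leq0n k); rewrite pow_O in yk.
have rN : 1 <= INR r * INR N.
  by rewrite -mul_INR; apply: (leq_INR (a := 1)); rewrite muln_gt0 r0.
have rX : (r <= natfl x %/ N)%N.
  rewrite leq_divRL //; apply/(le_natfl _ x0).
  rewrite mul_INR; nra.
split => //.
set L := (_ + 1)%N.
have h1 : ((natfl x).+1 <= r * L * N)%N.
  have a1 : ((natfl x %/ N).+1 <= L * r)%N by rewrite /L addn1; apply: ltn_ceil.
  have a2 : (natfl x < (natfl x %/ N).+1 * N)%N by apply: ltn_ceil.
  apply: leq_trans a2 _; rewrite (mulnC r) leq_mul2r a1 orbT //.
move/leq_INR: h1; rewrite S_INR !mul_INR => h1.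
apply: (Rmult_le_reg_l (INR r * INR N)); lra.
Qed.

Lemma typeII_dyadic (b : Z) (D : R) (N : nat) (lam am bn : nat -> C) (A Ba Bb : R) :
  1 <= D -> D ^ 2 * y ^ 64 <= x -> y ^ 2 <= INR N -> INR N ^ 2 <= 4 * x ->
  0 <= A -> 0 <= Ba -> 0 <= Bb ->
  (forall d, (0 < d)%N -> INR d <= D -> Cmod (lam d) <= A) ->
  (forall d, (0 < d)%N -> INR d <= D -> lam d <> RtoC 0 -> Z.gcd b (Z.of_nat d) = 1%Z /\ well_separable d D) ->
  (forall m, (m <= natfl x)%N -> Cmod (am m) <= Ba) ->
  (forall n, (N <= n < 2 * N)%N -> Cmod (bn n) <= Bb) ->
  Cmod (bilin x w b (natfl D) lam (index_iota N (2 * N)) (index_iota 0 (natfl x %/ N).+1) bn am)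
  <= 31 * A * Ba * Bb * INR M ^ 4 * (x / y).
Proof.
move=> D1 HD yN Nx A0 Ba0 Bb0 HA Hl HBa HBb.
have y3 := set_y HS; have x3 := set_x HS; have m1 := set_M1 HS.
have x0 : 0 <= x by lra.
have y2 := set_ypos HS 2.
have y64 := set_ypow HS (leq0n 64); rewrite pow_O in y64.
have N0r : 0 < INR N by lra.
have N0 : (0 < N)%N by have : INR 0 < INR N by []; move/INR_lt; lia.
(* With this [H] the diagonal [n1 = n2] saves [y^2], while the class of [m] modulo [h * lcm(s1, s2) <= H S^2]
   remains long enough for the Weyl bound. *)
pose H := Rmin (INR N / y ^ 2) D; pose S := D / H.
have H1 : 1 <= H.
  rewrite /H; apply: Rmin_glb => //; apply/Rle_div_r => //; lra.
have HDle : H <= D by exact: Rmin_r.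
have HNle : H * y ^ 2 <= INR N.
  have : H <= INR N / y ^ 2 by exact: Rmin_l.
  by move/(Rle_div_r _ _ _ y2).
have S1 : 1 <= S by rewrite /S; apply/Rle_div_r; lra.
have HSD : H * S = D by rewrite /S; field; lra.
have H0 : 0 <= H by lra. have S0 : 0 <= S by lra. have D0 : 0 <= D by lra.
pose Hn := natfl H; pose Sn := natfl S; pose Dn := natfl D.
have [Hn1 Hn2] := natflP H0; have [Sn1 Sn2] := natflP S0.
pose ps := [seq (h, s) | h <- index_iota 1 Hn.+1, s <- index_iota 1 Sn.+1].
(* The first pair of [ps] with product [d]; without one the default [(0, 0)] results, which is not
   in [ps]. *)
pose pick d := nth (0, 0)%N ps (find (fun p : nat * nat => (p.1 * p.2)%N == d) ps).
(* [mu] vanishes for [h > Hn], so that the dyadic blocks in [h] may run past [Hn]. *)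
pose mu h s := if (h <= Hn)%N && (pick (h * s)%N == (h, s)) then lam (h * s)%N else RtoC 0.
pose Phi d := \csum_(N <= n < 2 * N) \csum_(0 <= m < (natfl x %/ N).+1) Cmult (Cmult (bn n) (am m)) (zc x w b 1 d n m).
have hsD h s : (0 < h <= Hn)%N -> (0 < s <= Sn)%N -> (0 < h * s)%N /\ INR (h * s) <= D.
  move=> /andP [h0 hH] /andP [s0 sS]; split; first by rewrite muln_gt0 h0.
  rewrite mul_INR -HSD; apply: Rmult_le_compat; try exact: pos_INR.
    by have := leq_INR hH; rewrite -/Hn in Hn1; lra.
  by have := leq_INR sS; rewrite -/Sn in Sn1; lra.
have E : \csum_(1 <= d < Dn.+1) Cmult (lam d) (Phi d) =
  \csum_(1 <= h < Hn.+1) \csum_(1 <= s < Sn.+1) Cmult (mu h s) (Phi (h * s)%N).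
  rewrite (@pick_sum ps _ pick).
  - rewrite /ps big_allpairs; apply: eq_big_nat => h hh; apply: eq_bigr => s _ /=.
    by rewrite /mu (_ : (h <= Hn)%N) //; lia.
  - apply: allpairs_uniq; [exact: iota_uniq|exact: iota_uniq|by move=> [a1 a2] [b1 b2]].
  - exact: iota_uniq.
  - move=> d; rewrite mem_index_iota => hd nz.
    have dD : INR d <= D by apply/(le_natfl _ D0); lia.
    have d0 : (0 < d)%N by lia.
    have [_ ws] := Hl d d0 dD nz.
    have [h [s [h0 [s0 [hH [sS e]]]]]] := ws H S H1 S1 HSD.
    have hp : has (fun p : nat * nat => (p.1 * p.2)%N == d) ps.
      apply/hasP; exists (h, s); last by rewrite /= e.
      apply/allpairsP; exists (h, s); rewrite !mem_index_iota /=; split => //.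
        by apply/andP; split; [|rewrite ltnS; apply/(le_natfl _ H0)].
      by apply/andP; split; [|rewrite ltnS; apply/(le_natfl _ S0)].
    split; first by apply: mem_nth; rewrite -has_find.
    by have /eqP := nth_find (0, 0)%N hp.
  - move=> p /allpairsP [[h s] /= [h1 h2 ->]] /=; rewrite !mem_index_iota in h1 h2 *.
    have [||a1 a2] := hsD h s; try lia.
    by apply/andP; split => //; rewrite ltnS; apply/(le_natfl _ D0).
rewrite /bilin -/Dn E.
pose T h := \csum_(0 <= m < (natfl x %/ N).+1) Cmult (am m)
     (\csum_(1 <= s < Sn.+1) \csum_(N <= n < 2 * N) Cmult (Cmult (mu h s) (bn n)) (zc x w b h s n m)).
have ET h : \csum_(1 <= s < Sn.+1) Cmult (mu h s) (Phi (h * s)%N) = T h.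
  rewrite /T.
  have -> : \csum_(1 <= s < Sn.+1) Cmult (mu h s) (Phi (h * s)%N) =
    \csum_(1 <= s < Sn.+1) \csum_(0 <= m < (natfl x %/ N).+1) \csum_(N <= n < 2 * N)
      Cmult (am m) (Cmult (Cmult (mu h s) (bn n)) (zc x w b h s n m)).
    apply: eq_bigr => s _; rewrite /Phi exchange_big -csum_mulr; apply: eq_bigr => m _.
    rewrite -csum_mulr; apply: eq_bigr => n _; rewrite /zc mul1n; ring.
  rewrite exchange_big; apply: eq_bigr => m _; rewrite -csum_mulr; apply: eq_bigr => s _.
  by rewrite csum_mulr.
under eq_bigr do rewrite ET.
have T0 h : (Hn < h)%N -> T h = RtoC 0.
  move=> hh; rewrite /T big1 // => m _; rewrite big1 ?Cmult_0_r // => s _.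
  rewrite big1 // => n _; rewrite /mu (_ : (h <= Hn)%N = false) ?Cmult_0_l //; lia.
have Hn2M : (Hn.+1 <= 2 ^ M)%N.
  by apply: ltn_pow2 (set_log HS); have : D <= x; [nra|rewrite -/Hn in Hn1; lra].
have -> : \csum_(1 <= h < Hn.+1) T h = \csum_(1 <= h < 2 ^ M) T h.
  rewrite [RHS](@big_cat_nat _ _ _ Hn.+1) //= [X in (_ + X)%C]big1_seq ?Cplus_0_r // => h /andP [_].
  by rewrite mem_index_iota => hh; apply: T0; lia.
rewrite dyadic; apply: Rle_trans (Cmod_sum _ _) _.
have xy0 : 0 <= x / y by positivity.
have M3 : 0 <= INR M ^ 3 by positivity.
have C0 : 0 <= 31 * A * Ba * Bb * INR M ^ 3 * (x / y).
  by positivity.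
apply: Rle_trans (_ : \rsum_(0 <= i < M) (31 * A * Ba * Bb * INR M ^ 3 * (x / y)) <= _); last first.
  by rewrite rsum_const subn0; right; ring.
apply: rsum_nat_le => i _.
case: (leqP (2 ^ i) Hn) => hi; last first.
  rewrite big1_seq ?Cmod_0 // => h /andP [_]; rewrite mem_index_iota => hh; apply: T0; lia.
set Hb := (2 ^ i)%N in hi *.
have Hb0 : (0 < Hb)%N by rewrite expn_gt0.
have HbH : INR Hb <= H by apply/(le_natfl _ H0).
rewrite expnS -/Hb; apply: (typeII_block HS) => //.
- apply: Rle_trans HNle; apply: Rmult_le_compat_r; lra.
- nra.
- move=> Sb /andP [Sb0 SbS].
  have r0 : (0 < Hb * Sb)%N by rewrite muln_gt0 Hb0.
  have SbS2 : INR Sb <= S ^ 2.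
    apply: Rle_trans (_ : INR (Sn ^ 2) <= _); first exact: leq_INR.
    by rewrite exp_INR; apply: pow_incr; split => //; exact: pos_INR.
  have Hb1 : 0 <= INR Hb by exact: pos_INR. have Sb1 : 0 <= INR Sb by exact: pos_INR.
  (* If [H = N / y^2], then [H S^2 N = (H S)^2 y^2 = D^2 y^2], and [D ^ 2 * y ^ 64 <= x] leaves the
     length [y^50]. *)
  case: (Rle_lt_dec (INR N / y ^ 2) D) => hc.
    have [|h1 h2] := @typeII_len N 50 (Hb * Sb) N0 r0; last by split => //; left.
    have eH : H * y ^ 2 = INR N by rewrite /H Rmin_left //; field; lra.
    apply: Rle_trans HD.
    rewrite mul_INR -eH -HSD.
    apply: Rle_trans (_ : H * S ^ 2 * (H * y ^ 2) * y ^ 50 <= _).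
      apply: Rmult_le_compat_r; first by left; apply: (set_ypos HS).
      apply: Rmult_le_compat_r; first by lra.
      by apply: Rmult_le_compat.
    have -> : H * S ^ 2 * (H * y ^ 2) * y ^ 50 = (H * S) ^ 2 * y ^ 52 by ring.
    by apply: Rmult_le_compat_l; [exact: pow2_ge_0|apply: (set_ypow HS)].
  (* Here [S = 1], and the length [y^31] follows by squaring, from [N^2 <= 4 x] and
     [D ^ 2 * y ^ 64 <= x]. *)
  have eH : H = D by rewrite /H Rmin_right //; lra.
  have eS : S = 1 by rewrite /S eH; field; lra.
  have eSn : Sn = 1%N.
    rewrite /Sn eS /natfl; have [u1 u2] := archimed 1.
    have : (1 < up 1 <= 2)%Z.
      split; first by apply: lt_IZR; lra.
      by apply: le_IZR; lra.
    lia.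
  have eSb : Sb = 1%N by move: SbS; rewrite eSn; lia.
  have [|h1 h2] := @typeII_len N 31 (Hb * Sb) N0 r0; last by split => //; right.
  rewrite eSb muln1.
  have p : 0 <= INR Hb * INR N * y ^ 31 by positivity.
  have h1 : (INR Hb * INR N * y ^ 31) ^ 2 <= x ^ 2.
    have -> : (INR Hb * INR N * y ^ 31) ^ 2 = INR Hb ^ 2 * (INR N ^ 2 * y ^ 62) by ring.
    apply: Rle_trans (_ : D ^ 2 * (4 * x * y ^ 62) <= _).
      apply: Rmult_le_compat; [exact: pow2_ge_0| | |].
      - by positivity.
      - by apply: pow_incr; lra.
      - by apply: Rmult_le_compat_r => //; left; apply: (set_ypos HS).
    have -> : D ^ 2 * (4 * x * y ^ 62) = 4 * (D ^ 2 * y ^ 62) * x by ring.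
    have -> : x ^ 2 = x * x by ring.
    apply: Rmult_le_compat_r => //; apply: Rle_trans HD.
    have -> : D ^ 2 * y ^ 64 = y ^ 2 * (D ^ 2 * y ^ 62) by ring.
    apply: Rmult_le_compat_r; last by simpl; nra.
    by positivity.
  by nra.
- move=> h s hh hs; rewrite /mu; case: ifP => [/andP [hH _]|_]; last by rewrite Cmod_0.
  by have [||a1 a2] := hsD h s; [lia|lia|apply: HA].
- move=> h s hh hs g; rewrite /mu; case: ifP => // /andP [hH _].
  have [||a1 a2] := hsD h s; [lia|lia|].
  case: (Req_EM_T (Cmod (lam (h * s)%N)) 0) => [/Cmod_eq_0 //|nz].
  by case: g; have [|g _] := Hl _ a1 a2; [move=> z; apply: nz; rewrite z Cmod_0|].
Qed.

End Setting.

Section Setting.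
Variables (x y K w : R) (q M : nat).
Hypothesis HS : setting x y K w q M.

Lemma zc_large b d n m : (0 < d)%N -> x < INR (n * m) -> zc x w b 1 d n m = RtoC 0.
Proof.
move=> d0 h; rewrite /zc mul1n; case: ifP => // /(inAPP d0) [[_ h2] _]; lra.
Qed.

Lemma zc_zero b d n : (0 < d)%N -> zc x w b 1 d n 0 = RtoC 0.
Proof.
move=> d0; rewrite /zc mul1n muln0; case: ifP => // /(inAPP d0) [[h1 _] _].
by have := set_x HS; rewrite /= in h1; lra.
Qed.

Lemma zc_sym b d n m : zc x w b 1 d n m = zc x w b 1 d m n.
Proof. by rewrite /zc mulnC. Qed.

Lemma typeII_half (b : Z) (D : R) (I : nat) (lam am bn : nat -> C) (A Ba Bb : R) :
  1 <= D -> D ^ 2 * y ^ 64 <= x -> INR (2 ^ I) ^ 2 <= 16 * x ->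
  0 <= A -> 0 <= Ba -> 0 <= Bb ->
  (forall d, (0 < d)%N -> INR d <= D -> Cmod (lam d) <= A) ->
  (forall d, (0 < d)%N -> INR d <= D -> lam d <> RtoC 0 -> Z.gcd b (Z.of_nat d) = 1%Z /\ well_separable d D) ->
  (forall m, (m <= natfl x)%N -> Cmod (am m) <= Ba) ->
  (forall n, (n < 2 ^ I)%N -> Cmod (bn n) <= Bb) ->
  (forall n, INR n < 2 * y ^ 2 -> bn n = RtoC 0) ->
  Cmod (bilin x w b (natfl D) lam (index_iota 1 (2 ^ I)) (index_iota 0 (natfl x).+1) bn am)
  <= 31 * A * Ba * Bb * INR M ^ 5 * (x / y).
Proof.
move=> D1 HD HI A0 Ba0 Bb0 HA Hl HBa HBb Hb0.
have y3 := set_y HS; have x3 := set_x HS; have m1 := set_M1 HS.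
have x0 : 0 <= x by lra.
have IM : (I <= M)%N.
  have h : (2 ^ I < 2 ^ M)%N.
    have : INR (2 ^ I) < INR (2 ^ M).
      have := set_log HS; have := pos_INR (2 ^ I); nra.
    by move/INR_lt; lia.
  by rewrite ltn_exp2l // in h; apply: ltnW.
have -> : bilin x w b (natfl D) lam (index_iota 1 (2 ^ I)) (index_iota 0 (natfl x).+1) bn am =
  \csum_(0 <= i < I) bilin x w b (natfl D) lam (index_iota (2 ^ i) (2 * 2 ^ i))
     (index_iota 0 (natfl x %/ 2 ^ i).+1) bn am.
  rewrite /bilin exchange_big; apply: eq_big_nat => d hd.
  rewrite csum_mulr; congr Cmult; rewrite dyadic; apply: eq_bigr => i _.
  rewrite expnS; apply: eq_big_nat => n hn.
  have i0 : (0 < 2 ^ i)%N by rewrite expn_gt0.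
  rewrite (@big_cat_nat _ _ _ (natfl x %/ 2 ^ i).+1) //=; last by rewrite ltnS leq_div.
  rewrite [X in (_ + X)%C]big1_seq ?Cplus_0_r // => m /andP [_]; rewrite mem_index_iota => hm.
  rewrite zc_large ?Cmult_0_r //; first by lia.
  have [_ f2] := natflP x0; apply: Rlt_le_trans f2 _; rewrite -S_INR; apply: leq_INR.
  have : (natfl x < (natfl x %/ 2 ^ i).+1 * 2 ^ i)%N by apply: ltn_ceil.
  move=> h; apply: leq_trans h _; rewrite mulnC; apply: leq_mul; lia.
apply: Rle_trans (Cmod_sum _ _) _.
have xy0 : 0 <= x / y by positivity.
have M4 : 0 <= INR M ^ 4 by positivity.
have C0 : 0 <= 31 * A * Ba * Bb * INR M ^ 4 * (x / y).
  by positivity.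
apply: Rle_trans (_ : \rsum_(0 <= i < I) (31 * A * Ba * Bb * INR M ^ 4 * (x / y)) <= _); last first.
  rewrite rsum_const subn0.
  apply: Rle_trans (Rmult_le_compat_r _ _ _ C0 (leq_INR IM)) _; right; ring.
apply: rsum_nat_le => i hi.
(* A block ending below [2 y^2] meets only vanishing [bn]; every other block starts at some
   [N >= y^2], as [typeII_dyadic] needs. *)
case: (Rlt_le_dec (INR (2 * 2 ^ i)) (2 * y ^ 2)) => hc.
  rewrite /bilin big1 ?Cmod_0 // => d _; rewrite big1_seq ?Cmult_0_r // => n /andP [_].
  rewrite mem_index_iota => hn; rewrite big1 // => m _; rewrite Hb0 ?Cmult_0_l //.
  apply: Rle_lt_trans hc; apply: leq_INR; lia.
have hI : (2 * 2 ^ i <= 2 ^ I)%N by rewrite -expnS leq_exp2l //; lia.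
rewrite mul_INR (_ : INR 2 = 2) // in hc.
apply: (typeII_dyadic HS) => //; first by lra.
  have := leq_INR hI; rewrite mul_INR (_ : INR 2 = 2) // => h.
  have := pos_INR (2 ^ i); nra.
by move=> n hn; apply: HBb; lia.
Qed.

(** Of two factors with product at most [x], one is below [2 ^ I], the least power of two above the
    square root of [x]. That factor takes the place of [n], because [typeII_dyadic] needs [N] of
    size at most the square root of [x]; pairs with large [n] are handled by exchanging the two
    sequences. *)
Lemma typeII (b : Z) (D : R) (lam am bn : nat -> C) (A Ba Bb : R) :
  1 <= D -> D ^ 2 * y ^ 64 <= x -> 0 <= A -> 0 <= Ba -> 0 <= Bb ->
  (forall d, (0 < d)%N -> INR d <= D -> Cmod (lam d) <= A) ->
  (forall d, (0 < d)%N -> INR d <= D -> lam d <> RtoC 0 -> Z.gcd b (Z.of_nat d) = 1%Z /\ well_separable d D) ->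
  (forall m, (m <= natfl x)%N -> Cmod (am m) <= Ba) ->
  (forall n, (n <= natfl x)%N -> Cmod (bn n) <= Bb) ->
  (forall n, INR n < 2 * y ^ 2 -> am n = RtoC 0) ->
  (forall n, INR n < 2 * y ^ 2 -> bn n = RtoC 0) ->
  Cmod (bilin x w b (natfl D) lam (index_iota 1 (natfl x).+1) (index_iota 1 (natfl x).+1) bn am)
  <= 62 * A * Ba * Bb * INR M ^ 5 * (x / y).
Proof.
move=> D1 HD A0 Ba0 Bb0 HA Hl HBa HBb Ha0 Hb0.
have y3 := set_y HS; have x3 := set_x HS; have m1 := set_M1 HS.
have x0 : 0 <= x by lra.
have [f1 f2] := natflP x0.
have exI : exists i, Rltb x (INR (2 ^ i) ^ 2).
  exists M; apply/RltbP; have := set_log HS.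
  have : 1 <= INR (2 ^ M) by apply: (leq_INR (a := 1)); rewrite expn_gt0.
  by nra.
case: (ex_minnP exI) => I /RltbP HI minI.
have I0 : (0 < I)%N by case: (I) HI => // ; rewrite expn0 /=; lra.
have HI2 : INR (2 ^ I) ^ 2 <= 4 * x.
  case: I HI minI I0 => // I HI minI _.
  case: (Rle_lt_dec (INR (2 ^ I) ^ 2) x) => h; last first.
    by have := minI I; rewrite (introT (RltbP _ _) h) => /(_ isT); lia.
  by rewrite expnS mul_INR (_ : INR 2 = 2) //; lra.
have HIX : (2 ^ I <= (natfl x).+1)%N.
  have : INR (2 ^ I) < INR (natfl x).+1 by rewrite S_INR; have := pos_INR (2 ^ I); nra.
  by move/INR_lt; lia.
have I20 : (0 < 2 ^ I)%N by rewrite expn_gt0.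
(* Pairs with both factors below [2 ^ I] already occur in the first sum; [b'] removes them from the
   exchanged one. *)
pose b' n := if (2 ^ I <= n)%N then bn n else RtoC 0.
have split_d d : (0 < d)%N -> \csum_(1 <= n < (natfl x).+1) \csum_(1 <= m < (natfl x).+1) Cmult (Cmult (bn n) (am m)) (zc x w b 1 d n m)
  = Cplus (\csum_(1 <= n < 2 ^ I) \csum_(0 <= m < (natfl x).+1) Cmult (Cmult (bn n) (am m)) (zc x w b 1 d n m))
   (\csum_(1 <= n < 2 ^ I) \csum_(0 <= m < (natfl x).+1) Cmult (Cmult (am n) (b' m)) (zc x w b 1 d n m)).
  move=> d0; rewrite (@big_cat_nat _ _ _ (2 ^ I)) //=; congr Cplus.
    apply: eq_bigr => n _; rewrite [RHS]big_ltn // zc_zero // Cmult_0_r Cplus_0_l //.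
  have -> : \csum_(2 ^ I <= n < (natfl x).+1) \csum_(1 <= m < (natfl x).+1) Cmult (Cmult (bn n) (am m)) (zc x w b 1 d n m)
    = \csum_(2 ^ I <= n < (natfl x).+1) \csum_(1 <= m < 2 ^ I) Cmult (Cmult (bn n) (am m)) (zc x w b 1 d n m).
    apply: eq_big_nat => n hn; rewrite (@big_cat_nat _ _ _ (2 ^ I)) //=.
    rewrite [X in (_ + X)%C]big1_seq ?Cplus_0_r // => m /andP [_]; rewrite mem_index_iota => hm.
    rewrite zc_large ?Cmult_0_r //; apply: Rlt_le_trans HI _.
    rewrite -exp_INR; apply: leq_INR; rewrite expnS expn1; apply: leq_mul; lia.
  rewrite exchange_big; apply: eq_bigr => m _.
  rewrite [RHS](@big_cat_nat _ _ _ (2 ^ I)) //= [X in _ = (X + _)%C]big1_seq ?Cplus_0_l; last first.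
    move=> n /andP [_]; rewrite mem_index_iota => hn.
    by rewrite /b' leqNgt (_ : (n < 2 ^ I)%N) /= ?Cmult_0_r ?Cmult_0_l //; lia.
  apply: eq_big_nat => n hn; rewrite /b' (_ : (2 ^ I <= n)%N); last by lia.
  by rewrite zc_sym (Cmult_comm (bn n)).
have -> : bilin x w b (natfl D) lam (index_iota 1 (natfl x).+1) (index_iota 1 (natfl x).+1) bn am =
  Cplus (bilin x w b (natfl D) lam (index_iota 1 (2 ^ I)) (index_iota 0 (natfl x).+1) bn am)
   (bilin x w b (natfl D) lam (index_iota 1 (2 ^ I)) (index_iota 0 (natfl x).+1) am b').
  rewrite /bilin -csum_split; apply: eq_big_nat => d hd.
  by rewrite split_d ?Cmult_plus_distr_l //; lia.
apply: Rle_trans (Cmod_triangle _ _) _.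
have H1 : Cmod (bilin x w b (natfl D) lam (index_iota 1 (2 ^ I)) (index_iota 0 (natfl x).+1) bn am) <= 31 * A * Ba * Bb * INR M ^ 5 * (x / y).
  apply: typeII_half => //; first by lra.
  by move=> n hn; apply: HBb; lia.
have H2 : Cmod (bilin x w b (natfl D) lam (index_iota 1 (2 ^ I)) (index_iota 0 (natfl x).+1) am b') <= 31 * A * Bb * Ba * INR M ^ 5 * (x / y).
  apply: typeII_half => //; first by lra.
    by move=> n hn; rewrite /b'; case: ifP => _; [exact: HBb|rewrite Cmod_0].
  by move=> n hn; apply: HBa; lia.
lra.
Qed.

End Setting.

(** * Vaughan's identity *)

(* The Moebius function, by recursion on the least prime factor; [k] is fuel. *)
Fixpoint mobr (k n : nat) : R :=
  if k is k'.+1 then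
    if (n <= 1)%N then (if n == 1%N then 1 else 0)
    else if (pdiv n %| n %/ pdiv n)%N then 0 else - mobr k' (n %/ pdiv n)
  else 0.
Definition mob (n : nat) : R := mobr n n.

Lemma div_pdiv_lt n : (1 < n)%N -> (n %/ pdiv n < n)%N.
Proof. by move=> h; apply: ltn_Pdiv; [apply: prime_gt1; apply: pdiv_prime|lia]. Qed.

Lemma mobr_fuel k n : (n <= k)%N -> mobr k n = mob n.
Proof.
rewrite /mob; elim: k {-2}k (leqnn k) n => [|K IH] k hk n hn.
  have -> : n = 0%N by lia.
  by have -> : k = 0%N by lia.
case: k hk hn => [|k] hk hn; first by have -> : n = 0%N by lia.
case: n hn => [|n] hn //=.
case: ifP => // n1; case: ifP => // _; congr Ropp.
have lt := @div_pdiv_lt n.+1 ltac:(lia).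
by rewrite !IH //; lia.
Qed.

Lemma mob1 : mob 1 = 1. Proof. by []. Qed.

Lemma mob_rec n : (1 < n)%N ->
  mob n = if (pdiv n %| n %/ pdiv n)%N then 0 else - mob (n %/ pdiv n).
Proof.
case: n => [|n] // n1; rewrite /mob /= leqNgt n1 /=; case: ifP => // _.
by rewrite mobr_fuel //; have := div_pdiv_lt n1; lia.
Qed.

Lemma mob_abs n : Rabs (mob n) <= 1.
Proof.
elim: {n}n.+1 {-2}n (ltnSn n) => [|k IH] n hn; first by lia.
case: (ltnP 1 n) => [n1|].
  rewrite mob_rec //; case: ifP => _; first by rewrite Rabs_R0; lra.
  by rewrite Rabs_Ropp; apply: IH; have := div_pdiv_lt n1; lia.
case: n {hn} => [|[|n]] // _; rewrite /mob /=; split_Rabs; lra.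
Qed.

Lemma big_reindex_dvd (T : Type) (idx : T) (op : Monoid.com_law idx) (m N : nat) (G : nat -> T) :
  (0 < m)%N -> (forall k, (N < k)%N -> G k = idx) ->
  \big[op/idx]_(1 <= k < N.+1) (if (m %| k)%N then G k else idx) = \big[op/idx]_(1 <= l < N.+1) G (m * l)%N.
Proof.
move=> m0 G0.
have -> : \big[op/idx]_(1 <= l < N.+1) G (m * l)%N = \big[op/idx]_(1 <= l < N.+1) (if (m * l <= N)%N then G (m * l)%N else idx).
  by apply: eq_bigr => l _; case: leqP => // /G0.
rewrite -[LHS]big_mkcond -[RHS]big_mkcond -[LHS]big_filter -[RHS]big_filter.
rewrite -[RHS](big_map (fun l => m * l)%N xpredT G).
apply: perm_big; apply: uniq_perm.
- by rewrite filter_uniq // iota_uniq.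
- rewrite map_inj_uniq ?filter_uniq ?iota_uniq // => t t' /eqP.
  by rewrite eqn_pmul2l // => /eqP.
move=> k; rewrite mem_filter mem_index_iota; apply/andP/mapP => [[/dvdnP [l ->]] h|[l]].
  exists l; last by rewrite mulnC.
  by rewrite mem_filter mem_index_iota; case: l h => [|l] h; nia.
rewrite mem_filter mem_index_iota => h ->; split; first exact: dvdn_mulr.
by case: l h => [|l] h; nia.
Qed.

(** With [p] the least prime factor of [n], the divisors prime to [p] are paired with their
    multiples by [p]. For [p e] dividing [n], the least prime factor of [p e] is again [p], so one
    step of the recursion gives [mob (p * e)]: either [- mob e], or 0 if [p] divides [e]. *)
Lemma sum_mob_dvd (n N : nat) : (0 < n <= N)%N ->
  \rsum_(1 <= d < N.+1) (if (d %| n)%N then mob d else 0) = if n == 1%N then 1 else 0.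
Proof.
move=> /andP [n0 nN]; case: eqP => [e|/eqP n1].
  rewrite big_ltn; last by lia.
  rewrite e dvdn1 /= mob1 big1_seq ?Rplus_0_r // => d /andP [_].
  by rewrite mem_index_iota => hd; rewrite dvdn1; case: eqP => // hh; lia.
have n2 : (1 < n)%N by lia.
set p := pdiv n; have pp : prime p by apply: pdiv_prime.
have pn : (p %| n)%N by apply: pdiv_dvd.
have p0 := prime_gt0 pp.
have -> : \rsum_(1 <= d < N.+1) (if (d %| n)%N then mob d else 0) =
  \rsum_(1 <= d < N.+1) (if (d %| n)%N && ~~ (p %| d)%N then mob d else 0) +
  \rsum_(1 <= d < N.+1) (if (p %| d)%N then (if (d %| n)%N then mob d else 0) else 0).
  rewrite -rsum_split; apply: eq_bigr => d _.
  by case: (d %| n)%N; case: (p %| d)%N => /=; lra.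
rewrite (@big_reindex_dvd _ _ Rplus p N (fun d => if (d %| n)%N then mob d else 0)) //; last first.
  by move=> k hk; case: ifP => // /dvdn_leq h; have := h n0; lia.
rewrite -rsum_split big1_seq // => e /andP [_]; rewrite mem_index_iota => he.
have e0 : (0 < e)%N by lia.
case: (boolP (p * e %| n)%N) => [hpe|hpe]; last first.
  case: (boolP (p %| e)%N) => [_|hp]; first by rewrite andbF; lra.
  case: (boolP (e %| n)%N) => [he'|_] /=; last by lra.
  by move: hpe; rewrite Gauss_dvd ?pn ?he' // prime_coprime.
have pe1 : (1 < p * e)%N by have := prime_gt1 pp; nia.
have pd : pdiv (p * e) = p.
  apply/eqP; rewrite eqn_leq; apply/andP; split.
    by apply: pdiv_min_dvd; [apply: prime_gt1|apply: dvdn_mulr].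
  apply: pdiv_min_dvd; first by apply: prime_gt1; apply: pdiv_prime.
  by apply: dvdn_trans (pdiv_dvd _) hpe.
rewrite (mob_rec pe1) pd mulKn //.
have -> : (e %| n)%N by apply: dvdn_trans hpe; apply: dvdn_mull.
by case: (p %| e)%N => /=; lra.
Qed.

Lemma vonMangoldt_neq0 d : vonMangoldt d <> 0 -> exists p j, [/\ prime p, (0 < j)%N & d = (p ^ j)%N].
Proof.
rewrite /vonMangoldt; case E : (primes d) => [|p [|p' l]] // _.
have : p \in primes d by rewrite E inE.
rewrite mem_primes => /and3P [pp d0 pd]; exists p, (logn p d); split => //.
  by rewrite logn_gt0 E inE.
by rewrite -p_part part_pnat_id // /pnat d0 E /= inE eqxx.
Qed.

Lemma vonMangoldt_pow p j : prime p -> (0 < j)%N -> vonMangoldt (p ^ j) = ln (INR p).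
Proof. by move=> pp j0; rewrite /vonMangoldt primesX // primes_prime. Qed.

Lemma ln_INR_ge0 n : 0 <= ln (INR n).
Proof.
case: n => [|n].
  rewrite /ln; case: (Rlt_dec 0 (INR 0)) => h; last exact: Rle_refl.
  by exfalso; rewrite /= in h; lra.
have h : 1 <= INR n.+1 by apply: (leq_INR (a := 1)).
by rewrite -ln_1; apply: ln_le; lra.
Qed.

Lemma vonMangoldt_ge0 n : 0 <= vonMangoldt n.
Proof. by rewrite /vonMangoldt; case: (primes n) => [|p [|]]; [lra|apply: ln_INR_ge0|move=> *; lra]. Qed.

(** Induction along [n = p m]: passing from [m] to [n] adds exactly one prime power divisor,
    [p ^ (logn p m).+1], of weight [ln p]. *)
Lemma sum_vonMangoldt_dvd (n N : nat) : (0 < n <= N)%N ->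
  \rsum_(1 <= d < N.+1) (if (d %| n)%N then vonMangoldt d else 0) = ln (INR n).
Proof.
elim: {n}n.+1 {-2}n (ltnSn n) => [|k IH] n hn; first by lia.
move=> /andP [n0 nN]; case: (ltnP 1 n) => n1; last first.
  have -> : n = 1%N by lia.
  rewrite ln_1 big1_seq // => d _; rewrite dvdn1; case: eqP => // ->.
  by rewrite /vonMangoldt.
set p := pdiv n; have pp : prime p by apply: pdiv_prime.
have pn : (p %| n)%N by apply: pdiv_dvd.
set m := (n %/ p)%N; have nE : n = (p * m)%N by rewrite /m mulnC divnK.
have m0 : (0 < m)%N by rewrite /m divn_gt0 ?pdiv_leq // prime_gt0.
have mn : (m < n)%N by apply: div_pdiv_lt.
have p0 : 0 < INR p by apply: (ltn_INR (a := 0)); apply: prime_gt0.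
have -> : ln (INR n) = ln (INR p) + ln (INR m).
  by rewrite {1}nE mul_INR ln_mult //; apply: (ltn_INR (a := 0)).
rewrite -(IH m) //; [|lia|lia].
pose d0 := (p ^ (logn p m).+1)%N.
have d0n : (d0 %| n)%N.
  by rewrite nE /d0 expnS dvdn_pmul2l ?prime_gt0 // pfactor_dvdn.
have d0m : ~~ (d0 %| m)%N by rewrite /d0 pfactor_dvdn // -ltnNge.
have hd0 : d0 \in index_iota 1 N.+1.
  rewrite mem_index_iota expn_gt0 prime_gt0 //=; have := dvdn_leq n0 d0n; lia.
have key d : vonMangoldt d <> 0 -> (d %| n)%N -> ~~ (d %| m)%N -> d = d0.
  move=> /vonMangoldt_neq0 [r [j [rp j0 ->]]] h1 h2.
  have rE : r = p.
    case: (eqVneq r p) => // ne; move: h1; rewrite nE Gauss_dvdr ?(negPf h2) //.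
    by rewrite coprime_pexpl // prime_coprime // dvdn_prime2.
  rewrite rE in h1 h2 *; rewrite /d0; congr expn.
  move: h2; rewrite pfactor_dvdn // -ltnNge => h2.
  move: h1; rewrite nE pfactor_dvdn ?muln_gt0 ?m0 ?(prime_gt0 pp) // lognM ?(prime_gt0 pp) //.
  by rewrite (pfactorK 1 pp) /=; lia.
have -> : \rsum_(1 <= d < N.+1) (if (d %| n)%N then vonMangoldt d else 0) =
  \rsum_(1 <= d < N.+1) ((if (d %| m)%N then vonMangoldt d else 0) + (if d == d0 then ln (INR p) else 0)).
  apply: eq_bigr => d _.
  case: (eqVneq d d0) => [->|ne].
    by rewrite d0n (negPf d0m) vonMangoldt_pow //; lra.
  case: (boolP (d %| m)%N) => hm.
    by rewrite nE dvdn_mull //; lra.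
  case: ifP => hd; last by lra.
  case: (Req_dec (vonMangoldt d) 0) => [->|nz]; first by lra.
  by move: ne; rewrite (key d nz hd hm) eqxx.
rewrite rsum_split Rplus_comm; congr Rplus.
rewrite (bigD1_seq _ hd0) ?iota_uniq //= eqxx big1 ?Rplus_0_r //.
by move=> d /negPf ->.
Qed.

Lemma vonMangoldt_le n : vonMangoldt n <= ln (INR n).
Proof.
case: (posnP n) => [->|n0]; first by rewrite /vonMangoldt /=; apply: (ln_INR_ge0 0).
rewrite -(@sum_vonMangoldt_dvd n n) ?n0 ?leqnn //.
rewrite big_nat_recr //= dvdnn.
have : 0 <= \rsum_(1 <= i < n) (if (i %| n)%N then vonMangoldt i else 0).
  by apply: rsum_ge0 => i _; case: ifP => _; [apply: vonMangoldt_ge0|lra].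
lra.
Qed.

Section Vaughan.
Variables (V X : nat) (F : nat -> C).
Hypothesis V0 : (0 < V)%N.
Hypothesis VX : (V <= X)%N.
Hypothesis FX : forall k, (X < k)%N -> F k = RtoC 0.
Hypothesis FV : forall k, (k <= V)%N -> F k = RtoC 0.

(** The divisor sum of [mob] truncated at [V]. It is 1 at 1 and 0 at the other integers up to [V],
    so apart from 1 only the arguments kept by [vB] matter. *)
Definition vA (k : nat) : R := \rsum_(1 <= m < V.+1) (if (m %| k)%N then mob m else 0).
Definition vB (m : nat) : R := if (V < m)%N then vA m else 0.
Definition vL (n : nat) : R := if (V < n)%N then vonMangoldt n else 0.
Definition vC (k : nat) : R :=
  \rsum_(1 <= m < V.+1) \rsum_(1 <= a < V.+1) (if (m * a == k)%N then mob m * vonMangoldt a else 0).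

Lemma vA_small m : (0 < m <= V)%N -> vA m = if m == 1%N then 1 else 0.
Proof. exact: sum_mob_dvd. Qed.

Let T m a := \csum_(1 <= l < X.+1) Cmult (RtoC (mob m)) (Cmult (RtoC (vonMangoldt a)) (F (m * a * l))).

Lemma vaughan1 :
  \csum_(1 <= m < V.+1) Cmult (RtoC (mob m)) (\csum_(1 <= l < X.+1) Cmult (RtoC (ln (INR l))) (F (m * l))) =
  \csum_(1 <= m < V.+1) \csum_(1 <= a < X.+1) T m a.
Proof.
apply: eq_big_nat => m hm; rewrite /T.
have -> : \csum_(1 <= l < X.+1) Cmult (RtoC (ln (INR l))) (F (m * l)) =
  \csum_(1 <= l < X.+1) \csum_(1 <= a < X.+1) (if (a %| l)%N then Cmult (RtoC (vonMangoldt a)) (F (m * l)) else RtoC 0).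
  apply: eq_big_nat => l hl; rewrite -(@sum_vonMangoldt_dvd l X) //.
  rewrite RtoC_sum Cmult_comm -csum_mulr; apply: eq_bigr => a _.
  by case: ifP => _; rewrite ?Cmult_0_r // Cmult_comm.
rewrite exchange_big -csum_mulr; apply: eq_big_nat => a ha.
rewrite (@big_reindex_dvd _ _ Cplus a X (fun l => Cmult (RtoC (vonMangoldt a)) (F (m * l)))); [|lia|].
  by rewrite -csum_mulr; apply: eq_bigr => l _; rewrite mulnA.
by move=> k hk; rewrite FX ?Cmult_0_r //; apply: leq_trans hk _; apply: leq_pmull; lia.
Qed.

Lemma vaughan2 :
  \csum_(1 <= k < (V * V).+1) Cmult (RtoC (vC k)) (\csum_(1 <= l < X.+1) F (k * l)) =
  \csum_(1 <= m < V.+1) \csum_(1 <= a < V.+1) T m a.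
Proof.
pose S k := \csum_(1 <= l < X.+1) F (k * l).
have -> : \csum_(1 <= k < (V * V).+1) Cmult (RtoC (vC k)) (S k) =
  \csum_(1 <= k < (V * V).+1) \csum_(1 <= m < V.+1) \csum_(1 <= a < V.+1)
     (if (m * a == k)%N then Cmult (Cmult (RtoC (mob m)) (RtoC (vonMangoldt a))) (S k) else RtoC 0).
  apply: eq_bigr => k _; rewrite /vC RtoC_sum Cmult_comm -csum_mulr; apply: eq_bigr => m _.
  rewrite RtoC_sum -csum_mulr; apply: eq_bigr => a _.
  by case: ifP => _; rewrite ?Cmult_0_r // RtoC_mult Cmult_comm.
rewrite exchange_big; apply: eq_big_nat => m hm; rewrite exchange_big; apply: eq_big_nat => a ha.
have hin : (m * a)%N \in index_iota 1 (V * V).+1.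
  by rewrite mem_index_iota; have := @leq_mul m a V V; lia.
rewrite (bigD1_seq _ hin) ?iota_uniq //= eqxx big1 ?Cplus_0_r; last first.
  by move=> k ne; rewrite eq_sym (negPf ne).
by rewrite /T /S -csum_mulr; apply: eq_bigr => l _; rewrite -Cmult_assoc.
Qed.

(** The logarithmic sum and the [vC] sum are sums of the same [T m a], over all [a] and over
    [a <= V]. Their difference is the part [a > V], in which [m l = k] collects to [vA k]; there
    [k = 1] returns the original sum and [k > V] gives the bilinear one. As [F] vanishes up to [V],
    no term for small [n] remains. *)
Lemma vaughan :
  \csum_(1 <= n < X.+1) Cmult (RtoC (vonMangoldt n)) (F n) =
  (\csum_(1 <= m < V.+1) Cmult (RtoC (mob m)) (\csum_(1 <= l < X.+1) Cmult (RtoC (ln (INR l))) (F (m * l)))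
   - \csum_(1 <= k < (V * V).+1) Cmult (RtoC (vC k)) (\csum_(1 <= l < X.+1) F (k * l))
   - \csum_(1 <= n < X.+1) \csum_(1 <= m < X.+1) Cmult (Cmult (RtoC (vL n)) (RtoC (vB m))) (F (n * m)))%C.
Proof.
rewrite vaughan1 vaughan2.
have E1 : \csum_(1 <= m < V.+1) \csum_(1 <= a < X.+1) T m a =
  Cplus (\csum_(1 <= m < V.+1) \csum_(1 <= a < V.+1) T m a)
        (\csum_(1 <= m < V.+1) \csum_(V.+1 <= a < X.+1) T m a).
  by rewrite -csum_split; apply: eq_bigr => m _; rewrite -big_cat_nat.
have E2 : \csum_(1 <= m < V.+1) \csum_(V.+1 <= a < X.+1) T m a =
  \csum_(V.+1 <= a < X.+1) \csum_(1 <= k < X.+1) Cmult (Cmult (RtoC (vonMangoldt a)) (RtoC (vA k))) (F (a * k)).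
  rewrite exchange_big; apply: eq_big_nat => a ha.
  have -> : \csum_(1 <= m < V.+1) T m a =
    \csum_(1 <= m < V.+1) \csum_(1 <= k < X.+1)
       (if (m %| k)%N then Cmult (Cmult (RtoC (vonMangoldt a)) (RtoC (mob m))) (F (a * k)) else RtoC 0).
    apply: eq_big_nat => m hm.
    rewrite (@big_reindex_dvd _ _ Cplus m X (fun k => Cmult (Cmult (RtoC (vonMangoldt a)) (RtoC (mob m))) (F (a * k)))); [|lia|].
      by apply: eq_bigr => l _; rewrite (mulnC m a) -mulnA; ring.
    by move=> k hk; rewrite FX ?Cmult_0_r //; apply: leq_trans hk _; apply: leq_pmull; lia.
  rewrite exchange_big; apply: eq_bigr => k _.
  rewrite /vA RtoC_sum Cmult_comm Cmult_assoc -csum_mulr.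
  apply: eq_bigr => m _; case: ifP => _; rewrite ?Cmult_0_r //; ring.
have E3 : \csum_(1 <= n < X.+1) Cmult (RtoC (vonMangoldt n)) (F n) =
  \csum_(V.+1 <= n < X.+1) Cmult (RtoC (vonMangoldt n)) (F n).
  rewrite (@big_cat_nat _ _ _ V.+1) //= big1_seq ?Cplus_0_l // => n /andP [_].
  by rewrite mem_index_iota => hn; rewrite FV ?Cmult_0_r //; lia.
have E4 : \csum_(1 <= n < X.+1) \csum_(1 <= m < X.+1) Cmult (Cmult (RtoC (vL n)) (RtoC (vB m))) (F (n * m)) =
  \csum_(V.+1 <= n < X.+1) \csum_(1 <= m < X.+1) Cmult (Cmult (RtoC (vonMangoldt n)) (RtoC (vB m))) (F (n * m)).
  rewrite (@big_cat_nat _ _ _ V.+1) //= big1_seq ?Cplus_0_l.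
    apply: eq_big_nat => n hn; apply: eq_bigr => m _.
    by rewrite /vL (_ : (V < n)%N) //; lia.
  move=> n /andP [_]; rewrite mem_index_iota => hn; rewrite big1 // => m _.
  by rewrite /vL ltnNge (_ : (n <= V)%N) /= ?Cmult_0_l //; lia.
have E5 : \csum_(V.+1 <= n < X.+1) \csum_(1 <= m < X.+1) Cmult (Cmult (RtoC (vonMangoldt n)) (RtoC (vA m))) (F (n * m)) =
  Cplus (\csum_(V.+1 <= n < X.+1) \csum_(1 <= m < X.+1) Cmult (Cmult (RtoC (vonMangoldt n)) (RtoC (vB m))) (F (n * m)))
   (\csum_(V.+1 <= n < X.+1) Cmult (RtoC (vonMangoldt n)) (F n)).
  rewrite -csum_split; apply: eq_big_nat => n hn.
  have X1 : (1 < X.+1)%N by lia.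
  have -> : Cmult (RtoC (vonMangoldt n)) (F n) =
    \csum_(1 <= m < X.+1) (if m == 1%N then Cmult (RtoC (vonMangoldt n)) (F (n * m)) else RtoC 0).
    rewrite big_ltn //= muln1 big1_seq ?Cplus_0_r // => m /andP [_]; rewrite mem_index_iota => hm.
    by case: eqP => // e; lia.
  rewrite -csum_split; apply: eq_big_nat => m hm.
  rewrite /vB; case: (leqP m V) => hmV.
    rewrite vA_small; last by lia.
    by case: eqP => _; rewrite ?Cmult_1_r ?Cmult_0_r ?Cmult_0_l; ring.
  by case: eqP => [e|_]; [lia|rewrite Cplus_0_r].
rewrite E3 E4 E1 E2 E5; ring.
Qed.

End Vaughan.

Lemma Rabs_rsum (I : Type) (s : seq I) (f : I -> R) :
  Rabs (\rsum_(i <- s) f i) <= \rsum_(i <- s) Rabs (f i).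
Proof.
elim: s => [|a s IH]; first by rewrite !big_nil Rabs_R0; lra.
by rewrite !big_cons; apply: Rle_trans (Rabs_triang _ _) _; lra.
Qed.

Lemma ln_INR_le (m n : nat) : (m <= n)%N -> ln (INR m) <= ln (INR n).
Proof.
case: m => [|m] h.
  apply: Rle_trans (ln_INR_ge0 n); rewrite /ln.
  case: (Rlt_dec 0 (INR 0)) => h0; last exact: Rle_refl.
  by exfalso; rewrite /= in h0; lra.
by apply: ln_le; [apply: (ltn_INR (a := 0))|exact: leq_INR].
Qed.

Lemma ln_le_pow2 (z : R) (n : nat) : 0 < z -> z < INR (2 ^ n) -> ln z <= INR n.
Proof.
move=> z0 h; apply: Rle_trans (ln_le _ _ z0 (Rlt_le _ _ h)) _.
rewrite exp_INR (_ : INR 2 = 2) // ln_pow; last lra.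
have := pos_INR n; have : ln 2 <= 1; last by nra.
apply: Rle_trans (_ : ln (exp 1) <= _); last by rewrite ln_exp; lra.
by apply: ln_le; [lra|have := exp_ineq1 1 ltac:(lra); lra].
Qed.

(** * The sum over moduli coprime to [b] *)

Section Setting.
Variables (x y K w : R) (q M : nat).
Hypothesis HS : setting x y K w q M.

(** The type I sums have moduli [d m] up to [9 D y^4], and squaring [9 D y^4 * y^60 <= x] reduces it
    to [D ^ 2 * y ^ 64 <= x] and [81 y^64 <= x]. Seven factors [M] cover the logarithms and divisor
    functions of all three parts. *)
Lemma core_bound (b : Z) (D : R) (lam : nat -> C) (A : R) :
  1 <= D -> D ^ 2 * y ^ 64 <= x -> 0 <= A ->
  (forall d, (0 < d)%N -> INR d <= D -> Cmod (lam d) <= A) ->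
  (forall d, (0 < d)%N -> INR d <= D -> lam d <> RtoC 0 -> Z.gcd b (Z.of_nat d) = 1%Z /\ well_separable d D) ->
  Cmod (\csum_(1 <= d < (natfl D).+1) Cmult (lam d) (mangoldt_sum x w b d)) <= 200 * A * INR M ^ 7 * (x / y).
Proof.
move=> D1 HD A0 HA Hl.
have y3 := set_y HS; have x3 := set_x HS; have m1 := set_M1 HS.
have x0 : 0 <= x by lra.
have [f1 f2] := natflP x0.
have D0 : 0 <= D by lra.
have [D2 D3] := natflP D0.
(* The successor puts [V] above [2 y^2]: both type II coefficients then vanish below [2 y^2], while
   [V * V <= 9 y^4] keeps the type I sums long. *)
pose Dn := natfl D; pose X := natfl x; pose V := (natfl (2 * y ^ 2)).+1.
have y2 := set_ypos HS 2.
have Vy0 : 0 <= 2 * y ^ 2 by lra.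
have [V1 V2] := natflP Vy0.
have Vr : INR V <= 3 * y ^ 2 by rewrite /V S_INR; simpl in *; nra.
have Vlow n : INR n < 2 * y ^ 2 -> (n <= V)%N.
  by move=> h; apply: leqW; apply/(le_natfl _ Vy0); lra.
have y4x : y ^ 4 * 100 <= x.
  apply: Rle_trans (set_xy HS).
  have -> : y ^ 150 = y ^ 4 * y ^ 146 by rewrite -pow_add.
  apply: Rmult_le_compat_l; first by left; apply: (set_ypos HS).
  by have := set_ypow HS (isT : 1 <= 146)%N; rewrite pow_1; lra.
have y24 : y ^ 2 <= y ^ 4 by apply: (set_ypow HS).
have V0 : (0 < V)%N by [].
have Vx2 : INR V < x / 2 by lra.
have VX : (V <= X)%N by apply/(le_natfl _ x0); lra.
have VVr : INR (V * V) <= 9 * y ^ 4.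
  rewrite mul_INR; have := pos_INR V; have -> : 9 * y ^ 4 = (3 * y ^ 2) * (3 * y ^ 2) by ring.
  by move=> h; apply: Rmult_le_compat.
have VVx : INR (V * V) <= x by lra.
have lnM n : (n <= X)%N -> 0 <= ln (INR n) <= INR M.
  move=> hn; split; first exact: ln_INR_ge0.
  apply: Rle_trans (ln_INR_le hn) _; apply: ln_le_pow2.
    by apply: (ltn_INR (a := 0)); lia.
  by apply: Rle_lt_trans f1 (set_log HS).
have HA' d : (0 < d <= Dn)%N -> Cmod (lam d) <= A.
  by move=> /andP [d0 dD]; apply: HA => //; apply/(le_natfl _ D0).
have Hg' d : (0 < d <= Dn)%N -> Z.gcd b (Z.of_nat d) <> 1%Z -> lam d = RtoC 0.
  move=> /andP [d0 dD] g; case: (Req_EM_T (Cmod (lam d)) 0) => [/Cmod_eq_0 //|nz].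
  case: g; have [| |h _] := Hl _ d0 => //; first by apply/(le_natfl _ D0).
  by move=> z; apply: nz; rewrite z Cmod_0.
have DU U : INR U <= 9 * y ^ 4 -> INR (Dn * U) * y ^ 60 <= x.
  move=> hU; rewrite mul_INR.
  have y60 := set_ypos HS 60; have y60' := set_ypos HS 64.
  have p1 : INR Dn * INR U <= D * (9 * y ^ 4).
    by apply: Rmult_le_compat => //; exact: pos_INR.
  have p : 0 <= D * (9 * y ^ 4) * y ^ 60.
    by positivity.
  apply: Rle_trans (_ : D * (9 * y ^ 4) * y ^ 60 <= _).
    by apply: Rmult_le_compat_r; lra.
  have h : (D * (9 * y ^ 4) * y ^ 60) ^ 2 <= x ^ 2.
    have -> : (D * (9 * y ^ 4) * y ^ 60) ^ 2 = (D ^ 2 * y ^ 64) * (81 * y ^ 64) by ring.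
    have -> : x ^ 2 = x * x by ring.
    apply: Rmult_le_compat => //.
    + by positivity.
    + lra.
    apply: Rle_trans (set_xy HS).
    have -> : y ^ 150 = y ^ 86 * y ^ 64 by rewrite -pow_add.
    apply: Rmult_le_compat_r; first lra.
    by have := set_ypow HS (isT : 1 <= 86)%N; rewrite pow_1; lra.
  by nra.
pose F d k := zc x w b 1 d k 1.
have FE d k l : zc x w b 1 d k l = F d (k * l)%N by rewrite /F /zc muln1.
have Fap d m l : F d (m * l)%N = if inAP x b (m * l) d then e (w * INR (m * l) ^ 2) else RtoC 0.
  by rewrite /F /zc muln1 mul1n.
have FX d k : (0 < d)%N -> (X < k)%N -> F d k = RtoC 0.
  move=> d0 hk; rewrite /F zc_large // muln1; apply: Rlt_le_trans f2 _.
  by rewrite -S_INR; exact: leq_INR.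
have FV d k : (0 < d)%N -> (k <= V)%N -> F d k = RtoC 0.
  move=> d0 hk; rewrite /F /zc muln1 mul1n; case: ifP => // /(inAPP d0) [[h1 _] _].
  by have := leq_INR hk; lra.
pose G1 := \csum_(1 <= d < Dn.+1) Cmult (lam d) (\csum_(1 <= m < V.+1) Cmult (RtoC (mob m)) (\csum_(1 <= l < X.+1) Cmult (RtoC (ln (INR l))) (F d (m * l)%N))).
pose G2 := \csum_(1 <= d < Dn.+1) Cmult (lam d) (\csum_(1 <= k < (V * V).+1) Cmult (RtoC (- vC V k)) (\csum_(1 <= l < X.+1) Cmult (RtoC 1) (F d (k * l)%N))).
pose G3 := \csum_(1 <= d < Dn.+1) Cmult (lam d) (\csum_(1 <= n < X.+1) \csum_(1 <= m < X.+1) Cmult (Cmult (RtoC (- vL V n)) (RtoC (vB V m))) (F d (n * m)%N)).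
have E : \csum_(1 <= d < Dn.+1) Cmult (lam d) (\csum_(1 <= n < X.+1) Cmult (RtoC (vonMangoldt n)) (F d n)) =
  (G1 + (G2 + G3))%C.
  rewrite /G1 /G2 /G3 -!csum_split; apply: eq_big_nat => d hd; have d0 : (0 < d)%N by lia.
  rewrite (vaughan V0 VX (fun k => FX d k d0) (fun k => FV d k d0)).
  have -> : \csum_(1 <= k < (V * V).+1) Cmult (RtoC (- vC V k)) (\csum_(1 <= l < X.+1) Cmult (RtoC 1) (F d (k * l)%N)) =
    Cmult (- 1)%C (\csum_(1 <= k < (V * V).+1) Cmult (RtoC (vC V k)) (\csum_(1 <= l < X.+1) F d (k * l)%N)).
    rewrite -csum_mulr; apply: eq_bigr => k _; rewrite RtoC_opp csum_mulr; ring.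
  have -> : \csum_(1 <= n < X.+1) \csum_(1 <= m < X.+1) Cmult (Cmult (RtoC (- vL V n)) (RtoC (vB V m))) (F d (n * m)%N) =
    Cmult (- 1)%C (\csum_(1 <= n < X.+1) \csum_(1 <= m < X.+1) Cmult (Cmult (RtoC (vL V n)) (RtoC (vB V m))) (F d (n * m)%N)).
    rewrite -csum_mulr; apply: eq_bigr => n _; rewrite -csum_mulr; apply: eq_bigr => m _.
    rewrite RtoC_opp; ring.
  ring.
rewrite /mangoldt_sum -/Dn -/X E.
have toAP (U : nat) (cm : nat -> C) (wt : nat -> R) :
  \csum_(1 <= d < Dn.+1) Cmult (lam d) (\csum_(1 <= m < U.+1) Cmult (cm m) (\csum_(1 <= l < X.+1) Cmult (RtoC (wt l)) (F d (m * l)%N))) =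
  \csum_(1 <= d < Dn.+1) Cmult (lam d) (\csum_(1 <= m < U.+1) Cmult (cm m)
     (\csum_(0 <= l < X.+1) (if inAP x b (m * l) d then Cmult (RtoC (wt l)) (e (w * INR (m * l) ^ 2)) else RtoC 0))).
  apply: eq_big_nat => d hd; congr Cmult; apply: eq_big_nat => m hm; congr Cmult.
  rewrite [RHS]big_ltn //= muln0.
  have -> : inAP x b 0 d = false.
    apply/negP => h; have d0 : (0 < d)%N by lia.
    by have [[h1 _] _] := inAPP d0 h; rewrite /= in h1; lra.
  rewrite Cplus_0_l; apply: eq_bigr => l _; rewrite Fap.
  by case: ifP => _; rewrite ?Cmult_0_r.
have xy0 : 0 < x / y by positivity.
have xy2 : x / y ^ 2 <= x / y.
  apply: Rmult_le_compat_l => //; apply: Rinv_le_contravar; first lra.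
  by rewrite -{1}(pow_1 y); apply: (set_ypow HS).
have iy2 : 0 <= x / y ^ 2 by positivity.
have Mp n m : (n <= m)%N -> INR M ^ n <= INR M ^ m by move=> h; apply: Rle_pow; [lra|lia].
have P1 n : 1 <= INR M ^ n by rewrite -(pow_O (INR M)); apply: Mp.
have T1 : Cmod (G1) <= 12 * A * INR M ^ 7 * (x / y).
  rewrite /G1 (toAP V (fun m => RtoC (mob m)) (fun l => ln (INR l))).
  apply: Rle_trans (typeI HS HA' Hg' (B := 1) (Wm := INR M) _ _ _ A0 _ _) _.
  - by move=> m _; rewrite Cmod_R; exact: mob_abs.
  - exact: ln_INR_le.
  - exact: lnM.
  - lra.
  - by apply: DU; have := y24; lra.
  have -> : 12 * A * 1 * INR M * INR M ^ 2 * (x / y ^ 2) = 12 * A * (INR M ^ 3 * (x / y ^ 2)) by ring.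
  rewrite [X in _ <= X]Rmult_assoc; apply: Rmult_le_compat_l; first by lra.
  apply: Rmult_le_compat => //; [by have := P1 3%N; lra|exact: Mp].
have T2 : Cmod (G2) <= 12 * A * INR M ^ 7 * (x / y).
  rewrite /G2 (toAP (V * V)%N (fun k => RtoC (- vC V k)) (fun l => 1)).
  apply: Rle_trans (typeI HS HA' Hg' (B := INR M ^ 2) (Wm := 1) _ _ _ A0 _ _) _.
  - move=> k hk; rewrite Cmod_R Rabs_Ropp.
    apply: Rle_trans (_ : INR M * INR (\sum_(1 <= m < V.+1) \sum_(1 <= a < V.+1) (m * a == k))%N <= _).
      rewrite /vC INR_sum -rsum_mulr; apply: Rle_trans (Rabs_rsum _ _) _; apply: rsum_nat_le => m hm.
      rewrite INR_sum -rsum_mulr; apply: Rle_trans (Rabs_rsum _ _) _; apply: rsum_nat_le => a ha.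
      case: eqP => _ /=; last by rewrite Rabs_R0; lra.
      rewrite Rabs_mult (Rabs_pos_eq _ (vonMangoldt_ge0 a)).
      have aX : (a <= X)%N by lia.
      have [_ l2] := lnM a aX; have := vonMangoldt_le a; have := mob_abs m; have := Rabs_pos (mob m).
      have := vonMangoldt_ge0 a; nra.
    have -> : INR M ^ 2 = INR M * INR M by ring.
    apply: Rmult_le_compat_l; first lra; apply: leq_INR.
    have k0 : (0 < k)%N by lia.
    apply: leq_trans (sum_mul_fiber V V k0) _; apply: (set_tau_le HS) => //.
    by apply: Rle_trans VVx; apply: leq_INR; lia.
  - by move=> *; lra.
  - by move=> *; lra.
  - by have := P1 2%N; lra.
  - exact: DU.
  have -> : 12 * A * INR M ^ 2 * 1 * INR M ^ 2 * (x / y ^ 2) = 12 * A * (INR M ^ 4 * (x / y ^ 2)) by ring.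
  rewrite [X in _ <= X]Rmult_assoc; apply: Rmult_le_compat_l; first by lra.
  apply: Rmult_le_compat => //; [by have := P1 4%N; lra|exact: Mp].
have T3 : Cmod (G3) <= 62 * A * INR M ^ 7 * (x / y).
  have H := typeII HS (b := b) (D := D) (lam := lam) (am := fun m => RtoC (vB V m)) (bn := fun n => RtoC (- vL V n))
    D1 HD A0 (Ba := INR M) (Bb := INR M) ltac:(lra) ltac:(lra) HA Hl.
  have -> : G3 = bilin x w b Dn lam (index_iota 1 X.+1) (index_iota 1 X.+1) (fun n => RtoC (- vL V n)) (fun m => RtoC (vB V m)).
    by apply: eq_bigr => d _; congr Cmult; apply: eq_bigr => n _; apply: eq_bigr => m _; rewrite -FE.
  apply: Rle_trans (H _ _ _ _) _.
  - move=> m hm; rewrite Cmod_R /vB; case: ifP => hV; last by rewrite Rabs_R0; lra.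
    rewrite /vA; apply: Rle_trans (Rabs_rsum _ _) _.
    apply: Rle_trans (_ : INR (\sum_(1 <= d < V.+1) (d %| m))%N <= _).
      rewrite INR_sum; apply: rsum_nat_le => d hd; case: (d %| m)%N; last by rewrite Rabs_R0; apply: Rle_refl.
      exact: mob_abs.
    have m0 : (0 < m)%N by lia.
    apply: leq_INR; apply: leq_trans (sum_dvd_le V m0) _; apply: (set_tau_le HS) => //.
    by apply: Rle_trans f1; exact: leq_INR.
  - move=> n hn; rewrite Cmod_R Rabs_Ropp /vL; case: ifP => _; last by rewrite Rabs_R0; lra.
    rewrite (Rabs_pos_eq _ (vonMangoldt_ge0 n)).
    by have [_ l2] := lnM n hn; have := vonMangoldt_le n; lra.
  - by move=> n /Vlow hn; rewrite /vB ltnNge hn.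
  - by move=> n /Vlow hn; rewrite /vL ltnNge hn Ropp_0.
  by right; ring.
apply: Rle_trans (Cmod_triangle _ _) _.
have := Cmod_triangle G2 G3.
have : 0 <= A * INR M ^ 7 * (x / y).
  by positivity.
lra.
Qed.

End Setting.

(** * The divisor bound *)

Lemma tau_mul_prime (p n : nat) : prime p -> (0 < n)%N -> (tau (p * n) <= 2 * tau n)%N.
Proof.
move=> pp n0; have p0 := prime_gt0 pp.
have pn0 : (0 < p * n)%N by rewrite muln_gt0 p0.
rewrite /tau mul2n -addnn -{2}(size_map (muln p) (divisors n)) -size_cat; apply: uniq_leq_size.
  exact: divisors_uniq.
move=> d; rewrite -dvdn_divisors // mem_cat -dvdn_divisors // => hd.
case: (boolP (p %| d)%N) => [/dvdnP [k hk]|hp].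
  apply/orP; right; apply/mapP; exists k; last by rewrite hk mulnC.
  by rewrite -dvdn_divisors // -(dvdn_pmul2l p0) mulnC -hk.
by apply/orP; left; move: hd; rewrite Gauss_dvdr // coprime_sym prime_coprime.
Qed.

(** A divisor is determined by its exponent at [p] and its part prime to [p], which divides [m]. *)
Lemma tau_mul_pow (p a m : nat) : prime p -> (0 < m)%N -> ~~ (p %| m)%N ->
  (tau (p ^ a * m) <= a.+1 * tau m)%N.
Proof.
move=> pp m0 pm; have p0 := prime_gt0 pp.
have n0 : (0 < p ^ a * m)%N by rewrite muln_gt0 expn_gt0 p0.
rewrite /tau -{1}(size_iota 0 a.+1) -(size_allpairs (fun i d => p ^ i * d)%N).
apply: uniq_leq_size; first exact: divisors_uniq.
move=> d; rewrite -dvdn_divisors // => hd.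
have d0 : (0 < d)%N by apply: dvdn_gt0 hd.
have [e he hde] := pfactor_coprime pp d0.
apply/allpairsP; exists (logn p d, e); split; [rewrite mem_iota add0n ltnS| |] => /=.
- have := dvdn_leq_log p n0 hd; rewrite lognM ?expn_gt0 ?p0 // pfactorK //.
  by rewrite (@lognE p m) pp m0 (negPf pm) addn0.
- have : (e %| p ^ a * m)%N by apply: dvdn_trans hd; rewrite hde dvdn_mulr.
  rewrite -dvdn_divisors // Gauss_dvdr //.
  by rewrite coprime_sym coprimeXl.
by rewrite mulnC.
Qed.

Lemma Rpower_INR_mul (a b : nat) (z : R) : (0 < a)%N -> (0 < b)%N ->
  Rpower (INR (a * b)) z = Rpower (INR a) z * Rpower (INR b) z.
Proof. by move=> a0 b0; rewrite mul_INR Rpower_mult_distr //; apply: (ltn_INR (a := 0)). Qed.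

Lemma Rpower_pos a b : 0 < Rpower a b.
Proof. exact: exp_pos. Qed.

(** Induction on [P]: a power [P^a] contributes [a + 1] to the divisor count. Since
    [P^(a eps) >= 1 + a eps ln 2], this is at most [C1' P^(a eps)] with [C1' = 1 / (eps ln 2) + 1],
    uniformly in [a]. *)
Lemma tau_smooth (eps : R) (P : nat) : 0 < eps -> exists C, 1 <= C /\
  forall n, (0 < n)%N -> (forall p, prime p -> (p %| n)%N -> (p < P)%N) ->
    INR (tau n) <= C * Rpower (INR n) eps.
Proof.
move=> e0; elim: P => [|P [C [C1 IH]]].
  exists 1; split; first lra; move=> n n0 h.
  have -> : n = 1%N.
    case: (ltnP 1 n) => n1; last by lia.
    by have := h _ (pdiv_prime n1) (pdiv_dvd n); rewrite ltn0.
  by rewrite (_ : tau 1 = 1%N) // /= /Rpower ln_1 Rmult_0_r exp_0; lra.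
have l2 : 0 < ln 2 by rewrite -ln_1; apply: ln_increasing; lra.
have el : 0 < eps * ln 2 by positivity.
pose C1' := 1 / (eps * ln 2) + 1.
have C1p : 1 <= C1'.
  by rewrite /C1'; have : 0 < 1 / (eps * ln 2); [apply: Rdiv_lt_0_compat; lra|lra].
exists (C1' * C); split; first by nra.
move=> n n0 hn; have n1 := Rpower_pos (INR n) eps.
case: (boolP (prime P)) => pP; last first.
  apply: Rle_trans (IH n n0 _) _.
    move=> p pp pn; have := hn p pp pn; rewrite ltnS leq_eqVlt => /orP [/eqP e|//].
    by move: pP; rewrite -e pp.
  by apply: Rmult_le_compat_r; [lra|nra].
have [m hm hnm] := pfactor_coprime pP n0.
set a := logn P n in hnm.
have P0 := prime_gt0 pP.
have m0 : (0 < m)%N by case: (m) hnm n0 => // ->; rewrite mul0n.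
have Pm : ~~ (P %| m)%N by rewrite -prime_coprime.
have H1 := leq_INR (@tau_mul_pow P a m pP m0 Pm).
have H2 : INR (tau m) <= C * Rpower (INR m) eps.
  apply: IH => // p pp pm.
  have : (p < P.+1)%N by apply: hn => //; rewrite hnm dvdn_mulr.
  rewrite ltnS leq_eqVlt => /orP [/eqP e|//].
  by move: Pm; rewrite -e pm.
rewrite hnm mulnC; apply: Rle_trans H1 _.
rewrite Rpower_INR_mul ?expn_gt0 ?P0 // mul_INR.
have m1 := Rpower_pos (INR m) eps.
have H3 : INR a.+1 <= C1' * Rpower (INR (P ^ a)) eps.
  apply: Rle_trans (_ : C1' * (1 + INR a * (eps * ln 2)) <= _).
    rewrite /C1' S_INR.
    have -> : (1 / (eps * ln 2) + 1) * (1 + INR a * (eps * ln 2)) = INR a + 1 + (1 / (eps * ln 2) + INR a * (eps * ln 2)) by field; lra.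
    have : 0 < 1 / (eps * ln 2) by positivity.
    have := pos_INR a; nra.
  apply: Rmult_le_compat_l; first by lra.
  have p2 : 2 <= INR P by apply: (leq_INR (a := 2)); apply: prime_gt1.
  rewrite /Rpower exp_INR ln_pow; last by lra.
  have ll : ln 2 <= ln (INR P) by apply: ln_le; lra.
  have ae : 0 <= INR a * eps by positivity.
  apply: Rle_trans (_ : exp (INR a * (eps * ln 2)) <= _).
    case: (Req_dec (INR a * (eps * ln 2)) 0) => [->|ne]; first by rewrite exp_0; lra.
    by left; apply: exp_ineq1.
  have : INR a * (eps * ln 2) <= eps * (INR a * ln (INR P)) by nra.
  by case/Rle_lt_or_eq_dec => [h|->]; [left; exact: exp_increasing|exact: Rle_refl].
have -> : C1' * C * (Rpower (INR (P ^ a)) eps * Rpower (INR m) eps) =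
  (C1' * Rpower (INR (P ^ a)) eps) * (C * Rpower (INR m) eps) by ring.
by apply: Rmult_le_compat => //; exact: pos_INR.
Qed.

(* A prime [p >= 2^(1/eps)] multiplies [tau] by at most [2 <= p^eps], so the constant comes from the smaller primes only. *)
Lemma tau_bound (eps : R) : 0 < eps -> exists C, 1 <= C /\
  forall n, (0 < n)%N -> INR (tau n) <= C * Rpower (INR n) eps.
Proof.
move=> e0; pose P := (natfl (Rpower 2 (/ eps))).+1.
have [_ hP] := natflP (Rlt_le _ _ (Rpower_pos 2 (/ eps))).
have [C [C1 HC]] := tau_smooth P e0.
exists C; split => // n; elim: {n}n.+1 {-2}n (ltnSn n) => [|k IH] n hn n0; first by lia.
case: (boolP (all (fun p => (p < P)%N) (primes n))) => [/allP h|/allPn [p]].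
  by apply: HC => // p pp pn; apply: h; rewrite mem_primes pp n0 pn.
rewrite mem_primes -leqNgt => /and3P [pp _ pn] hpP.
have nE : n = (p * (n %/ p))%N by rewrite mulnC divnK.
have p0 := prime_gt0 pp.
have m0 : (0 < n %/ p)%N by rewrite divn_gt0 // dvdn_leq.
have mn : (n %/ p < n)%N by apply: ltn_Pdiv => //; apply: prime_gt1.
rewrite nE Rpower_INR_mul //.
apply: Rle_trans (leq_INR (tau_mul_prime pp m0)) _; rewrite mul_INR (_ : INR 2 = 2) //.
have h1 := IH (n %/ p)%N ltac:(lia) m0.
have h2 : 2 <= Rpower (INR p) eps.
  have -> : 2 = Rpower (Rpower 2 (/ eps)) eps.
    by rewrite Rpower_mult Rinv_l ?Rpower_1; lra.
  apply: Rle_Rpower_l; first by lra.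
  split; first exact: Rpower_pos.
  by have := leq_INR hpP; rewrite /P S_INR; lra.
have -> : C * (Rpower (INR p) eps * Rpower (INR (n %/ p)) eps) = Rpower (INR p) eps * (C * Rpower (INR (n %/ p)) eps) by ring.
by apply: Rmult_le_compat => //; [lra|exact: pos_INR].
Qed.

(** * The trivial bound and the reduction to fixed k *)

Section Trivial.
Variables (x w : R) (b : Z) (M : nat).
Hypothesis x1 : 1 <= x.
Hypothesis Hlog : x < INR (2 ^ M).
Hypothesis Htau : forall u, (0 < u)%N -> INR u <= x -> (tau u <= M)%N.

Let S := mangoldt_sum x w b.

Lemma triv_M n : (n <= natfl x)%N -> vonMangoldt n <= INR M.
Proof.
move=> hn; have x0 : 0 <= x by lra.
have [f1 f2] := natflP x0.
case: (posnP n) => [->|n0]; first by rewrite /vonMangoldt /=; exact: pos_INR.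
apply: Rle_trans (vonMangoldt_le n) _; apply: ln_le_pow2.
  exact: (ltn_INR (a := 0)).
by have := leq_INR hn; lra.
Qed.

Lemma triv_term n d : zc x w b 1 d n 1 = if inAP x b n d then e (w * INR n ^ 2) else RtoC 0.
Proof. by rewrite /zc mul1n muln1. Qed.

Lemma triv_ap d : (0 < d)%N -> Cmod (S d) <= INR M * INR (natfl x %/ d + 1).
Proof.
move=> d0; have x0 : 0 <= x by lra.
pose P n := inAP x b n d.
have -> : S d = \csum_(0 <= n < (natfl x).+1) (if P n then Cmult (RtoC (vonMangoldt n)) (e (w * INR n ^ 2)) else RtoC 0).
  rewrite [RHS]big_ltn // (_ : P 0%N = false) ?Cplus_0_l.
    by apply: eq_bigr => n _; rewrite triv_term /P; case: ifP => _; rewrite ?Cmult_0_r.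
  by apply/negP => /(inAPP d0) [[h _] _]; rewrite /= in h; lra.
have [m0 [L [hL HP E]]] := ap_sum d0 (P := P) (X := natfl x)
   (fun m h => inAP_le x0 d0 h) (fun m m' h h' le => inAP_dvd d0 h h' le)
   (fun m m' j h h' le dv => inAP_mid d0 h h' le dv).
rewrite E; apply: Rle_trans (Cmod_sum _ _) _.
apply: Rle_trans (_ : \rsum_(0 <= t < L) INR M <= _).
  apply: rsum_nat_le => t ht; rewrite Cmod_mult Cmod_e Rmult_1_r Cmod_R.
  rewrite Rabs_pos_eq; last exact: vonMangoldt_ge0.
  by apply: triv_M; apply: (inAP_le x0 d0); apply: HP; lia.
rewrite rsum_const subn0 Rmult_comm; apply: Rmult_le_compat_l; [exact: pos_INR|exact: leq_INR].
Qed.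

(* Only powers of a prime dividing [d] contribute. *)
Lemma triv_gcd d : (0 < d)%N -> INR d <= x -> Z.gcd b (Z.of_nat d) <> 1%Z -> Cmod (S d) <= INR M ^ 3.
Proof.
move=> d0 dx g1; have x0 : 0 <= x by lra.
have [f1 f2] := natflP x0.
pose Q n := inAP x b n d && (size (primes n) == 1%N).
have H : (\sum_(1 <= n < (natfl x).+1) Q n <= M * M)%N.
  apply: leq_trans (_ : tau d * M <= _)%N; last by rewrite leq_mul2r Htau ?orbT.
  rewrite -big_mkcond sum1_count /= -size_filter.
  (* A contributing [n = p^j] is coded by the divisor [p] of [d] and by [j], where [j <= M] because
     [2^j <= n < 2^M]. *)
  rewrite /tau -{1}(size_iota 1 M) -(size_allpairs (fun p j => p ^ j)%N); apply: uniq_leq_size.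
    by rewrite filter_uniq // iota_uniq.
  move=> n; rewrite mem_filter mem_index_iota => /andP [/andP [hAP /eqP hs] hn].
  have : vonMangoldt n <> 0.
    have n0 : (0 < n)%N by lia.
    rewrite /vonMangoldt; case E : (primes n) hs => [|p [|]] // _.
    have : p \in primes n by rewrite E inE.
    rewrite mem_primes => /and3P [pp _ _]; have := prime_gt1 pp => /ltn_INR; rewrite /= => h.
    by have := ln_increasing 1 (INR p) ltac:(lra) h; rewrite ln_1; lra.
  move=> /vonMangoldt_neq0 [p [j [pp j0 nE]]].
  have pn : (p %| n)%N by rewrite nE dvdn_exp.
  have pd : (p %| d)%N.
    pose g := Z.to_nat (Z.gcd b (Z.of_nat d)).
    have gpos : (0 <= Z.gcd b (Z.of_nat d))%Z := Z.gcd_nonneg _ _.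
    have gd : (g %| d)%N.
      have [k hk] := Z.gcd_divide_r b (Z.of_nat d).
      by apply/dvdnP; exists (Z.to_nat k); rewrite /g; nia.
    have gn : (g %| n)%N.
      have [k hk] := Z.gcd_divide_r b (Z.of_nat d).
      have [l hl] := Z.gcd_divide_l b (Z.of_nat d).
      have [_ [t ht]] := inAPP d0 hAP.
      apply/dvdnP; exists (Z.to_nat (l + t * k)); rewrite /g.
      have e : Z.of_nat n = ((l + t * k) * Z.gcd b (Z.of_nat d))%Z by rewrite ht {1}hl {2}hk; ring.
      by clear -e gpos hn; nia.
    have g0 : (0 < g)%N by apply: dvdn_gt0 gd.
    have g2 : (1 < g)%N by rewrite /g in g0 *; lia.
    have rp := pdiv_prime g2; have rg := pdiv_dvd g.
    have : (pdiv g %| p ^ j)%N by rewrite -nE; apply: dvdn_trans rg gn.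
    rewrite Euclid_dvdX // => /andP [hh _].
    move: hh; rewrite dvdn_prime2 // => /eqP <-.
    exact: dvdn_trans rg gd.
  apply/allpairsP; exists (p, j); split => /=; [by rewrite -dvdn_divisors| |exact: nE].
  rewrite mem_iota j0 add1n ltnS /=.
  rewrite -(@leq_exp2l 2) //; apply: leq_trans (_ : n <= _)%N.
    by rewrite nE leq_exp2r // prime_gt1.
  have : INR n < INR (2 ^ M).
    have : (n <= natfl x)%N by lia.
    by move/leq_INR; lra.
  by move/INR_lt; lia.
apply: Rle_trans (Cmod_sum _ _) _.
apply: Rle_trans (_ : INR M * INR (\sum_(1 <= n < (natfl x).+1) Q n)%N <= _).
  rewrite INR_sum -rsum_mulr; apply: rsum_nat_le => n hn.
  rewrite triv_term Cmod_mult Cmod_R Rabs_pos_eq; last exact: vonMangoldt_ge0.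
  rewrite /Q; case: (inAP x b n d) => /=; last by rewrite Cmod_0; lra.
  rewrite Cmod_e Rmult_1_r; case: eqP => [_|hs].
    by rewrite Rmult_1_r; apply: triv_M; lia.
  by rewrite /vonMangoldt; case: (primes n) hs => [|p [|]] //= *; lra.
apply: Rle_trans (Rmult_le_compat_l _ _ _ (pos_INR M) (leq_INR H)) _.
by rewrite mul_INR; right; ring.
Qed.

Lemma triv_bound (Dn : nat) (lam : nat -> C) (A : R) : INR Dn <= x -> 0 <= A -> (1 <= M)%N ->
  (forall d, (0 < d <= Dn)%N -> Cmod (lam d) <= A) ->
  Cmod (\csum_(1 <= d < Dn.+1) Cmult (lam d) (S d)) <= 2 * A * INR M ^ 2 * x.
Proof.
move=> hD A0 M1 HA; have x0 : 0 <= x by lra.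
have [f1 f2] := natflP x0; have M1r := leq_INR M1; rewrite (_ : INR 1 = 1) // in M1r.
apply: Rle_trans (Cmod_csum_mul_le (A := A) (g := fun d => INR M * INR (natfl x %/ d + 1)) _ _ _) _.
- by move=> d; rewrite mem_index_iota => hd; apply: HA; lia.
- move=> d; rewrite mem_index_iota => hd; rewrite Cmod_mult; apply: Rmult_le_compat_l; first exact: Cmod_ge_0.
  by apply: triv_ap; lia.
- by move=> d _; apply: Rmult_le_pos; exact: pos_INR.
have D2 : (Dn.+1 <= 2 ^ M)%N.
  have : INR Dn < INR (2 ^ M) by lra.
  by move/INR_lt; lia.
(* The harmonic sum: each of the at most [M] dyadic blocks of [d] contributes at most [natfl x], so
   [M] plays the part of the logarithm. *)
have H : (\sum_(1 <= d < Dn.+1) (natfl x %/ d + 1) <= M * natfl x + Dn)%N.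
  rewrite big_split /= sum_nat_const_nat muln1 subSS subn0 leq_add2r.
  apply: leq_trans (_ : \sum_(1 <= d < 2 ^ M) natfl x %/ d <= _)%N.
    by rewrite [X in (_ <= X)%N](@big_cat_nat _ _ _ Dn.+1) //= leq_addr.
  rewrite dyadic; apply: leq_trans (_ : \sum_(0 <= i < M) natfl x <= _)%N; last first.
    by rewrite sum_nat_const_nat subn0.
  rewrite !big_nat; apply: leq_sum => i _.
  apply: leq_trans (_ : \sum_(2 ^ i <= d < 2 ^ i.+1) natfl x %/ 2 ^ i <= _)%N.
    rewrite !big_nat; apply: leq_sum => d hd; apply: leq_div2l; first by rewrite expn_gt0.
    by lia.
  rewrite sum_nat_const_nat expnS (_ : 2 * 2 ^ i - 2 ^ i = 2 ^ i)%N; last by lia.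
  by rewrite mulnC leq_trunc_div.
rewrite rsum_mulr -INR_sum.
have H2 : INR (\sum_(1 <= d < Dn.+1) (natfl x %/ d + 1))%N <= 2 * INR M * x.
  apply: Rle_trans (leq_INR H) _; rewrite add_INR mul_INR.
  have : INR M * INR (natfl x) <= INR M * x by apply: Rmult_le_compat_l; lra.
  by nra.
have -> : 2 * A * INR M ^ 2 * x = A * (INR M * (2 * INR M * x)) by ring.
by apply: Rmult_le_compat_l => //; apply: Rmult_le_compat_l => //; exact: pos_INR.
Qed.

End Trivial.

Lemma Csum_csum N f : Csum N f = \csum_(0 <= i < N) f i.
Proof. by elim: N => [|N IH]; [rewrite big_geq|rewrite csum_recr //= IH]. Qed.

Lemma ubound_gt (z : R) : 0 <= z -> (natfl z < ubound z)%N.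
Proof.
move=> z0; rewrite /natfl /ubound; have [h1 h2] := archimed z.
have : (0 < up z)%Z by apply: lt_IZR; lra.
lia.
Qed.

Lemma Csum_ubound (z : R) (f : nat -> C) : 0 <= z ->
  Csum (S (ubound z)) (fun n => if (0 < n)%N && Rleb (INR n) z then f n else RtoC 0) =
  \csum_(1 <= n < (natfl z).+1) f n.
Proof.
move=> z0; rewrite Csum_csum big_ltn //= Cplus_0_l.
have h := ubound_gt z0.
rewrite (@big_cat_nat _ _ _ (natfl z).+1) //=; last by lia.
rewrite [X in (_ + X)%C]big1_seq ?Cplus_0_r.
  apply: eq_big_nat => n hn; rewrite (_ : (0 < n)%N); last by lia.
  by rewrite (introT (RlebP _ _)) //; apply/(le_natfl _ z0); lia.
move=> n /andP [_]; rewrite mem_index_iota => hn; case: ifP => // /andP [_ /RlebP].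
by move/(le_natfl _ z0); lia.
Qed.

(** For fixed [k] the phase [beta k] is a constant of modulus 1 and leaves the sum over [n]; after
    exchanging [d] and [k], there are at most [2 K] values of [k]. *)
Lemma W_bound (x D K alpha beta Cc Bd : R) (b : Z) (lam : nat -> C) (c : Z -> C) :
  1 <= x -> 0 <= D -> 0 <= K -> 0 <= Cc -> 0 <= Bd ->
  (forall k : Z, (1 <= Z.abs k)%Z -> IZR (Z.abs k) <= K -> Cmod (c k) <= Cc) ->
  (forall k : Z, (1 <= Z.abs k)%Z -> IZR (Z.abs k) <= K ->
     Cmod (\csum_(1 <= d < (natfl D).+1) Cmult (lam d) (mangoldt_sum x (alpha * IZR k) b d)) <= Bd) ->
  Cmod (W x D K alpha beta b lam c) <= 2 * K * Cc * Bd.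
Proof.
move=> x1 D0 K0 Cc0 Bd0 Hc HB; have x0 : 0 <= x by lra.
pose In (k : Z) := mangoldt_sum x (alpha * IZR k) b.
pose t k d := Cmult (c k) (Cmult (e (beta * IZR k)) (In k d)).
have inner k d : (0 < d)%N -> Csum (S (ubound x)) (fun n =>
                  if Rleb (x / 2) (INR n) && Rltb (INR n) x
                     && Z.eqb (Z.modulo (Z.of_nat n - b) (Z.of_nat d)) 0
                  then Cmult (e ((alpha * (INR n) ^ 2 + beta) * IZR k))
                             (RtoC (vonMangoldt n))
                  else RtoC 0) = Cmult (e (beta * IZR k)) (In k d).
  move=> d0; rewrite Csum_csum.
  have h := ubound_gt x0.
  rewrite big_ltn //= -/(inAP x b 0 d) (_ : inAP x b 0 d = false) ?Cplus_0_l; last first.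
    by apply/negP => /(inAPP d0) [[h1 _] _]; rewrite /= in h1; lra.
  rewrite (@big_cat_nat _ _ _ (natfl x).+1) //=; last by lia.
  rewrite [X in (_ + X)%C]big1_seq ?Cplus_0_r; last first.
    move=> n /andP [_]; rewrite mem_index_iota -/(inAP x b n d) => hn.
    by case: ifP => // /(inAP_le x0 d0); lia.
  rewrite /In /mangoldt_sum -csum_mulr; apply: eq_bigr => n _; rewrite triv_term -/(inAP x b n d).
  case: ifP => _; last by rewrite !Cmult_0_r.
  have -> : (alpha * INR n ^ 2 + beta) * IZR k = beta * IZR k + alpha * IZR k * INR n ^ 2 by ring.
  rewrite e_add; ring.
have -> : W x D K alpha beta b lam c =
  \csum_(1 <= kk < (natfl K).+1) \csum_(1 <= d < (natfl D).+1)
     Cplus (Cmult (lam d) (t (Z.of_nat kk) d)) (Cmult (lam d) (t (- Z.of_nat kk)%Z d)).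
  rewrite /W Csum_ubound // exchange_big; apply: eq_big_nat => d hd.
  have d0 : (0 < d)%N by lia.
  rewrite Csum_ubound // -csum_mulr; apply: eq_bigr => kk _.
  by rewrite !inner // Cmult_plus_distr_l.
apply: Rle_trans (Cmod_sum _ _) _.
apply: Rle_trans (_ : \rsum_(1 <= kk < (natfl K).+1) (2 * Cc * Bd) <= _); last first.
  rewrite rsum_const subSS subn0; have [h _] := natflP K0.
  have -> : 2 * K * Cc * Bd = K * (2 * Cc * Bd) by ring.
  apply: Rmult_le_compat_r => //; apply: Rmult_le_pos => //; lra.
apply: rsum_nat_le => kk hk.
have one k : (1 <= Z.abs k)%Z -> IZR (Z.abs k) <= K ->
  Cmod (\csum_(1 <= d < (natfl D).+1) Cmult (lam d) (t k d)) <= Cc * Bd.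
  move=> k1 kK.
  have -> : \csum_(1 <= d < (natfl D).+1) Cmult (lam d) (t k d) =
    Cmult (Cmult (c k) (e (beta * IZR k))) (\csum_(1 <= d < (natfl D).+1) Cmult (lam d) (In k d)).
    rewrite -csum_mulr; apply: eq_bigr => d _; rewrite /t; ring.
  rewrite !Cmod_mult Cmod_e Rmult_1_r; apply: Rmult_le_compat; try exact: Cmod_ge_0.
    exact: Hc.
  exact: HB.
have kK : INR kk <= K by apply/(le_natfl _ K0); lia.
rewrite csum_split; apply: Rle_trans (Cmod_triangle _ _) _.
have a1 : Cmod (\csum_(1 <= d < (natfl D).+1) Cmult (lam d) (t (Z.of_nat kk) d)) <= Cc * Bd.
  apply: one; first by lia.
  by rewrite Z.abs_eq; [rewrite -INR_IZR_INZ|lia].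
have a2 : Cmod (\csum_(1 <= d < (natfl D).+1) Cmult (lam d) (t (- Z.of_nat kk)%Z d)) <= Cc * Bd.
  apply: one; first by lia.
  by rewrite Z.abs_opp Z.abs_eq; [rewrite -INR_IZR_INZ|lia].
lra.
Qed.

(** A modulus not coprime to [b] contributes at most [A M^3], and there are at most [D <= x / y] of
    them; the others are those of [core_bound]. *)
Lemma fixed_k_bound (x y K w : R) (q M : nat) (b : Z) (D B : R) (lam : nat -> C) :
  setting x y K w q M -> 1 <= D -> D ^ 2 * y ^ 64 <= x -> 0 <= B ->
  (forall d, (0 < d)%N -> INR d <= D -> Cmod (lam d) <= B * INR (tau d)) ->
  (forall d, (0 < d)%N -> INR d <= D -> lam d <> RtoC 0 -> well_separable d D) ->
  Cmod (\csum_(1 <= d < (natfl D).+1) Cmult (lam d) (mangoldt_sum x w b d)) <= 201 * B * INR M ^ 8 * (x / y).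
Proof.
move=> HS D1 HD B0 HB Hws.
have y3 := set_y HS; have x3 := set_x HS; have m1 := set_M1 HS.
have y64 := set_ypow HS (leq0n 64); rewrite pow_O in y64.
have D0 : 0 <= D by lra.
have Dx : D <= x by nra.
have [D2 D3] := natflP D0.
pose A := B * INR M; have A0 : 0 <= A by apply: Rmult_le_pos; lra.
have HA d : (0 < d)%N -> INR d <= D -> Cmod (lam d) <= A.
  move=> d0 dD; apply: Rle_trans (HB d d0 dD) _; apply: Rmult_le_compat_l => //.
  by apply: leq_INR; apply: (set_tau_le HS) => //; lra.
pose S := mangoldt_sum x w b.
pose g d := Z.eqb (Z.gcd b (Z.of_nat d)) 1.
have -> : \csum_(1 <= d < (natfl D).+1) Cmult (lam d) (S d) =
  Cplus (\csum_(1 <= d < (natfl D).+1) Cmult (if g d then lam d else RtoC 0) (S d))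
        (\csum_(1 <= d < (natfl D).+1) Cmult (if g d then RtoC 0 else lam d) (S d)).
  rewrite -csum_split; apply: eq_bigr => d _.
  by case: (g d); rewrite Cmult_0_l ?Cplus_0_l ?Cplus_0_r.
apply: Rle_trans (Cmod_triangle _ _) _.
have H1 : Cmod (\csum_(1 <= d < (natfl D).+1) Cmult (if g d then lam d else RtoC 0) (S d)) <= 200 * A * INR M ^ 7 * (x / y).
  apply: (core_bound HS) => //.
    by move=> d d0 dD; case: (g d); [exact: HA|rewrite Cmod_0].
  move=> d d0 dD; rewrite /g; case: Z.eqb_spec => // e nz; split => //.
  exact: Hws.
have iy : 0 < / y by positivity.
have Dxy : D <= x / y.
  apply: (proj1 (Rle_div_r _ _ _ _)); first lra.
  have h : (D * y) ^ 2 <= x ^ 2.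
    have -> : (D * y) ^ 2 = D ^ 2 * y ^ 2 by ring.
    have y2 : y ^ 2 <= y ^ 64 by apply: (set_ypow HS).
    have h2 : D ^ 2 * y ^ 2 <= D ^ 2 * y ^ 64 by apply: Rmult_le_compat_l => //; exact: pow2_ge_0.
    by have : x <= x ^ 2; [simpl; nra|lra].
  have : 0 <= D * y by nra.
  by nra.
have Mp n m : (n <= m)%N -> INR M ^ n <= INR M ^ m by move=> h; apply: Rle_pow; [lra|lia].
have M7 : 1 <= INR M ^ 7 by rewrite -(pow_O (INR M)); apply: Mp.
have H2 : Cmod (\csum_(1 <= d < (natfl D).+1) Cmult (if g d then RtoC 0 else lam d) (S d)) <= A * INR M ^ 7 * (x / y).
  apply: Rle_trans (Cmod_csum_mul_le (A := A) (g := fun=> INR M ^ 7) _ _ _) _.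
  - move=> d; rewrite mem_index_iota => hd; case: (g d); first by rewrite Cmod_0.
    by apply: HA; [lia|apply/(le_natfl _ D0); lia].
  - move=> d; rewrite mem_index_iota => hd; rewrite Cmod_mult /g; case: Z.eqb_spec => e.
      by rewrite Cmod_0 !Rmult_0_l; lra.
    apply: Rmult_le_compat_l; first exact: Cmod_ge_0.
    apply: Rle_trans (_ : INR M ^ 3 <= _); last exact: Mp.
    have dD : INR d <= D by apply/(le_natfl _ D0); lia.
    apply: triv_gcd => //; [lra|exact: (set_log HS)|exact: (set_tau_le HS)|lia|lra].
  - by move=> d _; lra.
  rewrite rsum_const subSS subn0 Rmult_assoc; apply: Rmult_le_compat_l => //.
  by rewrite Rmult_comm; apply: Rmult_le_compat_l; lra.
have -> : 201 * B * INR M ^ 8 * (x / y) = 200 * A * INR M ^ 7 * (x / y) + A * INR M ^ 7 * (x / y).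
  by rewrite /A; ring.
lra.
Qed.

(** * Choice of parameters and conclusion *)

Lemma ln_le_Rpower (x s : R) : 0 < s -> 0 < x -> ln x <= / s * Rpower x s.
Proof.
move=> s0 x0; have -> : ln x = / s * ln (Rpower x s).
  by rewrite /Rpower ln_exp; field; lra.
apply: Rmult_le_compat_l; first by positivity.
have h := Rpower_pos x s.
have := exp_ineq1_le (ln (Rpower x s)); rewrite exp_ln //; lra.
Qed.

Lemma Rpower_le_exp (x a c : R) : 1 <= x -> a <= c -> Rpower x a <= Rpower x c.
Proof. by move=> x1 h; apply: Rle_Rpower. Qed.

Lemma Rpower_nat (x a : R) (n : nat) : (Rpower x a) ^ n = Rpower x (a * INR n).
Proof. by rewrite -Rpower_pow ?Rpower_mult //; exact: Rpower_pos. Qed.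

Lemma le_of_sqr_le (a c : R) : 0 <= c -> a ^ 2 <= c ^ 2 -> a <= c.
Proof. by move=> c0 h; case: (Rle_lt_dec a c) => // lt; nra. Qed.

Lemma mul_ge1 (a c : R) : 1 <= a -> 1 <= c -> 1 <= a * c.
Proof. by move=> *; nra. Qed.

Lemma div_le_self (a c : R) : 0 <= a -> 1 <= c -> a / c <= a.
Proof. by move=> a0 c1; apply: Rle_mul_div; nra. Qed.

Theorem theorem1 (theta rho : R)
  (Htheta : 0 < theta < 1 / 200) (Hrho1 : rho > 32 * theta)
  (Hrho2 : rho + 4 * theta < 11 / 54) (Hrho3 : rho + theta > 0) :
  forall eps : R, 0 < eps ->
  forall Clam Cc : R, 0 < Clam -> 0 < Cc ->
  exists Cst x0 : R, 0 < Cst /\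
  forall x : R, x0 <= x ->
  let delta := Rpower x (- theta) in
  let K := / delta * (ln x) ^ 2 in
  let Delta := Rpower x rho in
  let D := Rpower x (1 / 2) / (Delta * K ^ 4) in
  forall (alpha : R) (a : Z) (q : nat),
    (~ exists (u v : Z), v <> 0%Z /\ alpha = IZR u / IZR v) ->
    (0 < q)%nat -> Z.gcd a (Z.of_nat q) = 1%Z ->
    Rabs (alpha - IZR a / INR q) < 1 / (INR q) ^ 2 ->
  forall (lam : nat -> C),
    (forall d : nat, (0 < d)%nat -> INR d <= D -> Cmod (lam d) <= Clam * INR (tau d)) ->
    (forall d : nat, (0 < d)%nat -> INR d <= D -> lam d <> 0%C -> well_separable d D) ->
  forall (c : Z -> C),
    (forall k : Z, (1 <= Z.abs k)%Z -> IZR (Z.abs k) <= K -> Cmod (c k) <= Cc) ->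
  forall (b : Z) (beta : R),
    Cmod (W x D K alpha beta b lam c) <=
      Cst * Rpower x eps *
      ( x * K / Rpower Delta (1 / 32)
      + x * K / Rpower (INR q) (1 / 32)
      + Rpower x (15 / 16) * Rpower K (31 / 32) * Rpower (INR q) (1 / 32)
      + x * Rpower Delta (1 / 2) * K / Rpower (INR q) (1 / 4)
      + Rpower x (1 / 2) * Rpower Delta (1 / 2) * Rpower K (3 / 4) * Rpower (INR q) (1 / 4)).
Proof.
move=> eps eps0 Clam Cc Clam0 Cc0.
have rho0 : 0 < rho by lra.
(* [M] will have size [x^e1]: the bound [rho / 64] keeps [100 M] below [y = x^(rho / 32)], and
   [eps / 8] lets [x^eps] absorb [M ^ 8]. *)
pose e1 := Rmin (rho / 64) (eps / 8).
have e10 : 0 < e1 by apply: Rmin_glb_lt; lra.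
have e1r : e1 <= rho / 64 by exact: Rmin_l.
have e1e : 8 * e1 <= eps by have : e1 <= eps / 8; [exact: Rmin_r|lra].
(* The exponent is divided by 5 because [setting] asks for the divisor bound up to [x ^ 5]. *)
have [Ct [Ct1 HCt]] := tau_bound (ltac:(lra) : 0 < e1 / 5).
(* The summands serve the divisor bound, [ln x ^ 2 <= M], [x < 2 ^ M] and [M >= 10]. *)
pose C0 := Ct + 4 / e1 ^ 2 + 2 / e1 + 10.
have p1 : 0 < 4 / e1 ^ 2 by positivity.
have p2 : 0 < 2 / e1 by positivity.
have C0a : Ct <= C0 by rewrite /C0; lra.
have C0b : 4 / e1 ^ 2 <= C0 by rewrite /C0; lra.
have C0c : 2 / e1 <= C0 by rewrite /C0; lra.
have C0d : 10 <= C0 by rewrite /C0; lra.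
clearbody C0.
(* [402 = 2 * 201] comes from the two signs of [k] and [fixed_k_bound], and [2 * C0] from
   [M <= 2 C0 x^e1]. The threshold gives [200 C0 <= x^(rho / 64)]. *)
exists (402 * Cc * Clam * (2 * C0) ^ 8), (Rpower (200 * C0) (64 / rho)).
have C8 : 0 < (2 * C0) ^ 8 by positivity.
split; first by positivity.
move=> x hx.
have x64 : 200 * C0 <= Rpower x (rho / 64).
  have -> : 200 * C0 = Rpower (Rpower (200 * C0) (64 / rho)) (rho / 64).
    by rewrite Rpower_mult (_ : 64 / rho * (rho / 64) = 1) ?Rpower_1; [lra|lra|field; lra].
  by apply: Rle_Rpower_l; [lra|split => //; exact: Rpower_pos].
have x0 : 0 < x by apply: Rlt_le_trans hx; exact: Rpower_pos.
have x1 : 1 <= x.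
  apply: Rle_trans hx; rewrite -(Rpower_O (200 * C0)); last lra.
  by apply: Rpower_le_exp; [lra|left; apply: Rdiv_lt_0_compat; lra].
pose y := Rpower x (rho / 32).
pose B := C0 * Rpower x e1.
have xe1 : 1 <= Rpower x e1 by rewrite -(Rpower_O x) //; apply: Rpower_le_exp; lra.
have B10 : 10 <= B by rewrite /B; nra.
have B0 : 0 <= B by lra.
have [B1 B2] := natflP B0.
pose M := (natfl B).+1.
have MB : B <= INR M by rewrite /M S_INR; lra.
have M2B : INR M <= 2 * B by rewrite /M S_INR; lra.
have y0 : 0 < y by exact: Rpower_pos.
have My : 100 * INR M <= y.
  have -> : y = Rpower x (rho / 64) * Rpower x (rho / 64).
    by rewrite /y -Rpower_plus; congr Rpower; lra.
  have : Rpower x e1 <= Rpower x (rho / 64) by apply: Rpower_le_exp.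
  move=> h; apply: Rle_trans (_ : (200 * C0) * Rpower x e1 <= _).
    by move: M2B; rewrite /B; lra.
  by apply: Rmult_le_compat => //; lra.
(* This uses [150 / 32 * rho < 1], which follows from [rho < 11 / 54]. *)
have y150 : y ^ 150 <= x.
  rewrite /y Rpower_nat -[X in _ <= X](Rpower_1 x) //; apply: Rpower_le_exp => //.
  by rewrite INR_IZR_INZ /=; lra.
have y1 : 1 <= y by lra.
have lnx : 0 < ln x.
  have : 1 < x.
    case: (Rle_lt_or_eq_dec 1 x x1) => // e.
    by move: x64; rewrite -e /Rpower ln_1 Rmult_0_r exp_0; lra.
  by rewrite -ln_1 => h; apply: ln_increasing; lra.
have yx : y <= x.
  by apply: Rle_trans y150; rewrite -{1}(pow_1 y); apply: Rle_pow => //; lia.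
have lnx1 : 1 <= ln x.
  apply: Rle_trans (_ : ln (exp 1) <= _); first by rewrite ln_exp; lra.
  by apply: ln_le; [exact: exp_pos|have := exp_le_3; lra].
have lnx2 : ln x ^ 2 <= INR M.
  apply: Rle_trans MB; have h := ln_le_Rpower (ltac:(lra) : 0 < e1 / 2) x0.
  apply: Rle_trans (_ : (/ (e1 / 2) * Rpower x (e1 / 2)) ^ 2 <= _).
    by apply: pow_incr; lra.
  have -> : (/ (e1 / 2) * Rpower x (e1 / 2)) ^ 2 = 4 / e1 ^ 2 * (Rpower x (e1 / 2)) ^ 2 by field; lra.
  rewrite Rpower_nat (_ : e1 / 2 * INR 2 = e1); last by rewrite (_ : INR 2 = 2) //; lra.
  by apply: Rmult_le_compat_r; lra.
have Hlog : x < INR (2 ^ M).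
  rewrite exp_INR (_ : INR 2 = 2) //; apply: ln_lt_inv => //; first by positivity.
  rewrite ln_pow; last lra.
  have h := ln_le_Rpower e10 x0; have l2 := ln_lt_2.
  have h2 : 2 * ln x <= B.
    apply: Rle_trans (_ : 2 / e1 * Rpower x e1 <= _); first by rewrite /Rdiv; lra.
    by apply: Rmult_le_compat_r; lra.
  have M0 : 0 < INR M by lra.
  by nra.
have Htau u : (0 < u)%N -> INR u <= x ^ 5 -> (tau u <= M)%N.
  move=> u0 ux.
  have h : INR (tau u) <= B.
    apply: Rle_trans (HCt u u0) _; apply: Rmult_le_compat => //; [lra|left; exact: Rpower_pos|].
    apply: Rle_trans (_ : Rpower (x ^ 5) (e1 / 5) <= _).
      by apply: Rle_Rpower_l; [lra|split => //; exact: (ltn_INR (a := 0))].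
    rewrite -(Rpower_pow 5) // Rpower_mult (_ : INR 5 * (e1 / 5) = e1); first exact: Rle_refl.
    by rewrite (_ : INR 5 = 5); [lra|rewrite /=; ring].
  have : INR (tau u) < INR M by rewrite /M S_INR; lra.
  by move/INR_lt; lia.
move=> delta K Delta D alpha a q _ q0 gaq Hal lam Hlam Hws c Hc b beta.
have xth : 1 <= Rpower x theta by rewrite -(Rpower_O x) //; apply: Rpower_le_exp; lra.
have KE : K = Rpower x theta * ln x ^ 2.
  by rewrite /K /delta Rpower_Ropp Rinv_inv.
have K1 : 1 <= K.
  by rewrite KE; apply: mul_ge1 => //; have -> : ln x ^ 2 = ln x * ln x; [ring|apply: mul_ge1].
(* [M] covers the squared logarithm, and [theta < rho / 32] puts [x^theta] below [y]. *)
have KM : K <= INR M * y.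
  rewrite KE Rmult_comm; apply: Rmult_le_compat => //; [exact: pow2_ge_0|lra|].
  by apply: Rpower_le_exp; lra.
have DE : Delta = y ^ 32.
  rewrite /Delta /y Rpower_nat; congr Rpower; rewrite INR_IZR_INZ /=; field.
have y32 : 0 < y ^ 32 by positivity.
have K4 : 0 < K ^ 4 by positivity.
have xh : Rpower x (1 / 2) ^ 2 = x.
  by rewrite Rpower_nat (_ : 1 / 2 * INR 2 = 1) ?Rpower_1 // (_ : INR 2 = 2) //; lra.
have xhp := Rpower_pos x (1 / 2).
have D1 : 1 <= D.
  rewrite /D DE; apply: (proj1 (Rle_div_r _ _ _ _)); first exact: Rmult_lt_0_compat.
  have Ky : K <= y ^ 2.
    apply: Rle_trans KM _; have -> : y ^ 2 = y * y by ring.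
    by apply: Rmult_le_compat_r; lra.
  have K48 : K ^ 4 <= y ^ 8.
    have -> : y ^ 8 = (y ^ 2) ^ 4 by ring.
    by apply: pow_incr; lra.
  have h40 : y ^ 32 * K ^ 4 <= y ^ 40.
    have -> : y ^ 40 = y ^ 32 * y ^ 8 by ring.
    by apply: Rmult_le_compat_l; lra.
  have h80 : (y ^ 40) ^ 2 <= Rpower x (1 / 2) ^ 2.
    rewrite xh -pow_mult; apply: Rle_trans y150; apply: Rle_pow => //; lia.
  rewrite Rmult_1_l; apply: Rle_trans h40 _; apply: le_of_sqr_le h80; lra.
have D0 : 0 <= D by lra.
have DD : D ^ 2 * y ^ 64 <= x.
  have -> : D ^ 2 * y ^ 64 = Rpower x (1 / 2) ^ 2 / (K ^ 4) ^ 2 by rewrite /D DE; field; lra.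
  rewrite xh; apply: div_le_self; first lra.
  by rewrite -pow_mult -(pow1 (4 * 2)); apply: pow_incr; lra.
have y64 : 1 <= y ^ 64 by rewrite -(pow1 64); apply: pow_incr; lra.
have Dx : D <= x.
  apply: Rle_trans DD; have -> : D ^ 2 * y ^ 64 = D * (D * y ^ 64) by ring.
  rewrite -{1}(Rmult_1_r D); apply: Rmult_le_compat_l => //; exact: mul_ge1.
have q1 : 1 <= INR q by apply: (leq_INR (a := 1)).
have M10 : (10 <= M)%N.
  have : INR 9 < INR M by rewrite (_ : INR 9 = 9); [lra|rewrite /=; ring].
  by move/INR_lt; lia.
have MC : INR M ^ 8 <= (2 * C0) ^ 8 * Rpower x eps.
  apply: Rle_trans (_ : (2 * B) ^ 8 <= _); first by apply: pow_incr; lra.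
  have -> : (2 * B) ^ 8 = (2 * C0) ^ 8 * (Rpower x e1) ^ 8 by rewrite /B; ring.
  apply: Rmult_le_compat_l; first lra.
  rewrite Rpower_nat; apply: Rpower_le_exp => //; rewrite INR_IZR_INZ /=; lra.
set t1 := x * K / _; set t2 := x * K / _; set t3 := _ * _ * Rpower (INR q) (1 / 32); set t4 := _ / Rpower (INR q) (1 / 4).
set t5 := _ * Rpower (INR q) (1 / 4).
have xK : 0 < x * K by positivity.
have pd u v : 0 < u -> 0 < v -> 0 < u / v by move=> *; apply: Rdiv_lt_0_compat.
have t1p : 0 < t1 by apply: pd => //; exact: Rpower_pos.
have t2p : 0 < t2 by apply: pd => //; exact: Rpower_pos.
have t3p : 0 < t3 by repeat (apply: Rmult_lt_0_compat); exact: Rpower_pos.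
have t4p : 0 < t4.
  by apply: pd; [apply: Rmult_lt_0_compat; [apply: Rmult_lt_0_compat => //; exact: Rpower_pos|lra]|exact: Rpower_pos].
have t5p : 0 < t5 by repeat (apply: Rmult_lt_0_compat); exact: Rpower_pos.
have M8p : 1 <= INR M ^ 8 by rewrite -(pow1 8); apply: pow_incr; lra.
have CC : 0 < Cc * Clam by positivity.
suff [t [tsum Wt]] : exists t, t <= t1 + t2 + t3 + t4 + t5 /\ Cmod (W x D K alpha beta b lam c) <= 402 * (Cc * Clam) * INR M ^ 8 * t.
  have s0 : 0 < t1 + t2 + t3 + t4 + t5 by lra.
  apply: Rle_trans Wt _.
  apply: Rle_trans (_ : 402 * (Cc * Clam) * INR M ^ 8 * (t1 + t2 + t3 + t4 + t5) <= _).
    by apply: Rmult_le_compat_l => //; apply: Rmult_le_pos; lra.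
  apply: Rmult_le_compat_r; first lra.
  have -> : 402 * Cc * Clam * (2 * C0) ^ 8 * Rpower x eps = 402 * (Cc * Clam) * ((2 * C0) ^ 8 * Rpower x eps) by ring.
  by apply: Rmult_le_compat_l; lra.
have [Dn1 Dn2] := natflP D0.
have Delta2 : Rpower Delta (1 / 2) = y ^ 16.
  rewrite /Delta Rpower_mult /y Rpower_nat; congr Rpower; rewrite INR_IZR_INZ /=; field.
have KCc : 0 <= 2 * K * Cc by positivity.
have M7 : 1 <= INR M ^ 5 by rewrite -(pow1 5); apply: pow_incr; lra.
have M3 : 0 <= INR M ^ 3 by positivity.
have Am0 : 0 <= Clam * INR M by positivity.
have trivial : Cmod (W x D K alpha beta b lam c) <= 402 * (Cc * Clam) * INR M ^ 8 * (x * K).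
  apply: Rle_trans (_ : 2 * K * Cc * (2 * (Clam * INR M) * INR M ^ 2 * x) <= _).
    apply: W_bound => //; [lra|lra| |].
      by positivity.
    move=> k k1 kK; apply: triv_bound => //.
    - lra.
    - move=> d /andP [d0 dD].
      have dDr : INR d <= D by apply/(le_natfl _ D0).
      apply: Rle_trans (Hlam d d0 dDr) _; apply: Rmult_le_compat_l; first lra.
      apply: leq_INR; apply: Htau => //; apply: Rle_trans dDr _; apply: Rle_trans Dx _.
      by rewrite -{1}(pow_1 x); apply: Rle_pow => //; lia.
  have -> : 2 * K * Cc * (2 * (Clam * INR M) * INR M ^ 2 * x) = (Cc * Clam * INR M ^ 3 * (x * K)) * 4 by ring.
  have -> : 402 * (Cc * Clam) * INR M ^ 8 * (x * K) = (Cc * Clam * INR M ^ 3 * (x * K)) * (402 * INR M ^ 5) by ring.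
  apply: Rmult_le_compat_l; last by lra.
  by positivity.
have qp := Rpower_pos (INR q) (1 / 4).
(* The threshold [y ^ 64] is chosen for [Delta^(1/2) = y^16 = (y^64)^(1/4)]: below it [t4] is at
   least [x * K]. *)
case: (Rle_lt_dec (INR q) (y ^ 64)) => hq1.
  exists (x * K); split => //.
  suff : x * K <= t4 by lra.
  rewrite /t4 Delta2; apply: (proj1 (Rle_div_r _ _ _ qp)).
  have -> : x * y ^ 16 * K = x * K * y ^ 16 by ring.
  apply: Rmult_le_compat_l; first lra.
  have -> : y ^ 16 = Rpower (y ^ 64) (1 / 4).
    rewrite /y !Rpower_nat Rpower_mult; congr Rpower; rewrite !INR_IZR_INZ /=; field.
  by apply: Rle_Rpower_l; lra.
case: (Rle_lt_dec (x ^ 2 * K) (INR q * y ^ 64)) => hq2.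
  exists (x * K); split => //.
  suff : x * K <= t5 by lra.
  rewrite /t5 Delta2.
  have y16 : 0 < y ^ 16 by positivity.
  have h : Rpower (x ^ 2 * K) (1 / 4) <= Rpower (INR q) (1 / 4) * y ^ 16.
    have -> : y ^ 16 = Rpower (y ^ 64) (1 / 4).
      rewrite /y !Rpower_nat Rpower_mult; congr Rpower; rewrite !INR_IZR_INZ /=; field.
    rewrite Rpower_mult_distr; [|lra|lra].
    apply: Rle_Rpower_l; first lra.
    by split => //; apply: Rmult_lt_0_compat; [apply: pow_lt|lra].
  (* Written this way, [x * K] differs from [t5] only in having [(x^2 K)^(1/4)] in place of
     [q^(1/4) y^16]. *)
  have e : x * K = Rpower x (1 / 2) * Rpower K (3 / 4) * Rpower (x ^ 2 * K) (1 / 4).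
    rewrite -Rpower_mult_distr; [|by apply: pow_lt|lra].
    rewrite -(Rpower_pow 2) // Rpower_mult.
    have -> : INR 2 * (1 / 4) = 1 / 2 by rewrite (_ : INR 2 = 2) //; lra.
    have -> : Rpower x (1 / 2) * Rpower K (3 / 4) * (Rpower x (1 / 2) * Rpower K (1 / 4)) =
      (Rpower x (1 / 2) * Rpower x (1 / 2)) * (Rpower K (3 / 4) * Rpower K (1 / 4)) by ring.
    rewrite -!Rpower_plus (_ : 1 / 2 + 1 / 2 = 1); last lra.
    by rewrite (_ : 3 / 4 + 1 / 4 = 1) ?Rpower_1; [|lra|lra|lra].
  rewrite e.
  have -> : Rpower x (1 / 2) * y ^ 16 * Rpower K (3 / 4) * Rpower (INR q) (1 / 4) =
     Rpower x (1 / 2) * Rpower K (3 / 4) * (Rpower (INR q) (1 / 4) * y ^ 16) by ring.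
  apply: Rmult_le_compat_l h; left; apply: Rmult_lt_0_compat; exact: Rpower_pos.
have t1E : t1 = x * K / y.
  rewrite /t1; congr Rdiv; rewrite /Delta Rpower_mult /y; congr Rpower; lra.
exists t1; split; first lra.
have xy0 : 0 < x / y by exact: pd.
apply: Rle_trans (_ : 2 * K * Cc * (201 * Clam * INR M ^ 8 * (x / y)) <= _); last first.
  by rewrite t1E; right; field; lra.
apply: W_bound => //; [lra|lra| |].
  by positivity.
move=> k k1 kK; apply: (fixed_k_bound (K := K) (q := q)) => //; [|lra].
apply: Setting => //; try lra.
by move=> eta Y eta0; exact: (cnt_mul_le Y q0 gaq Hal eta0 k1 kK).
Qed.
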